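(* Let $0\le\alpha<n$, $m\in\mathbb{N}\cap\left(1-\frac{\alpha}{n},+\infty\right)$, and let $p(\cdot), q(\cdot)\in\mathbb{P}_{0}(0,\infty)$ be such that $0<p_{+},\,q_{+}<\frac{n}{\alpha}$ (with $\frac{n}{\alpha}=\infty$ if $\alpha=0$), $q(0)\le p(0)$ and $p(\infty)\le q(\infty)$. Let \[ T_{\alpha,m}f(x)=\int_{\mathbb{R}^n}|x-A_1y|^{-\alpha_1}\cdots|x-A_my|^{-\alpha_m}f(y)\,dy , \] where $\alpha_1+\cdots+\alpha_m=n-\alpha$ and $A_1,\dots,A_m$ are $n\times n$ orthogonal matrices; in the case $\alpha=0$, assume in addition that $A_i-A_j$ is invertible if $i\ne j$. Then, for $\frac{1}{u(t)}:=\frac{1}{p(t)}-\frac{\alpha}{n}$ and $\frac{1}{v(t)}:=\frac{1}{q(t)}-\frac{\alpha}{n}$, the operator $T_{\alpha,m}$ extends to a bounded operator $H^{p(\cdot),q(\cdot)}(\mathbb{R}^n)\to\mathfrak{L}^{u(\cdot),v(\cdot)}(\mathbb{R}^n)$.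
   Context: A variable exponent on $(0,\infty)$ is a measurable function $p(\cdot):(0,\infty)\to(0,\infty)$; put $p_{-}=\operatorname{ess\,inf}_{t\in(0,\infty)}p(t)$ and $p_{+}=\operatorname{ess\,sup}_{t\in(0,\infty)}p(t)$. $\mathbb{P}_0(0,\infty)$ is the class of variable exponents with $0<p_{-}\le p_{+}<\infty$ for which the limits $p(0)=\lim_{t\to0^+}p(t)$ and $p(\infty)=\lim_{t\to\infty}p(t)$ exist and, for some constant $C>0$ independent of $t$, $|p(t)-p(0)|\le \frac{C}{-\log t}$ for $0<t<\frac12$ and $|p(t)-p(\infty)|\le\frac{C}{\log(e+t)}$ for $0<t<\infty$. For measurable $f$ on $\mathbb{R}^n$, the non-increasing rearrangement is $f^{*}(t)=\inf\{s\ge 0: |\{x\in\mathbb{R}^n:|f(x)|>s\}|\le t\}$, $0<t<\infty$. Put $\rho_{p(\cdot),q(\cdot)}(f)=\int_0^\infty t^{\frac{q(t)}{p(t)}-1}[f^{*}(t)]^{q(t)}\,dt$. The variable Lorentz space $\mathfrak{L}^{p(\cdot),q(\cdot)}(\mathbb{R}^n)$ is the set of measurable $f$ with $\rho_{p(\cdot),q(\cdot)}(f)<\infty$, equipped with $\|f\|_{\mathfrak{L}^{p(\cdot),q(\cdot)}}=\inf\{\lambda>0:\rho_{p(\cdot),q(\cdot)}(f/\lambda)\le 1\}$. Hardy space: fix $r\in(0,\min\{1,p_{-},q_{-}\})$ and an integer $L\ge\lfloor n/r+3\rfloor$. Let $\mathcal{F}_L$ be the set of $\varphi\in\mathcal{S}(\mathbb{R}^n)$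 with $\sum_{|\beta|\le L}\sup_{x\in\mathbb{R}^n}(1+|x|)^L|\partial^\beta\varphi(x)|\le1$, let $\phi_t(x)=t^{-n}\phi(t^{-1}x)$, and for $f\in\mathcal{S}'(\mathbb{R}^n)$ let $\mathcal{M}^0_Lf(x)=\sup\{|(\phi_t*f)(x)|:t>0,\ \phi\in\mathcal{F}_L\}$. Then $H^{p(\cdot),q(\cdot)}(\mathbb{R}^n)=\{f\in\mathcal{S}'(\mathbb{R}^n):\|f\|_{H^{p(\cdot),q(\cdot)}}:=\|\mathcal{M}^0_Lf\|_{\mathfrak{L}^{p(\cdot),q(\cdot)}}<\infty\}$.
   Formalization: The exponents α_1,…,α_m are assumed positive; without this the claim fails, e.g. α=0, m=2, (α_1,α_2)=(n,0), A_1=I, A_2=−I, where the integral with kernel |x−y|^{−n} diverges. *)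

(* Defs.v *)
From HB Require Import structures.
From mathcomp Require Import all_boot all_order all_algebra.
From mathcomp Require Import all_classical all_reals all_analysis.
From mathcomp Require Import ess_sup_inf complex ring lra.

Set Implicit Arguments.
Unset Strict Implicit.
Unset Printing Implicit Defensive.
Import Order.TTheory GRing.Theory Num.Theory.
Import numFieldNormedType.Exports.
Import Normc.
Local Open Scope classical_set_scope.
Local Open Scope ring_scope.

(* Points of R^n are column vectors 'cV[R]_n, so that a matrix acts by A *m x.
   The library norm on matrices is the sup norm; the Euclidean norm is enorm
   below. *)

Definition measure_matrix_display : measure_display -> measure_display.
Proof. exact. Qed.

Section measurable_matrix.
Context d (T : measurableType d) (m n : nat).

Definition matrix_cylinders : set (set 'M[T]_(m, n)) :=
  [set A | exists (i : 'I_m) (j : 'I_n) (B : set T),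
    measurable B /\ A = [set M : 'M[T]_(m, n) | B (M i j)]].

HB.instance Definition _ := @isMeasurable.Build (measure_matrix_display d)
  'M[T]_(m, n) <<s matrix_cylinders >> (@sigma_algebra0 _ _ _)
  (@sigma_algebraC _ _) (@sigma_algebra_bigcup _ _ _).

Lemma measurable_entry i j :
  measurable_fun [set: 'M[T]_(m, n)] (fun M : 'M[T]_(m, n) => M i j).
Proof.
move=> _ B mB; rewrite setTI; apply: sub_sigma_algebra.
by exists i, j, B.
Qed.

Lemma measurable_fun_matrix d' (U : measurableType d') (f : U -> 'M[T]_(m, n)) :
  (forall i j, measurable_fun setT (fun x => f x i j)) -> measurable_fun setT f.
Proof.
move=> mf; apply: (@measurability _ _ _ _ _ _ matrix_cylinders) => //.
move=> _ [_ [i [j [B [mB ->]]]] <-].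
exact: mf.
Qed.
End measurable_matrix.

(* Lebesgue measure on R^n.+1 is the image of the product of the Lebesgue measures
   on R and R^n; on the one-point space R^0 it is the unit mass. *)
Section lebesgue.
Context {R : realType}.

Definition cons_cV n (p : R * 'cV[R]_n) : 'cV[R]_n.+1 := col_mx p.1%:M p.2.
Lemma measurable_cons_cV n : measurable_fun setT (@cons_cV n).
Proof.
apply: measurable_fun_matrix => i j.
rewrite /cons_cV.
under eq_fun do rewrite mxE.
case: (@fintype.splitP 1 n i) => k _.
  by under eq_fun do rewrite !mxE (ord1 k) (ord1 j); exact: measurable_fst.
exact: (measurableT_comp (measurable_entry k j)).
Qed.

Definition uncons_cV n (v : 'cV[R]_n.+1) : R * 'cV[R]_n :=
 (@usubmx R 1 n 1 v ord0 ord0, @dsubmx R 1 n 1 v).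
Lemma measurable_uncons_cV n : measurable_fun setT (@uncons_cV n).
Proof.
apply: measurable_fun_pair.
  under eq_fun do rewrite mxE.
  exact: measurable_entry.
apply: measurable_fun_matrix => i j.
under eq_fun do rewrite mxE.
exact: measurable_entry.
Qed.

Lemma cons_cVK n : cancel (@cons_cV n) (@uncons_cV n).
Proof.
by move=> [x v]; rewrite /cons_cV /uncons_cV col_mxKu col_mxKd mxE eqxx.
Qed.


Section step.
Variables (n : nat) (mu : {sigma_finite_measure set 'cV[R]_n -> \bar R}).
Definition lebesgue_step : set 'cV[R]_n.+1 -> \bar R :=
  pushforward (@lebesgue_measure R \x mu)%E (@cons_cV n).
HB.instance Definition _ := Measure.copy lebesgue_step
  (measure_function_pushforward__canonical__measure_function_Measure
     (@lebesgue_measure R \x mu)%E (@measurable_cons_cV n)).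
Lemma lebesgue_step_sigma_finite : sigma_finite setT lebesgue_step.
Proof.
have /sigma_finiteP[F [TF ndF Foo]] := sigma_finiteT (@lebesgue_measure R).
have /sigma_finiteP[G [TG ndG Goo]] := sigma_finiteT mu.
exists (fun k => @uncons_cV n @^-1` (F k `*` G k)).
  rewrite -preimage_bigcup [X in _ @^-1` X](_ : _ = setT) ?preimage_setT//.
  apply/seteqP; split=> // -[x y] _.
  have [i _ Fx] : (\bigcup_i F i) x by rewrite -TF.
  have [j _ Gy] : (\bigcup_i G i) y by rewrite -TG.
  exists (maxn i j) => //; split => /=.
  - by move: x Fx; exact/subsetPset/ndF/leq_maxl.
  - by move: y Gy; exact/subsetPset/ndG/leq_maxr.
move=> k; have [mF Fk] := Foo k; have [mG Gk] := Goo k; split.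
  rewrite -[X in measurable X]setTI; apply: measurable_uncons_cV => //.
  exact: measurableX.
rewrite /lebesgue_step /pushforward -comp_preimage.
rewrite (_ : _ \o _ = id); last by apply/funext => x /=; rewrite cons_cVK.
by rewrite preimage_id product_measure1E// lte_mul_pinfty// ge0_fin_numE.
Qed.
HB.instance Definition _ :=
  @Measure_isSigmaFinite.Build _ _ R lebesgue_step lebesgue_step_sigma_finite.
End step.

Fixpoint lebesgue_rn n : {sigma_finite_measure set 'cV[R]_n -> \bar R} :=
  if n is k.+1 then lebesgue_step (lebesgue_rn k) else \d_ (0 : 'cV[R]_0).

End lebesgue.
Arguments lebesgue_rn {R} n.

Local Notation Re := (@complex.Re _).
Local Notation Im := (@complex.Im _).

Section schwartz.
Context {R : realType}.

Definition enorm n (x : 'cV[R]_n) : R :=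
  Num.sqrt (\sum_i x i ord0 ^+ 2).

Definition complex_differentiable n (f : 'cV[R]_n -> R[i]) (x : 'cV[R]_n) :
    Prop :=
  differentiable (Re \o f) x /\ differentiable (Im \o f) x.

Definition pderiv n (i : 'I_n) (f : 'cV[R]_n -> R[i]) : 'cV[R]_n -> R[i] :=
  fun x => Complex ('D_(delta_mx i ord0) (Re \o f) x)
                   ('D_(delta_mx i ord0) (Im \o f) x).

Definition pderivs n (s : seq 'I_n) (f : 'cV[R]_n -> R[i]) : 'cV[R]_n -> R[i] :=
  foldr (@pderiv n) f s.

Definition smooth n (f : 'cV[R]_n -> R[i]) : Prop :=
  forall s x, complex_differentiable (pderivs s f) x.

Definition multi_pderiv n (b : 'I_n -> nat) :
    ('cV[R]_n -> R[i]) -> 'cV[R]_n -> R[i] :=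
  pderivs (flatten [seq nseq (b i) i | i <- enum 'I_n]).

Definition schwartz_norm n (N : nat) (f : 'cV[R]_n -> R[i]) : \bar R :=
  (\sum_(b : {ffun 'I_n -> 'I_N.+1} | (\sum_i b i <= N)%N)
    ereal_sup (range (fun x : 'cV[R]_n =>
      ((1 + enorm x) ^+ N * normc (multi_pderiv (fun i => b i) f x))%:E)))%E.

Definition is_schwartz n (f : 'cV[R]_n -> R[i]) : Prop :=
  smooth f /\ forall N, (schwartz_norm N f < +oo)%E.

Section pderiv.
Variable n : nat.
Implicit Types (f g : 'cV[R]_n -> R[i]) (a : R[i]).

Lemma ReZD a f g : Re \o (a *: f + g) =
  Re a *: (Re \o f) - Im a *: (Im \o f) + (Re \o g).
Proof.
apply/funext => x; rewrite /= !fctE/=.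
by case: a (f x) (g x) => [? ?] [? ?] [? ?].
Qed.
Lemma ImZD a f g : Im \o (a *: f + g) =
  Re a *: (Im \o f) + Im a *: (Re \o f) + (Im \o g).
Proof.
apply/funext => x; rewrite /= !fctE/=.
by case: a (f x) (g x) => [? ?] [? ?] [? ?].
Qed.

Lemma complex_differentiableZD a f g x :
  complex_differentiable f x -> complex_differentiable g x ->
  complex_differentiable (a *: f + g) x.
Proof.
move=> [f1 f2] [g1 g2]; rewrite /complex_differentiable ReZD ImZD; split.
  exact: (differentiableD (differentiableB (differentiableZ _ f1) (differentiableZ _ f2)) g1).
exact: (differentiableD (differentiableD (differentiableZ _ f2) (differentiableZ _ f1)) g2).
Qed.

Lemma pderivZD i a f g : (forall x, complex_differentiable f x) ->
  (forall x, complex_differentiable g x) ->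
  pderiv i (a *: f + g) = a *: pderiv i f + pderiv i g.
Proof.
move=> df dg; apply/funext => x; rewrite /pderiv ReZD ImZD.
have [f1 f2] := df x; have [g1 g2] := dg x.
have [{}f1 {}f2] := (diff_derivable (v := delta_mx i ord0) f1, diff_derivable (v := delta_mx i ord0) f2).
have [{}g1 {}g2] := (diff_derivable (v := delta_mx i ord0) g1, diff_derivable (v := delta_mx i ord0) g2).
have fZ1 b : derivable (b *: (Re \o f)) x (delta_mx i ord0) by exact: derivableZ.
have fZ2 b : derivable (b *: (Im \o f)) x (delta_mx i ord0) by exact: derivableZ.
have E1 : 'D_(delta_mx i ord0) (Re a *: (Re \o f) - Im a *: (Im \o f) + (Re \o g)) x =
    Re a * Re (pderiv i f x) - Im a * Im (pderiv i f x) + Re (pderiv i g x).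
  by rewrite (deriveD (derivableB (fZ1 _) (fZ2 _)) g1) (deriveB (fZ1 _) (fZ2 _)) (deriveZ _ f1) (deriveZ _ f2).
have E2 : 'D_(delta_mx i ord0) (Re a *: (Im \o f) + Im a *: (Re \o f) + (Im \o g)) x =
    Re a * Im (pderiv i f x) + Im a * Re (pderiv i f x) + Im (pderiv i g x).
  by rewrite (deriveD (derivableD (fZ2 _) (fZ1 _)) g2) (deriveD (fZ2 _) (fZ1 _)) (deriveZ _ f1) (deriveZ _ f2).
by rewrite E1 E2; case: (a).
Qed.

Lemma pderivsZD s a f g : smooth f -> smooth g ->
  pderivs s (a *: f + g) = a *: pderivs s f + pderivs s g.
Proof.
move=> sf sg; elim: s => //= i s ->; apply: pderivZD => x; [exact: sf|exact: sg].
Qed.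

Lemma smoothZD a f g : smooth f -> smooth g -> smooth (a *: f + g).
Proof.
by move=> sf sg s x; rewrite pderivsZD//; apply: complex_differentiableZD.
Qed.


Lemma differentiable_affine (c : R) (x y : 'cV[R]_n) (F : 'cV[R]_n -> R) :
  differentiable F (c *: (x - y)) ->
  differentiable (F \o (fun z => c *: (x - z))) y /\
  forall v, 'D_v (F \o (fun z => c *: (x - z))) y = - c * 'D_v F (c *: (x - y)).
Proof.
pose h (z : 'cV[R]_n) : 'cV[R]_n := c *: (x - z).
rewrite -[c *: (x - y)]/(h y) -[fun z => _]/h => dF.
have dh : is_diff y h (c *: (0 - id)).
  rewrite (_ : h = c *: (cst x - id)); last exact/funext.
  exact: is_diffZ.
have dFh : differentiable (F \o h) y by apply: differentiable_comp => //; exact: ex_diff.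
split; first exact: dFh.
move=> v; have dh1 : differentiable h y by exact: ex_diff.
rewrite (deriveE _ dFh).
rewrite (deriveE _ dF).
transitivity ('d F (h y) ('d h y v)).
  exact: (congr1 (@^~ v) (diff_comp dh1 dF)).
have -> : 'd h y v = - c *: v.
  have -> : 'd h y v = (c *: (0 - id)) v by rewrite (@diff_val _ _ _ _ _ _ _ dh).
  by rewrite fctE/= sub0r scalerN scaleNr.
exact: linearZ.
Qed.

Lemma pderiv_affine i (c : R) x f : (forall y, complex_differentiable f y) ->
  pderiv i (f \o (fun y => c *: (x - y))) =
  (- c%:C)%C *: (pderiv i f \o (fun y => c *: (x - y))).
Proof.
move=> df; apply/funext => y; have [df1 df2] := df (c *: (x - y)).
have [_ D1] := differentiable_affine df1.
have [_ D2] := differentiable_affine df2.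
rewrite /pderiv -[Re \o (f \o _)]/((Re \o f) \o _) -[Im \o (f \o _)]/((Im \o f) \o _).
rewrite D1 D2.
set a := 'D_ _ _ _; set b := 'D_ _ _ _.
rewrite !fctE -/a -/b.
by congr Complex; rewrite /= oppr0 mul0r ?subr0 ?addr0.
Qed.

Lemma complex_differentiable_affine (c : R) x y f :
  complex_differentiable f (c *: (x - y)) ->
  complex_differentiable (f \o (fun y => c *: (x - y))) y.
Proof.
by move=> [/differentiable_affine[+ _] /differentiable_affine[+ _]].
Qed.

Lemma complex_differentiable0 x : complex_differentiable (0 : 'cV[R]_n -> R[i]) x.
Proof.
by split; [rewrite (_ : Re \o 0 = cst 0)|rewrite (_ : Im \o 0 = cst 0)];
  first exact: differentiable_cst.
Qed.

Lemma pderivZ i a f : (forall y, complex_differentiable f y) ->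
  pderiv i (a *: f) = a *: pderiv i f.
Proof.
move=> df; have pd0 : pderiv i (0 : 'cV[R]_n -> R[i]) = 0.
  have := pderivZD i (-1) complex_differentiable0 complex_differentiable0.
  by rewrite scaler0 addr0 scaleN1r addNr.
by have := pderivZD i a df complex_differentiable0; rewrite !addr0 pd0 addr0.
Qed.

Lemma pderivs0 s : pderivs s (0 : 'cV[R]_n -> R[i]) = 0.
Proof.
elim: s => //= i s ->.
by have := pderivZ i 0 complex_differentiable0; rewrite !scale0r.
Qed.

Lemma smooth0 : smooth (0 : 'cV[R]_n -> R[i]).
Proof. by move=> s x; rewrite pderivs0; exact: complex_differentiable0. Qed.

Lemma pderivs_affine s (c : R) x f : smooth f ->
  pderivs s (f \o (fun y => c *: (x - y))) =
  (- c%:C)%C ^+ size s *: (pderivs s f \o (fun y => c *: (x - y))).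
Proof.
move=> sf; elim: s => [|i s IHs] /=; first by rewrite expr0 scale1r.
rewrite IHs pderivZ; last first.
  by move=> y; apply: complex_differentiable_affine; exact: sf.
rewrite pderiv_affine; last exact: sf.
by rewrite scalerA exprSr.
Qed.


Lemma enorm_ge0 (x : 'cV[R]_n) : 0 <= enorm x.
Proof. exact: sqrtr_ge0. Qed.

Lemma enorm1_ge0 (x : 'cV[R]_n) : 0 <= 1 + enorm x.
Proof. exact: (addr_ge0 ler01 (enorm_ge0 x)). Qed.

Lemma enormX_ge0 N (x : 'cV[R]_n) : 0 <= (1 + enorm x) ^+ N.
Proof. exact: (exprn_ge0 N (enorm1_ge0 x)). Qed.

Lemma le_entry_enorm (x : 'cV[R]_n) i : `|x i ord0| <= enorm x.
Proof.
rewrite -sqrtr_sqr ler_wsqrtr// (bigD1 i)//= lerDl.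
by apply: sumr_ge0 => j _; exact: sqr_ge0.
Qed.

Lemma le_enorm_sum (x : 'cV[R]_n) : enorm x <= \sum_i `|x i ord0|.
Proof.
rewrite -[leRHS]ger0_norm; last exact: sumr_ge0.
rewrite -sqrtr_sqr ler_wsqrtr// expr2 mulr_suml; apply: ler_sum => i _.
rewrite -real_normK ?num_real// expr2 ler_wpM2l// (bigD1 i)//= lerDl.
exact: sumr_ge0.
Qed.

Lemma normc_ge0 (z : R[i]) : 0 <= normc z.
Proof. by case: z => ? ?; exact: sqrtr_ge0. Qed.

Lemma schwartz_normP N f : (schwartz_norm N f < +oo)%E <->
  forall b : {ffun 'I_n -> 'I_N.+1}, (\sum_i b i <= N)%N -> exists M, forall x,
    (1 + enorm x) ^+ N * normc (multi_pderiv (fun i => b i) f x) <= M.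
Proof.
have ge0 b : (0 <= ereal_sup (range (fun x : 'cV[R]_n =>
  ((1 + enorm x) ^+ N * normc (multi_pderiv b f x))%:E)))%E.
  apply: (@le_trans _ _ ((1 + enorm 0) ^+ N * normc (multi_pderiv b f 0))%:E).
    rewrite lee_fin; exact: (mulr_ge0 (enormX_ge0 N 0) (normc_ge0 _)).
  apply: ereal_sup_ubound; exact: (imageT (fun x : 'cV[R]_n => ((1 + enorm x) ^+ N * normc (multi_pderiv b f x))%:E) 0).
split=> [foo b bN|fM].
- have boo : (ereal_sup (range (fun x : 'cV[R]_n =>
    ((1 + enorm x) ^+ N * normc (multi_pderiv (fun i => b i) f x))%:E)) < +oo)%E.
    apply: le_lt_trans foo; rewrite /schwartz_norm (bigD1 b)//= leeDl//.
    by apply: sume_ge0 => *; exact: ge0.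
  exists (fine (ereal_sup (range (fun x : 'cV[R]_n =>
    ((1 + enorm x) ^+ N * normc (multi_pderiv (fun i => b i) f x))%:E)))) => x.
  rewrite -lee_fin fineK; last by rewrite ge0_fin_numE.
  by apply: ereal_sup_ubound; exact: imageT.
- apply: lte_sum_pinfty => b bN; have [M fMb] := fM b bN.
  apply: (@le_lt_trans _ _ M%:E); last exact: ltry.
  by apply: ge_ereal_sup => _ [x _ <-]; rewrite lee_fin.
Qed.

Lemma multi_pderivZD (b : 'I_n -> nat) a f g : smooth f -> smooth g ->
  multi_pderiv b (a *: f + g) = a *: multi_pderiv b f + multi_pderiv b g.
Proof. exact: pderivsZD. Qed.

Lemma is_schwartz0 : is_schwartz (0 : 'cV[R]_n -> R[i]).
Proof.
split=> [|N]; first exact: smooth0.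
apply/schwartz_normP => b _; exists 0 => x.
rewrite /multi_pderiv pderivs0 [normc _](_ : _ = 0) ?mulr0//.
exact: normc0.
Qed.

Lemma is_schwartzZD a f g :
  is_schwartz f -> is_schwartz g -> is_schwartz (a *: f + g).
Proof.
move=> [sf fN] [sg gN]; split=> [|N]; first exact: smoothZD.
apply/schwartz_normP => b bN.
have [M fM] := (schwartz_normP N f).1 (fN N) b bN.
have [M' gM] := (schwartz_normP N g).1 (gN N) b bN.
exists (normc a * M + M') => x.
rewrite multi_pderivZD// !fctE.
have w0 := enormX_ge0 N x.
apply: (@le_trans _ _ ((1 + enorm x) ^+ N * (normc a * normc (multi_pderiv (fun i => b i) f x)
   + normc (multi_pderiv (fun i => b i) g x)))).
  rewrite ler_wpM2l// -normcM.
  exact: le_normcD.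
by rewrite mulrDr lerD// mulrCA ler_wpM2l// normc_ge0.
Qed.

Lemma is_schwartz_affine (c : R) x f : 0 < c -> is_schwartz f ->
  is_schwartz (f \o (fun y => c *: (x - y))).
Proof.
move=> c0 [sf fN]; split=> [|N].
  move=> s y; rewrite pderivs_affine//.
  rewrite -[X in complex_differentiable X]addr0.
  apply: complex_differentiableZD; last exact: complex_differentiable0.
  exact/complex_differentiable_affine/sf.
apply/schwartz_normP => b bN.
have [M fM] := (schwartz_normP N f).1 (fN N) b bN.
set s := flatten [seq nseq (b i) i | i <- enum 'I_n].
have M0 : 0 <= M.
  exact: (le_trans (mulr_ge0 (enormX_ge0 N 0) (normc_ge0 _)) (fM 0)).
pose K := 1 + \sum_i `|x i ord0| + n%:R * c^-1.
have K0 : 0 <= K.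
  by rewrite /K !addr_ge0 ?sumr_ge0// mulr_ge0// invr_ge0 ltW.
exists (K ^+ N * (normc ((- c%:C)%C ^+ size s) * M)) => y.
rewrite /multi_pderiv pderivs_affine// !fctE.
set z := c *: (x - y).
have yz : 1 + enorm y <= K * (1 + enorm z).
  have yx i : `|y i ord0| <= `|x i ord0| + c^-1 * enorm z.
    have -> : y i ord0 = x i ord0 - c^-1 * z i ord0.
      by rewrite !mxE mulrA mulVf ?gt_eqF// mul1r opprB addrC subrK.
    apply: (le_trans (ler_normB _ _)); rewrite lerD2l normrM.
    rewrite (@ger0_norm _ c^-1) ?invr_ge0 ?(ltW c0)//.
    by rewrite ler_wpM2l ?invr_ge0 ?(ltW c0)//; exact: le_entry_enorm.
  apply: (@le_trans _ _ (1 + (\sum_i `|x i ord0| + n%:R * c^-1 * enorm z))).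
    rewrite lerD2l (le_trans (le_enorm_sum y))//.
    apply: (le_trans (ler_sum _ (fun i _ => yx i))).
    by rewrite big_split/= lerD2l sumr_const card_ord -mulrA mulr_natl.
  have z0 := enorm_ge0 z; have S0 : 0 <= \sum_i `|x i ord0| by exact: sumr_ge0.
  have c1 : 0 <= n%:R * c^-1 by rewrite mulr_ge0// invr_ge0 ltW.
  rewrite /K; move: (\sum_i _) (n%:R * _) (enorm z) S0 c1 z0 => S k e S0 k0 e0.
  nra.
have w0 := enorm1_ge0 y.
have z0 := enorm1_ge0 z.
apply: (@le_trans _ _ ((K * (1 + enorm z)) ^+ N *
  normc ((- c%:C)%C ^+ size s *: pderivs s f z))).
  by rewrite ler_wpM2r ?normc_ge0// lerXn2r ?nnegrE// mulr_ge0.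
rewrite [normc _]normcM exprMn -mulrA ler_wpM2l ?exprn_ge0//.
by rewrite mulrCA ler_wpM2l ?normc_ge0//; exact: fM.
Qed.

End pderiv.

Section schwartz_space.
Variable n : nat.

Definition schwartz_pred : {pred 'cV[R]_n -> R[i]} :=
  fun f => `[< is_schwartz f >].

Lemma schwartz_submod_closed : submod_closed schwartz_pred.
Proof.
split; first by apply/asboolP; exact: is_schwartz0.
by move=> a f g /asboolP sf /asboolP sg; apply/asboolP; exact: is_schwartzZD.
Qed.

HB.instance Definition _ := GRing.isSubmodClosed.Build R[i] ('cV[R]_n -> R[i])
  schwartz_pred schwartz_submod_closed.

Record schwartz : Type := Schwartz {
  schwartz_fun :> 'cV[R]_n -> R[i] ;
  schwartz_funP : schwartz_fun \in schwartz_pred }.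

HB.instance Definition _ := [isSub for schwartz_fun].
HB.instance Definition _ := [Choice of schwartz by <:].
HB.instance Definition _ :=
  [SubChoice_isSubLmodule of schwartz by <:].

Definition mk_schwartz (f : 'cV[R]_n -> R[i]) (sf : is_schwartz f) : schwartz :=
  Schwartz (asboolT sf : f \in schwartz_pred).

Lemma is_schwartz_fun (phi : schwartz) : is_schwartz phi.
Proof. exact/asboolP/(schwartz_funP phi). Qed.

Lemma is_schwartz_reflect (x : 'cV[R]_n) (phi : schwartz) :
  is_schwartz (fun y => phi (x - y)).
Proof.
have := is_schwartz_affine x ltr01 (is_schwartz_fun phi).
by rewrite (_ : _ \o _ = fun y => phi (x - y))//; apply/funext => y /=; rewrite scale1r.
Qed.

Lemma is_schwartz_dilation (t : {posnum R}) (phi : schwartz) :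
  is_schwartz (fun x => (t%:num ^- n)%:C%C * phi (t%:num^-1 *: x)).
Proof.
have t0 : 0 < t%:num^-1 :> R by rewrite invr_gt0.
have s1 := is_schwartz_affine 0 t0 (is_schwartz_fun phi).
have s2 := is_schwartz_affine 0 ltr01 s1.
have := is_schwartzZD (t%:num ^- n)%:C%C s2 (is_schwartz0 n).
rewrite addr0; congr is_schwartz; apply/funext => x.
have -> // : t%:num^-1 *: x = t%:num^-1 *: (0 - (1 : R) *: (0 - x)).
by rewrite scale1r !sub0r opprK.
Qed.

Definition schwartz_reflect (x : 'cV[R]_n) (phi : schwartz) : schwartz :=
  mk_schwartz (is_schwartz_reflect x phi).

Definition dilation (t : {posnum R}) (phi : schwartz) : schwartz :=
  mk_schwartz (is_schwartz_dilation t phi).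

(* Continuity for the topology given by the directed family schwartz_norm N. *)
Definition tempered_distribution (F : schwartz -> R[i]) : Prop :=
  linear F /\ exists (N : nat) (C : R), forall phi : schwartz,
    ((normc (F phi))%:E <= C%:E * schwartz_norm N phi)%E.

Definition convolution (psi : schwartz) (F : schwartz -> R[i])
  (x : 'cV[R]_n) : R[i] := F (schwartz_reflect x psi).

Definition unit_schwartz (L : nat) : set schwartz :=
  [set phi : schwartz | (schwartz_norm L phi <= 1)%E].

Definition grand_maximal (L : nat) (F : schwartz -> R[i])
    (x : 'cV[R]_n) : \bar R :=
  ereal_sup [set (normc (convolution (dilation t phi) F x))%:E
    | t in [set: {posnum R}] & phi in unit_schwartz L].

Definition complex_integral (f : 'cV[R]_n -> R[i]) : R[i] :=
  Complex (\int[lebesgue_rn n]_x (Re (f x))) (\int[lebesgue_rn n]_x (Im (f x))).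

Definition distribution_of (f : 'cV[R]_n -> R[i]) (phi : schwartz) : R[i] :=
  complex_integral (fun x => f x * phi x).

End schwartz_space.
End schwartz.
Arguments schwartz R n : clear implicits.

(* The library sigma-algebras are Borel; being Lebesgue measurable is being
   almost everywhere equal to a Borel function. *)
Definition lebesgue_measurable d (T : measurableType d) (R : realType)
    (mu : set T -> \bar R) (D : set T) (f : T -> R) : Prop :=
  exists g : T -> R, measurable_fun D g /\ {ae mu, forall x, D x -> f x = g x}.

Section exponents.
Context {R : realType}.
Implicit Types p : R -> R.

Definition exponent_inf p : \bar R :=
  ess_inf (mrestr (@lebesgue_measure R) (measurable_itv `]0, +oo[))
    (EFin \o p).

Definition exponent_sup p : \bar R :=
  ess_sup (mrestr (@lebesgue_measure R) (measurable_itv `]0, +oo[))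
    (EFin \o p).

Definition exponent_at0 p : R := lim (p t @[t --> 0^'+]).

Definition exponent_aty p : R := lim (p t @[t --> +oo]).

(* Exponents are functions on R whose values outside ]0, +oo[ are irrelevant. *)
Definition variable_exponent p : Prop :=
  lebesgue_measurable (@lebesgue_measure R) `]0, +oo[ p /\
  forall t, 0 < t -> 0 < p t.

Definition log_hoelder_exponent p : Prop :=
  [/\ variable_exponent p,
      (0 < exponent_inf p)%E /\ (exponent_sup p < +oo)%E,
      cvg (p t @[t --> 0^'+]) /\ cvg (p t @[t --> +oo]) &
      exists2 C : R, 0 < C &
        (forall t, 0 < t < 2^-1 -> `|p t - exponent_at0 p| <= C / - ln t) /\
        (forall t, 0 < t -> `|p t - exponent_aty p| <= C / ln (expR 1 + t))].

Definition critical_exponent (n : nat) (alpha : R) : \bar R :=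
  if alpha == 0 then +oo%E else (n%:R / alpha)%:E.

Definition shifted_exponent (n : nat) (alpha : R) p (t : R) : R :=
  ((p t)^-1 - alpha / n%:R)^-1.

End exponents.

Section lorentz.
Context {R : realType} (n : nat).

(* For use with the maximal function, which may take the value +oo, the
   quantities below are functions of g = |f| with values in \bar R. *)
Definition rearrangement (g : 'cV[R]_n -> \bar R) (t : R) : \bar R :=
  ereal_inf [set s%:E | s in [set s : R | 0 <= s /\
    (lebesgue_rn n [set x | s%:E < g x] <= t%:E)%E]].

Definition lorentz_modular (p q : R -> R) (g : 'cV[R]_n -> \bar R) : \bar R :=
  (\int[@lebesgue_measure R]_(t in `]0%R, +oo[)
     ((t `^ (q t / p t - 1))%:E * (rearrangement g t `^ q t)))%E.

Definition lorentz_norm (p q : R -> R) (g : 'cV[R]_n -> \bar R) : \bar R :=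
  ereal_inf [set l%:E | l in [set l : R | 0 < l /\
    (lorentz_modular p q (fun x => (l^-1)%:E * g x) <= 1)%E]].

Definition modulus (f : 'cV[R]_n -> R[i]) (x : 'cV[R]_n) : \bar R :=
  (normc (f x))%:E.

(* Every almost everywhere class has a Borel representative. *)
Definition lorentz (p q : R -> R) : set ('cV[R]_n -> R[i]) :=
  [set f : 'cV[R]_n -> R[i] | [/\ measurable_fun setT (Re \o f),
    measurable_fun setT (Im \o f) &
    (lorentz_modular p q (modulus f) < +oo)%E]].

Definition hardy_norm (L : nat) (p q : R -> R) (F : schwartz R n -> R[i]) :
  \bar R := lorentz_norm p q (grand_maximal L F).

Definition hardy (L : nat) (p q : R -> R) : set (schwartz R n -> R[i]) :=
  [set F | tempered_distribution F /\ (hardy_norm L p q F < +oo)%E].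

Definition Lebesgue_space (s : R) : set ('cV[R]_n -> R[i]) :=
  [set f : 'cV[R]_n -> R[i] | [/\
    lebesgue_measurable (lebesgue_rn n) setT (Re \o f),
    lebesgue_measurable (lebesgue_rn n) setT (Im \o f) &
    (\int[lebesgue_rn n]_x ((normc (f x)) `^ s)%:E < +oo)%E]].

End lorentz.

Section operator.
Context {R : realType} (n m : nat).
Variables (a : 'I_m -> R) (A : 'I_m -> 'M[R]_n).

(* On the null set where some x = A i y the kernel gets the value 0. *)
Definition rough_kernel (x y : 'cV[R]_n) : R :=
  \prod_i enorm (x - A i *m y) `^ (- a i).

Definition rough_operator (f : 'cV[R]_n -> R[i]) (x : 'cV[R]_n) : R[i] :=
  complex_integral (fun y => (rough_kernel x y)%:C%C * f y).

Definition rough_operator_defined (f : 'cV[R]_n -> R[i]) (x : 'cV[R]_n) : Prop :=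
  (\int[lebesgue_rn n]_y (rough_kernel x y * normc (f y))%:E < +oo)%E.

End operator.

(* Main.v *)
(* Since |w|^(-a) is a multiple of the integral of s^(a/2-1) exp(-s |w|^2) ds, the
   kernel is a superposition, over s in (0,oo)^m, of products of Gaussians centred
   at the poles A_l^T x.  Such a product is a single Gaussian, of parameter
   b = s_1 + ... + s_m, centred at the barycenter of the poles, times exp(-V) where
   V is the dispersion of the poles.  A Gaussian may be paired with any tempered
   distribution F, and this defines T F without atomic decompositions.
   The pairings are controlled by a maximal function MF built from Gaussians only.
   Large s contribute the values of MF at the poles; for small s MF may be replaced by
   its rearrangement, since a Gaussian at scale r sees a ball of measure r^n.  Hence
     (T F)*(c r^n) <= C sum_k (2^k r)^alpha (MF)*(c' (2^k r)^n);
   if alpha = 0 one must stay away from x = 0, where the poles merge, and V supplies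
   the missing decay.  The estimate of norms is then a one-dimensional inequality with
   variable exponents.  For f in L^s, T f is the integral operator by Fubini's
   theorem, once the kernel is integrated against |f| for almost every x. *)
Require Import Defs.
From mathcomp Require Import all_boot all_order all_algebra.
From mathcomp Require Import all_classical all_reals all_analysis.
From mathcomp Require Import measurable_realfun ess_sup_inf complex ring lra.
Set Implicit Arguments.
Unset Strict Implicit.
Unset Printing Implicit Defensive.
Import Order.TTheory GRing.Theory Num.Theory.
Import numFieldNormedType.Exports.
Import Normc.
Local Open Scope classical_set_scope.
Local Open Scope ring_scope.

(** * Integrals without measurability, affine changes of variables *)

(** Counting exponents decides the matter. Convergence for large [s_l] asks for a decay exponent
    above [a l / 2] in each variable; these sum to [(n - alpha) / 2], while the factor [b^(-n/2)]
    offers [n / 2] to be shared. This leaves room exactly when [alpha > 0]. For [alpha = 0] the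
    dispersion contributes a further [n / 2] in one variable other than the largest; this takes at
    least two poles, separated from each other, hence [x] away from 0. In one dimension, [t^(1/p) H]
    is bounded when [H] is nonincreasing with modular at most 1. As [p_+ < n / alpha], a gap
    [delta > 0] separates [1/p] from [alpha / n], and the term of index [k] of the series carries
    [b^(-k delta)]. This factor is split repeatedly: to sum the series, to integrate it term by
    term, and to pay for the scales across which the model exponent changes. Only suprema and
    geometric sums occur, so exponents below 1 behave like the others. The extension is one formula
    on the whole Hardy space, and boundedness is proved there directly. Linearity holds wherever the
    defining integrals converge, which is almost everywhere. *)

Section unconditional_integral.
Local Open Scope ereal_scope.
Context d (T : measurableType d) (R : realType) (mu : {measure set T -> \bar R}).
Import HBNNSimple.

(* No measurability is assumed: the integral of a nonnegative function is a
   supremum over the simple functions below it. *)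
Lemma ae_le_ge0_integral (D : set T) (f g : T -> \bar R) :
  (forall x, D x -> 0 <= f x) -> (forall x, D x -> 0 <= g x) ->
  {ae mu, forall x, D x -> f x <= g x} ->
  \int[mu]_(x in D) f x <= \int[mu]_(x in D) g x.
Proof.
move=> f0 g0 [N [mN N0 fgN]]; rewrite !ge0_integralE//.
apply: ge_ereal_sup => _ [h /= hf <-].
have mNC : measurable (~` N) by exact: measurableC.
(* Cutting a simple function off on the null set keeps its integral and puts it below [g]. *)
pose h' := mul_nnsfun h (indic_nnsfun R mNC).
have h'h : sintegral mu h = sintegral mu h'.
  rewrite -!integralT_nnsfun; apply: ge0_ae_eq_integral => //.
  - exact/measurable_EFinP.
  - exact/measurable_EFinP.
  - by move=> x _; rewrite lee_fin; exact: (@fun_ge0 _ _ h).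
  - by move=> x _; rewrite lee_fin; exact: (@fun_ge0 _ _ h').
  exists N; split => // x /= /not_implyP[_ hh']; apply: contrapT => Nx; apply: hh'.
  by rewrite /h'/= mindicE mem_set ?mulr1.
rewrite h'h; apply: ereal_sup_ubound; exists h' => //= x.
rewrite mindicE; have [Nx|Nx] := boolP (x \in ~` N); last first.
  rewrite mulr0 patchE; case: ifPn => // xD; apply: g0; exact: set_mem.
rewrite mulr1; apply: (le_trans (hf x)); rewrite !patchE; case: ifPn => // xD.
apply: contrapT => fg; move: Nx; rewrite inE; apply; apply: fgN => /= /(_ (set_mem xD)).
exact: fg.
Qed.

Lemma ge0_le_integralW (D : set T) (f g : T -> \bar R) :
  (forall x, D x -> 0 <= f x) -> (forall x, D x -> f x <= g x) ->
  \int[mu]_(x in D) f x <= \int[mu]_(x in D) g x.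
Proof.
move=> f0 fg; apply: ae_le_ge0_integral => //.
  by move=> x Dx; exact: le_trans (f0 _ Dx) (fg _ Dx).
exact: aeW.
Qed.

Lemma ae_eq_integralW (D : set T) (f g : T -> \bar R) :
  {ae mu, forall x, D x -> f x = g x} ->
  \int[mu]_(x in D) f x = \int[mu]_(x in D) g x.
Proof.
move=> fg.
have H (f1 g1 : T -> \bar R) : (forall x, D x -> 0 <= f1 x) ->
    (forall x, D x -> 0 <= g1 x) -> {ae mu, forall x, D x -> f1 x = g1 x} ->
    \int[mu]_(x in D) f1 x = \int[mu]_(x in D) g1 x.
  move=> f10 g10 fg1; apply/eqP; rewrite eq_le; apply/andP; split;
    apply: ae_le_ge0_integral => //; by apply: filterS fg1 => x fgx Dx; rewrite fgx.
rewrite integralE [RHS]integralE; congr (_ - _); apply: H.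
- by move=> x _; exact: funepos_ge0.
- by move=> x _; exact: funepos_ge0.
- by apply: filterS fg => x fgx Dx; rewrite !funeposE fgx.
- by move=> x _; exact: funeneg_ge0.
- by move=> x _; exact: funeneg_ge0.
- by apply: filterS fg => x fgx Dx; rewrite !funenegE fgx.
Qed.

End unconditional_integral.

Section affine_change_of_variables.
Local Open Scope ereal_scope.
Context {R : realType}.
Local Notation mu := (@lebesgue_measure R).

(** By uniqueness of Lebesgue measure: [c] times the image measure gives every half-open interval
    its length. *)
Lemma lebesgue_measure_affine (c d : R) (A : set R) : (0 < c)%R ->
  measurable A ->
  mu ((fun x => c * x + d)%R @^-1` A) = (c^-1)%:E * mu A.
Proof.
move=> c0 mA.
have mphi : measurable_fun [set: measurableTypeR R]
    (fun x : measurableTypeR R => c * x + d : measurableTypeR R)%R.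
  by apply: measurable_funD => //; exact: measurable_funM.
pose nu0 : {measure set (measurableTypeR R) -> \bar R} :=
  measure_function_pushforward__canonical__measure_function_Measure mu mphi.
pose nu : {measure set (measurableTypeR R) -> \bar R} := mscale (NngNum (ltW c0)) nu0.
have : mu A = nu A.
  apply: (@lebesgue_measure_unique R nu) => //.
  move=> _ [[a b]] _ <-; rewrite /= /mscale/= /pushforward.
  have -> : (fun x => c * x + d)%R @^-1` `]a, b] =
      `]((a - d) / c)%R, ((b - d) / c)%R]%classic.
    apply/seteqP; split => x /=; rewrite !in_itv/= ltr_pdivrMr// ler_pdivlMr//.
      by rewrite ltrBlDr lerBrDr (mulrC x).
    by rewrite ltrBlDr lerBrDr (mulrC x).
  rewrite !lebesgue_measure_itv/= !lte_fin ltr_pM2r ?invr_gt0// ltrD2r.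
  case: ifPn => ab; last by rewrite mule0.
  rewrite -!EFinB -EFinM; congr EFin; rewrite -mulrBl mulrCA divff ?gt_eqF//; ring.
rewrite /nu /mscale/= /pushforward => ->.
by rewrite muleA -EFinM mulVf ?gt_eqF// mul1e.
Qed.

Lemma ge0_integral_affine (c d : R) (f : R -> \bar R) : (0 < c)%R ->
  measurable_fun setT f -> (forall x, 0 <= f x) ->
  \int[mu]_x f (c * x + d)%R = (c^-1)%:E * \int[mu]_x f x.
Proof.
move=> c0 mf f0.
have mphi : measurable_fun [set: measurableTypeR R]
    (fun x : measurableTypeR R => c * x + d : measurableTypeR R)%R.
  by apply: measurable_funD => //; exact: measurable_funM.
have ci : (0 <= c^-1)%R by rewrite invr_ge0 ltW.
rewrite -(@ge0_integral_mscale _ (measurableTypeR R) _ mu setT measurableT (NngNum ci) f mf)//.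
have := @ge0_integral_pushforward _ _ (measurableTypeR R) (measurableTypeR R)
  R _ mphi mu setT f measurableT mf (fun x _ => f0 x).
rewrite preimage_setT => <-.
by apply: eq_measure_integral => A mA _; exact: lebesgue_measure_affine.
Qed.

Lemma ge0_integral_scale (c : R) (f : R -> \bar R) : (0 < c)%R ->
  measurable_fun (`]0%R, +oo[ : set R) f -> (forall x, (0 < x)%R -> 0 <= f x) ->
  \int[mu]_(x in `]0%R, +oo[) f (c * x)%R =
    (c^-1)%:E * \int[mu]_(x in `]0%R, +oo[) f x.
Proof.
move=> c0 mf f0; rewrite integral_mkcond [in RHS]integral_mkcond.
rewrite -(@ge0_integral_affine c 0)//.
- apply: eq_integral => x _; rewrite !patchE addr0.
  by rewrite !mem_setE !in_itv/= !andbT pmulr_rgt0.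
- exact/(measurable_restrictT _ _).1.
- by move=> x; rewrite patchE; case: ifPn => //; rewrite inE/= in_itv/= andbT; exact: f0.
Qed.

End affine_change_of_variables.

(** * Lebesgue measure on column vectors *)

Section lebesgue_rn_integral.
Local Open Scope ereal_scope.
Context {R : realType}.
Local Notation mu := (@lebesgue_measure R).

Lemma measurable_coord n (i : 'I_n) :
  measurable_fun setT (fun v : 'cV[R]_n => v i ord0).
Proof. exact: measurable_entry. Qed.

Lemma cons_cV0 n (t : R) (v : 'cV[R]_n) : cons_cV (t, v) ord0 ord0 = t.
Proof.
rewrite /cons_cV mxE; case: (@fintype.splitP 1 n ord0) => k /= k0; last by [].
by rewrite mxE (ord1 k) eqxx.
Qed.

Lemma cons_cVS n (t : R) (v : 'cV[R]_n) i :
  cons_cV (t, v) (lift ord0 i) ord0 = v i ord0.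
Proof.
rewrite /cons_cV mxE; case: (@fintype.splitP 1 n (lift ord0 i)) => k /= k0.
  by case: k k0 => -[]//.
by congr (v _ _); apply/val_inj; move: k0; rewrite /bump/= !add1n => -[].
Qed.

Lemma ge0_integral_rnS n (f : 'cV[R]_n.+1 -> \bar R) :
  measurable_fun setT f -> (forall x, 0 <= f x) ->
  \int[lebesgue_rn n.+1]_x f x =
  \int[mu]_t \int[lebesgue_rn n]_v f (cons_cV (t, v)).
Proof.
move=> mf f0.
transitivity (\int[mu \x lebesgue_rn n]_z (f \o @cons_cV R n) z).
  have := @ge0_integral_pushforward _ _ (measurableTypeR R * 'cV[R]_n)%type _ R _
    (@measurable_cons_cV R n) (mu \x lebesgue_rn n) setT f measurableT mf (fun x _ => f0 x).
  rewrite preimage_setT => <-.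
  by [].

rewrite fubini_tonelli1//=.
apply: measurableT_comp => //; exact: measurable_cons_cV.
Qed.

Lemma measurable_rn_prod n (f : 'I_n -> R -> R) :
  (forall i, measurable_fun setT (f i)) ->
  measurable_fun setT (fun v : 'cV[R]_n => \prod_i f i (v i ord0))%R.
Proof.
move=> mf; apply: measurable_prod => i _.
by apply: measurableT_comp => //; exact: measurable_coord.
Qed.

Lemma integral_rn_prod n (f : 'I_n -> R -> R) (c : 'I_n -> R) :
  (forall i, measurable_fun setT (f i)) -> (forall i x, 0 <= f i x)%R ->
  (forall i, \int[mu]_x (f i x)%:E = (c i)%:E) ->
  \int[lebesgue_rn n]_v (\prod_i f i (v i ord0))%:E = (\prod_i c i)%:E.
Proof.
elim: n f c => [|n IH] f c mf f0 fc.
  under eq_integral do rewrite big_ord0.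
  rewrite big_ord0 integral_dirac//.
  by rewrite mule1 diracT.
rewrite ge0_integral_rnS; last 2 first.
- by apply/measurable_EFinP; exact: (measurable_rn_prod mf).
- by move=> x; rewrite lee_fin prodr_ge0.
have f0int t : \int[lebesgue_rn n]_v (\prod_i f i (cons_cV (t, v) i ord0))%:E =
    (\prod_(i < n) c (lift ord0 i))%:E * (f ord0 t)%:E.
  rewrite muleC -(IH (fun i => f (lift ord0 i)))//.
  rewrite -ge0_integralZl//; last 3 first.
  - by apply/measurable_EFinP; apply: (measurable_rn_prod (f := fun i => f (lift ord0 i))).
  - by move=> x _; rewrite lee_fin prodr_ge0.
  - by rewrite lee_fin.
  apply: eq_integral => v _; rewrite big_ord_recl cons_cV0 EFinM; congr (_ * _%:E).
  by apply: eq_bigr => i _; rewrite cons_cVS.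
under eq_integral do rewrite f0int.
rewrite ge0_integralZl//; last 3 first.
- by apply/measurable_EFinP; exact: mf.
- by move=> x _; rewrite lee_fin.
- rewrite lee_fin; apply: prodr_ge0 => i _; rewrite -lee_fin -fc.
  by apply: integral_ge0 => x _; rewrite lee_fin.
by rewrite fc -EFinM mulrC big_ord_recl.
Qed.

(** Half open, so that the boxes of a dyadic grid partition the space. *)
Definition box n (a b : 'I_n -> R) : set 'cV[R]_n :=
  [set v | forall i, (a i <= v i ord0 < b i)%R].

Lemma box_prod n (a b : 'I_n -> R) (v : 'cV[R]_n) :
  (\1_(box a b) v : R) = (\prod_i \1_(`[a i, b i[%classic : set R) (v i ord0))%R.
Proof.
rewrite indicE; have [vB|vB] := boolP (v \in box a b).
  rewrite big1// => i _; rewrite indicE mem_set//= in_itv/=; exact: (set_mem vB).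
have /existsNP[i vi] : ~ box a b v by move=> ?; case/negP: vB; exact: mem_set.
rewrite (bigD1 i)//= indicE memNset ?mul0r//=.
Qed.

Lemma measurable_box n (a b : 'I_n -> R) : measurable (box a b).
Proof.
apply/(measurable_indicP R).
rewrite (_ : \1_ _ = (fun v : 'cV[R]_n =>
    \prod_i \1_(`[a i, b i[%classic : set R) (v i ord0))%R); last first.
  by apply/funext => v; rewrite box_prod.
by apply: (measurable_rn_prod (f := fun i => \1_(`[a i, b i[%classic : set R))) => i; exact: measurable_indic.
Qed.

Lemma lebesgue_rn_box n (a b : 'I_n -> R) : (forall i, a i <= b i)%R ->
  lebesgue_rn n (box a b) = (\prod_i (b i - a i))%:E.
Proof.
move=> ab.
rewrite -[LHS](_ : \int[lebesgue_rn n]_v (\1_(box a b) v)%:E = _); last first.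
  by rewrite integral_indic ?setIT//; exact: measurable_box.
under eq_integral do rewrite box_prod.
apply: (integral_rn_prod (f := fun i => \1_(`[a i, b i[%classic : set R))).
- by move=> i; exact: measurable_indic.
- by move=> i x; rewrite indicE.
- move=> i; rewrite integral_indic// setIT -[LHS]/(mu `[a i, b i[%classic).
  rewrite lebesgue_measure_itv/= lte_fin.
  case: ltP => //; move: (ab i) => abi bai; congr EFin; lra.
Qed.

(** The measure of an arbitrary set is an iterated integral of measures of sections, and such
    integrals are suprema over simple functions, hence monotone. This allows level sets of the grand
    maximal function and of [modulus] to be compared directly. *)
Lemma le_lebesgue_rnW n (A B : set 'cV[R]_n) : A `<=` B ->
  lebesgue_rn n A <= lebesgue_rn n B.
Proof.
elim: n A B => [|n IH] A B AB.
  rewrite /= /dirac !indicE lee_fin ler_nat.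
  have [/set_mem/AB A0|] := boolP (_ \in A); last by [].
  by rewrite mem_set.
change (\int[mu]_t (lebesgue_rn n (xsection (@cons_cV R n @^-1` A) t)) <=
        \int[mu]_t (lebesgue_rn n (xsection (@cons_cV R n @^-1` B) t))).
apply: ge0_le_integralW => x _ //; apply: IH => v; rewrite /xsection/= !inE/=.
exact: AB.
Qed.

End lebesgue_rn_integral.

(** * Open sets as unions of dyadic cells, and their preimages under matrices *)

Section dyadic_cells.
Local Open Scope ereal_scope.
Context {R : realType} (n : nat).
Implicit Types (U : set 'cV[R]_n) (v w : 'cV[R]_n).

(** Openness is spelled out in coordinates because the sigma-algebra is generated by coordinate
    cylinders. *)
Definition box_open U := forall x, U x ->
  exists2 e : R, (0 < e)%R & forall y : 'cV[R]_n,
    (forall i, `|y i ord0 - x i ord0| < e)%R -> U y.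

Definition cell_index (k : nat) v : {ffun 'I_n -> int} :=
  [ffun i => Num.floor (2 ^+ k * v i ord0)].

Definition cell k (z : {ffun 'I_n -> int}) : set 'cV[R]_n :=
  box (fun i => (z i)%:~R / 2 ^+ k)%R (fun i => ((z i)%:~R + 1) / 2 ^+ k)%R.

Lemma in_cell k z v : cell k z v <-> cell_index k v = z.
Proof.
have k0 : (0 < 2 ^+ k :> R)%R by rewrite exprn_gt0.
split=> [vz|<- i].
  apply/ffunP => i; rewrite ffunE; apply: floor_def.
  have := vz i; rewrite ler_pdivrMr// ltr_pdivlMr// mulrC => /andP[-> h].
  by rewrite intrD.
rewrite ffunE ler_pdivrMr// ltr_pdivlMr// (mulrC (v i ord0)).
by have := floor_itv (2 ^+ k * v i ord0)%R; rewrite intrD.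
Qed.

Definition cells_in U k : set 'cV[R]_n := [set v | cell k (cell_index k v) `<=` U].

(** The cells are numbered by their codes, with the empty set for invalid codes and for cells that
    leave [U], so that countable additivity applies. *)
Definition nth_cell_in U k (j : nat) : set 'cV[R]_n :=
  if pickle_inv j is Some z then
    if `[< cell k z `<=` U >] then cell k z else set0 else set0.

Lemma cells_inE U k : cells_in U k = \bigcup_j nth_cell_in U k j.
Proof.
apply/seteqP; split=> [v vU|v [j _]].
  exists (pickle (cell_index k v)) => //; rewrite /nth_cell_in pickleK_inv.
  by rewrite asboolT//; exact/in_cell.
rewrite /nth_cell_in; case: pickle_inv => // z; case: asboolP => // zU /in_cell vz.
by rewrite /cells_in/= vz.
Qed.

Lemma measurable_nth_cell_in U k j : measurable (nth_cell_in U k j).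
Proof.
rewrite /nth_cell_in; case: pickle_inv => // z; case: ifPn => // _.
exact: measurable_box.
Qed.

Lemma trivIset_nth_cell_in U k : trivIset setT (nth_cell_in U k).
Proof.
move=> i j _ _ [v []]; rewrite /nth_cell_in.
have /= := @pickle_invK {ffun 'I_n -> int} i.
have /= := @pickle_invK {ffun 'I_n -> int} j.
case: (pickle_inv j) => //= z <-; case: asboolP => // _.
case: (pickle_inv i) => //= y <-; case: asboolP => // _.
by move=> /in_cell <- /in_cell <-.
Qed.

Lemma measurable_cells_in U k : measurable (cells_in U k).
Proof.
rewrite cells_inE; apply: bigcupT_measurable => j.
exact: measurable_nth_cell_in.
Qed.

Lemma cells_in_sub U k : cells_in U k `<=` U.
Proof. by move=> v; apply; exact/in_cell. Qed.

(** This is the nesting of the dyadic grids: points in a common cell of one level share a cell of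
    the previous level. *)
Lemma floor_double_eq (x y : R) :
  Num.floor (2 * x)%R = Num.floor (2 * y)%R -> Num.floor x = Num.floor y.
Proof.
have lem (a b : R) : Num.floor (2 * a)%R = Num.floor (2 * b)%R ->
    (Num.floor b <= Num.floor a)%R.
  move=> ab; rewrite leNgt floor_lt_int; apply/negP => aN.
  have : (Num.floor (2 * a)%R < 2 * Num.floor b)%R.
    by rewrite floor_lt_int intrM ltr_pM2l.
  rewrite ab floor_lt_int intrM ltr_pM2l// ltNge => /negP; apply.
  exact: floor_le.
by move=> xy; apply/eqP; rewrite eq_le !lem.
Qed.

Lemma nondecreasing_cells_in U : nondecreasing_seq (cells_in U).
Proof.
apply/nondecreasing_seqP => k; apply/subsetPset => v vU w /in_cell vw.
apply: vU; apply/in_cell/ffunP => i; rewrite !ffunE.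
move/ffunP/(_ i): vw; rewrite !ffunE exprS -!mulrA.
exact: floor_double_eq.
Qed.

Lemma bigcup_cells_in U : box_open U -> \bigcup_k cells_in U k = U.
Proof.
move=> oU; apply/seteqP; split=> [v [k _]|v Uv]; first exact: cells_in_sub.
have [e e0 vU] := oU v Uv.
have [k ke] : exists k, (e^-1 < 2 ^+ k)%R.
  exists (Num.truncn e^-1).+1; apply: (lt_trans (truncnS_gt _)).
  by rewrite -natrX ltr_nat ltn_expl.
exists k => // w /in_cell vw; apply: vU => i.
move/ffunP/(_ i): vw; rewrite !ffunE => vw.
have k0 : (0 < 2 ^+ k :> R)%R by rewrite exprn_gt0.
have ek : (1 < 2 ^+ k * e)%R by rewrite -ltr_pdivrMr// div1r.
have /andP[w1 w2] := floor_itv (2 ^+ k * w i ord0)%R.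
have /andP[v1 v2] := floor_itv (2 ^+ k * v i ord0)%R.
rewrite vw !intrD in w1 w2; rewrite intrD in v2.
rewrite -(ltr_pM2l k0); apply: lt_trans ek.
rewrite -[X in (X * _)%R](gtr0_norm k0) -normrM mulrBr ltr_norml; apply/andP; split; lra.
Qed.

Lemma box_open_measurable U : box_open U -> measurable U.
Proof.
move=> /bigcup_cells_in <-; apply: bigcupT_measurable => k.
exact: measurable_cells_in.
Qed.

Definition matrix_bounded (B : 'M[R]_n) := forall i j, (`|B i j| <= 1)%R.

Lemma measurable_mulmx (B : 'M[R]_n) :
  measurable_fun setT (fun x : 'cV[R]_n => B *m x).
Proof.
apply: measurable_fun_matrix => i j; under eq_fun do rewrite mxE.
apply: measurable_sum => k; apply: measurable_funM => //.
by rewrite (ord1 j); exact: measurable_coord.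
Qed.

(* A matrix with entries in [-1, 1] maps a cube of side [l] into one of side [(2n+1)l]. *)
Lemma lebesgue_rn_preimage_cell (B A : 'M[R]_n) k z : A *m B = 1%:M ->
  matrix_bounded A ->
  lebesgue_rn n ((fun x => B *m x) @^-1` cell k z) <=
  ((2 * n%:R + 1) ^+ n)%:E * lebesgue_rn n (cell k z).
Proof.
move=> AB bA; have k0 : (0 < 2 ^+ k :> R)%R by rewrite exprn_gt0.
pose q : 'cV[R]_n := \col_i ((z i)%:~R / 2 ^+ k)%R.
pose l : R := ((2 ^+ k)^-1)%R.
have l0 : (0 < l)%R by rewrite invr_gt0.
pose a i := ((A *m q) i ord0 - n%:R * l)%R.
pose b i := ((A *m q) i ord0 + (n%:R + 1) * l)%R.
apply: (@le_trans _ _ (lebesgue_rn n (box a b))).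
  apply: le_lebesgue_rnW => x /= xz i.
  have -> : x = A *m (B *m x) by rewrite mulmxA AB mul1mx.
  set y := B *m x in xz *.
  have yq : (`|(A *m y) i ord0 - (A *m q) i ord0| <= n%:R * l)%R.
    rewrite !mxE -sumrB; apply: (le_trans (ler_norm_sum _ _ _)).
    rewrite -[X in (X%:R * _)%R]card_ord mulr_natl -sumr_const.
    apply: ler_sum => j _; rewrite -mulrBr normrM -[leRHS]mul1r.
    apply: ler_pM => //; rewrite [q j ord0]mxE -/l.
    have := xz j; rewrite mulrDl div1r -/l.
    move: (_ * l)%R (y j ord0) => zl yj /andP[y1 y2].
    by rewrite ger0_norm; lra.
  move: yq; rewrite ler_norml /a /b => /andP[y1 y2]; apply/andP; split; nra.
rewrite !lebesgue_rn_box; last 2 first.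
- by move=> i; rewrite ler_pM2r ?invr_gt0//; lra.
- move=> i; rewrite /a /b; have : (0 <= n%:R :> R)%R by []; nra.
rewrite -EFinM lee_fin -[X in (_ ^+ X * _)%R]card_ord -prodr_const -big_split/=.
apply: ler_prod => i _; rewrite /a /b -/l.
have : (0 <= n%:R :> R)%R by [].
by move=> n0; apply/andP; split; nra.
Qed.

(** The open set is exhausted by unions of disjoint dyadic cells, to each of which the bound for one
    cell applies. The factor is later absorbed by the constant [Lam] that dilates the argument of a
    rearrangement. *)
Lemma lebesgue_rn_preimage_le (B A : 'M[R]_n) U : A *m B = 1%:M ->
  matrix_bounded A -> box_open U ->
  lebesgue_rn n ((fun x => B *m x) @^-1` U) <=
  ((2 * n%:R + 1) ^+ n)%:E * lebesgue_rn n U.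
Proof.
move=> AB bA oU; set C := ((2 * n%:R + 1) ^+ n)%R.
have C0 : (0 <= C)%R by rewrite exprn_ge0// addr_ge0// mulr_ge0.
have mB (X : set 'cV[R]_n) : measurable X -> measurable ((fun x => B *m x) @^-1` X).
  by move=> mX; rewrite -[X in measurable X]setTI; exact: measurable_mulmx.
rewrite -[X in _ @^-1` X](bigcup_cells_in oU) preimage_bigcup.
have := @nondecreasing_cvg_mu _ _ _ (lebesgue_rn n)
  (fun k => (fun x => B *m x) @^-1` cells_in U k).
move=> /(_ _ _ _)/cvg_lim <- //.
- apply: lime_le.
    apply: ereal_nondecreasing_is_cvgn => i j ij; apply: le_lebesgue_rnW => x /=.
    by have /subsetPset := @nondecreasing_cells_in U _ _ ij; exact.
  near=> k; rewrite /= cells_inE preimage_bigcup.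
  apply: (@le_trans _ _ (\sum_(j <oo) lebesgue_rn n ((fun x => B *m x) @^-1` nth_cell_in U k j))).
    apply: generalized_Boole_inequality => [j|]; first by apply: mB; exact: measurable_nth_cell_in.
    by apply: bigcupT_measurable => j; by apply: mB; exact: measurable_nth_cell_in.
  apply: (@le_trans _ _ (\sum_(j <oo) (C%:E * lebesgue_rn n (nth_cell_in U k j)))).
    apply: lee_nneseries => j _ //; rewrite /nth_cell_in; case: pickle_inv => [z|]; last first.
      by rewrite preimage_set0 !measure0 mule0.
    case: ifPn => _; first exact: lebesgue_rn_preimage_cell AB bA.
    by rewrite preimage_set0 !measure0 mule0.
  rewrite nneseriesZl//; apply: lee_wpmul2l; first by rewrite lee_fin.
  rewrite -measure_semi_bigcup//.
  - by rewrite -cells_inE; apply: le_lebesgue_rnW; exact: cells_in_sub.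
  - by move=> j; exact: measurable_nth_cell_in.
  - exact: trivIset_nth_cell_in.
  - by apply: bigcupT_measurable => j; exact: measurable_nth_cell_in.
- by move=> k; by apply: mB; exact: measurable_cells_in.
- by apply: bigcupT_measurable => k; by apply: mB; exact: measurable_cells_in.
- move=> i j ij; apply/subsetPset => x /=.
  by have /subsetPset := @nondecreasing_cells_in U _ _ ij; exact.
Unshelve. all: by end_near. Qed.

End dyadic_cells.

(** * Power weights *)

Section dyadic_sums.
Context {R : realType}.

Lemma nneseries_geometric_le (M x : R) : 0 <= M -> 0 <= x < 1 ->
  (\sum_(k <oo) (M * x ^+ k)%:E <= (M / (1 - x))%:E)%E.
Proof.
move=> M0 /andP[x0 x1]; apply: lime_le.
  by apply: is_cvg_nneseries => k _ _; rewrite lee_fin mulr_ge0// exprn_ge0.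
near=> k; rewrite sumEFin lee_fin -mulr_sumr ler_wpM2l//.
have -> : \sum_(0 <= i < k) x ^+ i = (1 - x ^+ k) / (1 - x).
  have x10 : 1 - x != 0 by rewrite gt_eqF// subr_gt0.
  apply: (mulIf x10); rewrite divfK// big_mkord mulrC.
  by rewrite -[LHS]opprK -mulNr opprB -subrX1 opprB.
by rewrite -[leRHS]div1r ler_pM2r ?invr_gt0 ?subr_gt0// lerBlDr lerDl exprn_ge0.
Unshelve. all: by end_near. Qed.

Lemma nneseries_ge_term (u : nat -> \bar R) k : (forall i, 0 <= u i)%E ->
  (u k <= \sum_(i <oo) u i)%E.
Proof.
move=> u0; apply: (@le_trans _ _ (\sum_(0 <= i < k.+1) u i)%E).
  by rewrite big_nat_recr//= leeDr// sume_ge0.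
exact: nneseries_lim_ge.
Qed.

Lemma geometric_bracket (c x : R) : 0 < c < 1 -> 0 < x <= 1 ->
  exists k, c ^+ k.+1 < x <= c ^+ k.
Proof.
move=> /andP[c0 c1] /andP[x0 x1].
have [N cN] : exists N, c ^+ N < x.
  have := @cvg_expr R c; rewrite gtr0_norm// => /(_ c1)/cvgrPdist_lt/(_ x x0)[N _ /(_ N)].
  by rewrite /= sub0r normrN => /(_ (leqnn N)) h; exists N; apply: le_lt_trans (ler_norm _) h.
have [[|k] ck kmin] := ex_minnP (ex_intro (fun N => c ^+ N < x) N cN).
  by move: ck; rewrite expr0 ltNge x1.
exists k; rewrite ck/= leNgt; apply/negP => /kmin.
by rewrite ltnn.
Qed.

Lemma powR_bounded_ratio (x e : R) : 2^-1 <= x <= 2 -> x `^ e <= 2 `^ `|e|.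
Proof.
move=> /andP[x1 x2]; have x0 : 0 < x by apply: lt_le_trans x1; rewrite invr_gt0.
have [e0|e0] := leP 0 e.
  by rewrite ger0_norm// ge0_ler_powR// nnegrE// ltW.
have -> : x `^ e = x^-1 `^ (- e) by rewrite -powR_inv1 ?ltW// -powRrM mulN1r opprK.
rewrite ltr0_norm//.
rewrite ge0_ler_powR// ?nnegrE ?invr_ge0 ?oppr_ge0 ?(ltW e0) ?(ltW x0)//.
by rewrite invf_ple// posrE.
Qed.

Lemma expr_powR (x e : R) k : 0 < x -> (x ^+ k) `^ e = (x `^ e) ^+ k.
Proof. by move=> x0; rewrite -(powR_mulrn k (ltW x0)) -(powR_mulrn k (powR_ge0 x e)) powRAC. Qed.

End dyadic_sums.

Section power_weights.
Context {R : realType}.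
Local Notation mu := (@lebesgue_measure R).

(* [s^(a-1) max(s,S)^-e] on the positive half-line, extended by 0. *)
Definition power_weight (a S e s : R) : R :=
  if 0 < s then s `^ (a - 1) * Num.max s S `^ (- e) else 0.

Lemma power_weight_ge0 a S e s : 0 <= power_weight a S e s.
Proof. by rewrite /power_weight; case: ifP => // _; rewrite mulr_ge0 ?powR_ge0. Qed.

Lemma measurable_power_weight a S e : measurable_fun setT (power_weight a S e).
Proof.
apply: measurable_fun_ifT => //; first exact: measurable_fun_ltr.
apply: measurable_funM => //.
apply: (@measurableT_comp _ _ _ _ _ _ (@powR R ^~ (- e))) => //.
exact: measurable_maxr.
Qed.

Lemma power_weight_scale a S e s : 0 < S ->
  power_weight a S e (S * s) = S `^ (a - 1 - e) * power_weight a 1 e s.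
Proof.
move=> S0; rewrite /power_weight pmulr_rgt0//; case: ifPn => [s0|_]; last by rewrite mulr0.
have -> : Num.max (S * s) S = S * Num.max s 1 by rewrite maxr_pMr ?mulr1// ltW.
have S0' := ltW S0; have s0' := ltW s0.
have m0 : 0 <= Num.max s 1 by rewrite le_max ler01 orbT.
rewrite (powRM _ S0' s0') (powRM _ S0' m0).
by rewrite (@powRD _ S (a - 1)) ?(gt_eqF S0) ?implybT// mulrACA.
Qed.

(** Dyadic pieces: near 0 the piece at [2^-k] has mass of order [2^(-k a)], near infinity the piece
    at [2^k] has mass of order [2^(-k (e - a))]. Both series are geometric. *)
Lemma power_weight_integral_lty (a e : R) : 0 < a < e ->
  (\int[mu]_s (power_weight a 1 e s)%:E < +oo)%E.
Proof.
move=> /andP[a0 ae].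
pose M : R := 2 `^ `|a - 1|; pose M' : R := 2 `^ `|a - 1 - e|.
pose x : R := 2^-1 `^ a; pose y : R := 2^-1 `^ (e - a).
have h0 : 0 < 2^-1 :> R by rewrite invr_gt0.
have h1 : 2^-1 < 1 :> R by rewrite invf_lt1// ltr1n.
have xy1 (z : R) : 0 < z -> 0 <= (2^-1 : R) `^ z < 1.
  move=> z0; rewrite powR_ge0/= [ltRHS](_ : _ = 1 `^ z); last by rewrite powR1.
  by apply: gt0_ltr_powR; rewrite ?nnegrE ?ltW.
pose f k s := M * (2^-1 ^+ k) `^ (a - 1) * \1_(`]2^-1 ^+ k.+1, 2^-1 ^+ k] : set R) s.
pose g k s := M' * (2^-1 ^+ k) `^ (e - a + 1) * \1_(`](2 ^+ k), (2 ^+ k.+1)] : set R) s.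
have f0 k s : 0 <= f k s by rewrite !mulr_ge0 ?powR_ge0.
have g0 k s : 0 <= g k s by rewrite !mulr_ge0 ?powR_ge0.
have mf k : measurable_fun setT (f k).
  by apply: measurable_funM => //; exact: measurable_indic.
have mg k : measurable_fun setT (g k).
  by apply: measurable_funM => //; exact: measurable_indic.
have bound (s : R) : ((power_weight a 1 e s)%:E <=
    \sum_(k <oo) (f k s)%:E + \sum_(k <oo) (g k s)%:E)%E.
  have sf : (0 <= \sum_(k <oo) (f k s)%:E)%E by apply: nneseries_ge0 => k _ _; rewrite lee_fin.
  have sg : (0 <= \sum_(k <oo) (g k s)%:E)%E by apply: nneseries_ge0 => k _ _; rewrite lee_fin.
  rewrite /power_weight; case: ifPn => [s0|_]; last exact: adde_ge0.
  have [s1|s1] := leP s 1.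
    apply: le_trans (leeDl _ sg).
    have [k /andP[k1 k2]] := geometric_bracket (introT andP (conj h0 h1)) (introT andP (conj s0 s1)).
    apply: (@le_trans _ _ (f k s)%:E); last first.
      by apply: (nneseries_ge_term (u := fun k => (f k s)%:E)) => i; rewrite lee_fin.
    rewrite lee_fin powR1 mulr1 /f indicE mem_set/= ?in_itv/= ?k1 ?k2// mulr1.
    have k0 : 0 < 2^-1 ^+ k :> R by rewrite exprn_gt0.
    have -> : s = (s / 2^-1 ^+ k) * 2^-1 ^+ k by rewrite divfK// gt_eqF.
    rewrite powRM ?divr_ge0 ?(ltW k0) ?(ltW s0)// ler_pM2r ?powR_gt0//.
    apply: powR_bounded_ratio; rewrite ler_pdivlMr// ler_pdivrMr// -exprS ltW//=.
    by apply: (le_trans k2); rewrite ler_peMl ?(ltW k0) ?ler1n.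
  apply: le_trans (leeDr _ sf).
  have s1i : 0 < s^-1 < 1 by rewrite invr_gt0 s0/= invf_lt1.
  have [k] := geometric_bracket (introT andP (conj h0 h1))
    (introT andP (conj (proj1 (andP s1i)) (ltW (proj2 (andP s1i))))).
  rewrite !exprVn ltf_pV2 ?posrE ?exprn_gt0// lef_pV2 ?posrE ?exprn_gt0// => /andP[k1 k2].
  have k0 : 0 < 2 ^+ k :> R by rewrite exprn_gt0.
  have [k3|k3] := ltP (2 ^+ k) s.
    apply: (@le_trans _ _ (g k s)%:E); last first.
      by apply: (nneseries_ge_term (u := fun k => (g k s)%:E)) => i; rewrite lee_fin.
    rewrite lee_fin -powRD ?(gt_eqF s0) ?implybT//.
    rewrite /g indicE mem_set/= ?in_itv/= ?k3 ?(ltW k1)// mulr1.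
    have -> : s = (s / 2 ^+ k) * 2 ^+ k by rewrite divfK// gt_eqF.
    rewrite powRM ?divr_ge0 ?(ltW k0) ?(ltW s0)// exprVn -powR_inv1 ?(ltW k0)// -powRrM.
    have -> : -1 * (e - a + 1) = a - 1 - e by ring.
    rewrite ler_pM2r ?powR_gt0//.
    apply: powR_bounded_ratio; rewrite powR_inv1 ?(ltW k0)// ler_pdivlMr// ler_pdivrMr// -exprS (ltW k1) andbT.
    by apply: le_trans (ltW k3); rewrite ler_piMl ?(ltW k0)// invf_le1 ?ler1n.
  (* The bracket of [s^-1] gives [2 ^+ k <= s], whereas the pieces are open on the left: the
     endpoint belongs to the previous piece. *)
  have sk : s = 2 ^+ k by apply/eqP; rewrite eq_le k2 k3.
  case: k => [|k] in k1 k2 k3 k0 sk *; first by move: s1; rewrite sk expr0 ltxx.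
  apply: (@le_trans _ _ (g k s)%:E); last first.
    by apply: (nneseries_ge_term (u := fun k => (g k s)%:E)) => i; rewrite lee_fin.
  have k0' : 0 < 2 ^+ k :> R by rewrite exprn_gt0.
  rewrite lee_fin -powRD ?(gt_eqF s0) ?implybT//.
  rewrite /g indicE mem_set/= ?in_itv/= ?sk ?lexx ?exprS ?ltr_pMl ?ltr1n// mulr1.
  rewrite powRM ?(ltW k0') ?ler0n// exprVn -powR_inv1 ?(ltW k0')// -powRrM.
  have -> : -1 * (e - a + 1) = a - 1 - e by ring.
  rewrite ler_pM2r ?powR_gt0//; apply: powR_bounded_ratio; rewrite lexx andbT; lra.
apply: (@le_lt_trans _ _ (\int[mu]_s (\sum_(k <oo) (f k s)%:E + \sum_(k <oo) (g k s)%:E))%E).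
  by apply: ge0_le_integralW => s _; rewrite ?lee_fin ?power_weight_ge0.
rewrite ge0_integralD//; last 4 first.
- by move=> s _; apply: nneseries_ge0 => k _ _; rewrite lee_fin.
- by apply: ge0_emeasurable_sum => k *; [rewrite lee_fin|apply/measurable_EFinP; exact: mf].
- by move=> s _; apply: nneseries_ge0 => k _ _; rewrite lee_fin.
- by apply: ge0_emeasurable_sum => k *; [rewrite lee_fin|apply/measurable_EFinP; exact: mg].
have serI (h : nat -> R -> R) : (forall k s, 0 <= h k s) ->
    (forall k, measurable_fun setT (h k)) ->
    (\int[mu]_s \sum_(k <oo) (h k s)%:E = \sum_(k <oo) \int[mu]_s (h k s)%:E)%E.
  move=> h0' mh; apply: integral_nneseries => //.
  - by move=> k; apply/measurable_EFinP; exact: mh.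
  - by move=> k s _; rewrite lee_fin.
rewrite !serI//.
have intc (c : R) (u v : R) : 0 <= c -> u <= v ->
    (\int[mu]_s (c * \1_(`]u, v] : set R) s)%:E = (c * (v - u))%:E)%E.
  move=> c0 uv; under eq_integral do rewrite EFinM.
  rewrite ge0_integralZl//; last exact/measurable_EFinP/measurable_indic.
  rewrite integral_indic// setIT -[X in (_ * X)%E]/(mu `]u, v]%classic).
  rewrite lebesgue_measure_itv/= lte_fin EFinM; congr (_ * _)%E.
  by case: ltP => // vu; congr EFin; lra.
apply: lte_add_pinfty.
  apply: (@le_lt_trans _ _ (\sum_(k <oo) (M * x ^+ k)%:E)%E).
    apply: lee_nneseries => k *; first by apply: integral_ge0 => s _; rewrite lee_fin.
    rewrite intc; last 2 first.
    - by rewrite mulr_ge0 ?powR_ge0.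
    - by rewrite exprS ler_piMl ?exprn_ge0 ?(ltW h0)// ltW.
    rewrite lee_fin -mulrA ler_wpM2l ?powR_ge0// expr_powR// exprS.
    have -> : 2^-1 ^+ k - 2^-1 * 2^-1 ^+ k = 2^-1 * 2^-1 ^+ k :> R by lra.
    rewrite mulrCA -exprMn -[X in _ `^ _ * X]powRr1 ?(ltW h0)//.
    rewrite -powRD ?(gt_eqF h0) ?implybT// subrK ler_piMl ?exprn_ge0 ?powR_ge0// ltW//.
  by apply: le_lt_trans (nneseries_geometric_le (powR_ge0 _ _) (xy1 _ a0)) _; rewrite ltry.
apply: (@le_lt_trans _ _ (\sum_(k <oo) (M' * y ^+ k)%:E)%E).
  apply: lee_nneseries => k *; first by apply: integral_ge0 => s _; rewrite lee_fin.
  rewrite intc; last 2 first.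
  - by rewrite mulr_ge0 ?powR_ge0.
  - by rewrite exprS ler_peMl ?exprn_ge0 ?ler1n.
  rewrite lee_fin -mulrA ler_wpM2l ?powR_ge0// expr_powR// exprS.
  have -> : 2 * 2 ^+ k - 2 ^+ k = 2 ^+ k :> R by lra.
  rewrite powRD ?(gt_eqF h0) ?implybT// powRr1 ?(ltW h0)// exprMn -mulrA -exprMn.
  by rewrite mulVf// expr1n mulr1.
have ea0 : 0 < e - a by rewrite subr_gt0.
by apply: le_lt_trans (nneseries_geometric_le (powR_ge0 _ _) (xy1 _ ea0)) _; rewrite ltry.
Qed.

Definition power_weight_mass a e := fine (\int[mu]_s (power_weight a 1 e s)%:E).

Lemma power_weight_massE a e : 0 < a < e ->
  (\int[mu]_s (power_weight a 1 e s)%:E = (power_weight_mass a e)%:E)%E.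
Proof.
move=> ae; rewrite fineK// ge0_fin_numE; first exact: power_weight_integral_lty.
by apply: integral_ge0 => s _; rewrite lee_fin power_weight_ge0.
Qed.

Lemma power_weight_mass_ge0 a e : 0 <= power_weight_mass a e.
Proof.
by apply: fine_ge0; apply: integral_ge0 => s _; rewrite lee_fin power_weight_ge0.
Qed.

Lemma integral_power_weight a S e : 0 < S -> 0 < a < e ->
  (\int[mu]_s (power_weight a S e s)%:E =
   (S `^ (a - e) * power_weight_mass a e)%:E)%E.
Proof.
move=> S0 ae; have Si : 0 < S^-1 by rewrite invr_gt0.
have := @ge0_integral_affine R S 0 (EFin \o power_weight a S e) S0
  ((measurable_EFinP _ _).2 (measurable_power_weight a S e))
  (fun x => power_weight_ge0 a S e x).
rewrite /= (_ : (\int[mu]_x _ = (S `^ (a - 1 - e))%:E * (power_weight_mass a e)%:E)%E); last first.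
  rewrite -power_weight_massE// -ge0_integralZl//; last 3 first.
  - by apply/measurable_EFinP; exact: measurable_power_weight.
  - by move=> x _; rewrite lee_fin power_weight_ge0.
  - by rewrite lee_fin powR_ge0.
  by apply: eq_integral => x _; rewrite addr0 power_weight_scale// EFinM.
move=> h.
have : (S%:E * ((S `^ (a - 1 - e))%:E * (power_weight_mass a e)%:E) =
    \int[mu]_s (power_weight a S e s)%:E)%E.
  by rewrite h muleA -EFinM divff ?gt_eqF// mul1e.
move=> <-; rewrite -!EFinM mulrA; congr (_ * _)%:E.
by rewrite -{1}(powRr1 (ltW S0)) -powRD ?(gt_eqF S0) ?implybT//; congr (_ `^ _); ring.
Qed.

End power_weights.

(** * Gaussians as Schwartz functions *)

Section gaussian.
Context {R : realType} (n : nat).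
Implicit Types (x y : 'cV[R]_n) (P Q : 'cV[R]_n -> R).

Definition gauss x : R := expR (- \sum_i x i ord0 ^+ 2).

(** The coefficients that the Gaussian acquires under differentiation. The inductive form gives
    differentiability, stability under derivatives and polynomial growth by the same induction. *)
Inductive poly_fun : ('cV[R]_n -> R) -> Prop :=
| poly_fun_cst c : poly_fun (cst c)
| poly_fun_coord i : poly_fun (fun x => x i ord0)
| poly_funD P Q : poly_fun P -> poly_fun Q -> poly_fun (P + Q)
| poly_funM P Q : poly_fun P -> poly_fun Q -> poly_fun (P * Q).

Lemma poly_fun_differentiable P x : poly_fun P -> differentiable P x.
Proof.
elim=> [c|i|{}P Q _ dP _ dQ|{}P Q _ dP _ dQ].
- exact: differentiable_cst.
- exact: differentiable_coord.
- exact: differentiableD.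
- exact: differentiableM.
Qed.

Lemma derive_coord i j x :
  'D_(delta_mx i ord0) (fun x : 'cV[R]_n => x j ord0) x = (j == i)%:R.
Proof.
have @f : {linear 'cV[R]_n -> R}.
  by exists (fun N : 'cV[R]_n => N j ord0); do 2![eexists]; do ?[constructor];
     rewrite ?mxE// => ? *; rewrite ?mxE//; move=> ?; rewrite !mxE.
rewrite deriveE; last exact: differentiable_coord.
rewrite (_ : (fun x : 'cV[R]_n => x j ord0) = f)// diff_lin; last exact: coord_continuous.
by rewrite /f/= mxE andbT.
Qed.

Lemma poly_fun_derive i P : poly_fun P ->
  exists2 Q, poly_fun Q & forall x, 'D_(delta_mx i ord0) P x = Q x.
Proof.
have dv Q x : poly_fun Q -> derivable Q x (delta_mx i ord0).
  by move=> pQ; apply: diff_derivable; exact: poly_fun_differentiable.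
elim=> [c|j|{}P Q pP [P' pP' PE] pQ [Q' pQ' QE]|{}P Q pP [P' pP' PE] pQ [Q' pQ' QE]].
- by exists (cst 0); [exact: poly_fun_cst|move=> x; rewrite derive_cst].
- exists (cst (j == i)%:R); first exact: poly_fun_cst.
  by move=> x; rewrite derive_coord.
- exists (P' + Q'); first exact: poly_funD.
  by move=> x; rewrite deriveD ?PE ?QE//; exact: dv.
- exists (P * Q' + Q * P'); first by apply: poly_funD; exact: poly_funM.
  by move=> x; rewrite deriveM ?PE ?QE//; exact: dv.
Qed.

Lemma poly_fun_sum (I : Type) (r : seq I) (F : I -> 'cV[R]_n -> R) :
  (forall i, poly_fun (F i)) -> poly_fun (fun x => \sum_(i <- r) F i x).
Proof.
move=> pF; elim: r => [|i r IH].
  by under eq_fun do rewrite big_nil; exact: poly_fun_cst.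
by under eq_fun do rewrite big_cons; exact: (poly_funD (pF i) IH).
Qed.

Definition gauss_exponent x : R := - \sum_i x i ord0 ^+ 2.

Lemma poly_fun_gauss_exponent : poly_fun gauss_exponent.
Proof.
rewrite (_ : gauss_exponent = cst (-1) * (fun x => \sum_i x i ord0 ^+ 2)).
  apply: (poly_funM (poly_fun_cst _)); apply: poly_fun_sum => i.
  by under eq_fun do rewrite expr2; exact: (poly_funM (poly_fun_coord i) (poly_fun_coord i)).
by apply/funext => x; rewrite /gauss_exponent/= mulN1r.
Qed.

Lemma gauss_differentiable x : differentiable gauss x.
Proof.
have d1 := poly_fun_differentiable x poly_fun_gauss_exponent.
apply: (@differentiable_comp _ _ _ _ gauss_exponent expR) => //.
by apply/derivable1_diffP; exact: derivable_expR.
Qed.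

Lemma gauss_derive i : exists2 Q, poly_fun Q &
  forall x, 'D_(delta_mx i ord0) gauss x = Q x * gauss x.
Proof.
have [Q pQ QE] := poly_fun_derive i poly_fun_gauss_exponent.
exists Q => // x.
have d1 := poly_fun_differentiable x poly_fun_gauss_exponent.
have d2 : differentiable (@expR R) (gauss_exponent x).
  by apply/derivable1_diffP; exact: derivable_expR.
have d3 : differentiable (expR \o gauss_exponent) x by exact: differentiable_comp.
rewrite -[gauss]/(expR \o gauss_exponent) deriveE// diff_comp//= -(deriveE _ d1) QE.
rewrite diff1E//= derive1E; congr (_ * _); exact: (congr1 (@^~ _) (@derive_expR R)).
Qed.

Definition poly_gauss P x := P x * gauss x.

Lemma poly_gauss_differentiable P x : poly_fun P -> differentiable (poly_gauss P) x.
Proof.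
move=> pP; apply: differentiableM; first exact: poly_fun_differentiable.
exact: gauss_differentiable.
Qed.

Lemma poly_gauss_derive i P : poly_fun P -> exists2 Q, poly_fun Q &
  forall x, 'D_(delta_mx i ord0) (poly_gauss P) x = poly_gauss Q x.
Proof.
move=> pP; have [P' pP' PE] := poly_fun_derive i pP.
have [G' pG' GE] := gauss_derive i.
exists (P * G' + P'); first by apply: poly_funD => //; exact: poly_funM.
move=> x; have dg := gauss_differentiable x; have gE := GE x.
rewrite [poly_gauss P](_ : _ = P * gauss)//.
rewrite deriveM; last 2 first.
- by apply: diff_derivable; exact: poly_fun_differentiable.
- exact: diff_derivable.
rewrite PE gE /poly_gauss !fctE -[_ *: _]/(_ * _) -[X in _ + X]/(_ * _); ring.
Qed.

Definition gaussC x : R[i] := (gauss x)%:C%C.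

Lemma pderivs_gauss (s : seq 'I_n) : exists2 P, poly_fun P &
  pderivs s gaussC = fun x => (poly_gauss P x)%:C%C.
Proof.
elim: s => [|i s [P pP IH]] /=.
  exists (cst 1); first exact: poly_fun_cst.
  by apply/funext => x; rewrite /poly_gauss mul1r.
have [Q pQ QE] := poly_gauss_derive i pP; exists Q => //.
rewrite IH; apply/funext => x; rewrite /pderiv.
rewrite -[X in Complex ('D_ _ X _)]/(poly_gauss P) QE.
rewrite (_ : @complex.Im R \o _ = cst 0); last by apply/funext.
by rewrite derive_cst.
Qed.

(** Comparable to [1 + enorm x] but handled coordinate by coordinate. It is at least 1, so exponents
    may be increased freely. *)
Definition l1 x : R := 1 + \sum_i `|x i ord0|.

Lemma l1_ge1 x : 1 <= l1 x.
Proof. by rewrite lerDl sumr_ge0. Qed.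

Lemma l1_ge0 x : 0 <= l1 x. Proof. exact: le_trans (l1_ge1 x). Qed.

Definition l1dist x y : R := \sum_i `|x i ord0 - y i ord0|.

Lemma l1dist_ge0 x y : 0 <= l1dist x y.
Proof. exact: sumr_ge0. Qed.

Lemma coord_le_l1 x i : `|x i ord0| <= l1 x.
Proof.
by rewrite /l1 (bigD1 i)//= addrCA lerDl addr_ge0// sumr_ge0.
Qed.

(** Growth and Lipschitz bound are proved together because the product case of the second uses the
    first. *)
Lemma poly_fun_bounds P : poly_fun P -> exists C k, [/\ 0 <= C,
  (forall x, `|P x| <= C * l1 x ^+ k) &
  (forall x y, `|P x - P y| <= C * (l1 x * l1 y) ^+ k * l1dist x y)].
Proof.
have ge1 x y : 1 <= l1 x * l1 y.
  by rewrite -[leLHS]mul1r ler_pM// l1_ge1.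
have ge0 x y : 0 <= l1 x * l1 y by rewrite mulr_ge0// l1_ge0.
have lxy x y : l1 x <= l1 x * l1 y by rewrite ler_peMr ?l1_ge1 ?l1_ge0.
have lyx x y : l1 y <= l1 x * l1 y by rewrite ler_peMl ?l1_ge1 ?l1_ge0.
elim=> [c|i|{}P Q _ [C [k [C0 P1 P2]]] _ [D [l [D0 Q1 Q2]]]
  |{}P Q _ [C [k [C0 P1 P2]]] _ [D [l [D0 Q1 Q2]]]].
- exists `|c|, 0%N; split=> // [x|x y]; first by rewrite expr0 mulr1.
  by rewrite subrr normr0 !mulr_ge0 ?exprn_ge0 ?l1dist_ge0.
- exists 1, 1%N; split=> // [x|x y]; first by rewrite mul1r coord_le_l1.
  rewrite mul1r expr1; apply: (@le_trans _ _ (l1dist x y)).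
    by rewrite /l1dist (bigD1 i)//= lerDl sumr_ge0.
  by rewrite ler_peMl ?l1dist_ge0.
- exists (C + D), (k + l)%N; split; first exact: addr_ge0.
    move=> x; apply: (le_trans (ler_normD _ _)); rewrite mulrDl; apply: lerD.
      apply: (le_trans (P1 x)); rewrite ler_wpM2l// ler_weXn2l ?l1_ge1//.
      by rewrite leq_addr.
    apply: (le_trans (Q1 x)); rewrite ler_wpM2l// ler_weXn2l ?l1_ge1//.
    by rewrite leq_addl.
  move=> x y; rewrite !fctE opprD addrACA.
  apply: (le_trans (ler_normD _ _)); rewrite (mulrDl C) (mulrDl (C * _)); apply: lerD.
    apply: (le_trans (P2 x y)); rewrite ler_wpM2r ?l1dist_ge0// ler_wpM2l//.
    by rewrite ler_weXn2l// leq_addr.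
  apply: (le_trans (Q2 x y)); rewrite ler_wpM2r ?l1dist_ge0// ler_wpM2l//.
  by rewrite ler_weXn2l// leq_addl.
- exists (C * D + C * D), (k + l)%N; split; first by rewrite addr_ge0// mulr_ge0.
    move=> x; rewrite !fctE normrM exprD.
    apply: (@le_trans _ _ ((C * l1 x ^+ k) * (D * l1 x ^+ l))); first exact: ler_pM.
    rewrite mulrACA ler_wpM2r ?mulr_ge0 ?exprn_ge0 ?l1_ge0//.
    by rewrite lerDl mulr_ge0.
  move=> x y; rewrite !fctE.
  have -> : P x * Q x - P y * Q y = P x * (Q x - Q y) + Q y * (P x - P y) by ring.
  apply: (le_trans (ler_normD _ _)); rewrite !normrM (mulrDl (C * D)) (mulrDl (C * D * _)); apply: lerD.
    apply: (@le_trans _ _ ((C * (l1 x * l1 y) ^+ k) * (D * (l1 x * l1 y) ^+ l * l1dist x y))).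
      apply: ler_pM => //; apply: (le_trans (P1 x)); rewrite ler_wpM2l//.
      by rewrite lerXn2r// nnegrE ?l1_ge0.
    by rewrite exprD !mulrA (mulrAC _ _ D).
  apply: (@le_trans _ _ ((D * (l1 x * l1 y) ^+ l) * (C * (l1 x * l1 y) ^+ k * l1dist x y))).
    apply: ler_pM => //; apply: (le_trans (Q1 y)); rewrite ler_wpM2l//.
    by rewrite lerXn2r// nnegrE ?l1_ge0.
  rewrite addnC exprD !mulrA (mulrAC _ _ C) (mulrC D C); exact: lexx.
Qed.

Lemma expRN_lip (a b : R) : 0 <= a -> 0 <= b -> `|expR (- a) - expR (- b)| <= `|a - b|.
Proof.
wlog ab : a b / a <= b.
  move=> H a0 b0; have [ab|/ltW ba] := leP a b; first exact: H.
  by rewrite distrC (distrC a); exact: H.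
move=> a0 b0; rewrite ger0_norm; last by rewrite subr_ge0 ler_expR lerN2.
rewrite distrC ger0_norm ?subr_ge0//.
have -> : expR (- b) = expR (- a) * expR (- (b - a)) by rewrite -expRD; congr expR; ring.
have := expR_ge1Dx (- (b - a)); have e0 := expR_ge0 (- (b - a)).
have := expR_ge0 (- a); have : expR (- a) <= 1 by rewrite expR_le1 oppr_le0.
move: (expR (- a)) (expR _) => u v u1 u0 h; nra.
Qed.

Lemma gauss_ge0 x : 0 <= gauss x. Proof. exact: expR_ge0. Qed.

Lemma gauss_le1 x : gauss x <= 1.
Proof. by rewrite expR_le1 oppr_le0 sumr_ge0// => i _; rewrite sqr_ge0. Qed.

Lemma gauss_lip x y : `|gauss x - gauss y| <= 2 * (l1 x * l1 y) * l1dist x y.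
Proof.
apply: (le_trans (expRN_lip _ _)); [by apply: sumr_ge0 => i _; rewrite sqr_ge0..|].
rewrite -sumrB; apply: (le_trans (ler_norm_sum _ _ _)); rewrite /l1dist mulr_sumr.
apply: ler_sum => i _; rewrite subr_sqr normrM mulrC ler_wpM2r//.
apply: (le_trans (ler_normD _ _)).
have := coord_le_l1 x i; have := coord_le_l1 y i.
have := l1_ge1 x; have := l1_ge1 y.
move: (l1 x) (l1 y) `|x i ord0| `|y i ord0| => u v a b *; nra.
Qed.

Lemma poly_gauss_lip P : poly_fun P -> exists C k, 0 <= C /\ forall x y,
  `|poly_gauss P x - poly_gauss P y| <= C * (l1 x * l1 y) ^+ k * l1dist x y.
Proof.
move=> /poly_fun_bounds[C [k [C0 P1 P2]]]; exists (3 * C), k.+1; split.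
  by rewrite mulr_ge0.
move=> x y; rewrite /poly_gauss.
have -> : P x * gauss x - P y * gauss y =
  (P x - P y) * gauss x + P y * (gauss x - gauss y) by ring.
apply: (le_trans (ler_normD _ _)); rewrite !normrM.
have g1 := gauss_le1 x; have g0 := gauss_ge0 x.
rewrite (ger0_norm g0).
have lx := l1_ge1 x; have ly := l1_ge1 y.
have p2 := P2 x y; have p1 := P1 y; have gl := gauss_lip x y.
set d := l1dist x y in p2 gl *; have d0 : 0 <= d by exact: l1dist_ge0.
set m := l1 x * l1 y in p2 gl *.
have m1 : 1 <= m by rewrite /m; nra.
have my : l1 y <= m by rewrite /m; nra.
have mk0 : 0 <= m ^+ k by rewrite exprn_ge0// (le_trans _ m1).
have p1' : `|P y| <= C * m ^+ k.
  apply: (le_trans p1); rewrite ler_wpM2l// lerXn2r// nnegrE//; first exact: l1_ge0.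
  exact: le_trans m1.
have t1 : `|P x - P y| * gauss x <= C * m ^+ k * d * m.
  apply: ler_pM => //; exact: le_trans g1 m1.
have t2 : `|P y| * `|gauss x - gauss y| <= C * m ^+ k * (2 * m * d).
  exact: ler_pM.
apply: (le_trans (lerD t1 t2)); rewrite exprSr.
by rewrite le_eqVlt; apply/orP; left; apply/eqP; ring.
Qed.

Lemma l1_gauss_bounded j : exists2 M, 0 <= M & forall x, l1 x ^+ j * gauss x <= M.
Proof.
exists ((1 + n%:R) ^+ j * (j`!%:R * expR 1)).
  by rewrite !mulr_ge0 ?exprn_ge0 ?addr_ge0 ?expR_ge0.
move=> x; pose t := \sum_i x i ord0 ^+ 2.
have t0 : 0 <= t by apply: sumr_ge0 => i _; rewrite sqr_ge0.
have lt : l1 x <= (1 + n%:R) * (1 + t).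
  apply: (@le_trans _ _ (1 + (n%:R + t))).
    rewrite lerD2l; apply: (@le_trans _ _ (\sum_i (1 + x i ord0 ^+ 2))).
      apply: ler_sum => i _; rewrite -real_normK ?num_real//.
      have := normr_ge0 (x i ord0); move: `|_| => u u0; nra.
    by rewrite big_split/= sumr_const card_ord.
  by have : 0 <= n%:R :> R by []; nra.
apply: (@le_trans _ _ (((1 + n%:R) * (1 + t)) ^+ j * gauss x)).
  rewrite ler_wpM2r ?gauss_ge0// lerXn2r// nnegrE ?l1_ge0// mulr_ge0// ?addr_ge0//.
rewrite exprMn -mulrA ler_wpM2l ?exprn_ge0 ?addr_ge0//.
have h : (1 + t) ^+ j <= j`!%:R * expR (1 + t).
  case: j => [|j]; first by rewrite expr0 fact0 mul1r -expR0 ler_expR addr_ge0.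
  have := @expR_ge1Dxn R (1 + t) j (addr_ge0 ler01 t0).
  have f0 : 0 < j.+1`!%:R :> R by rewrite ltr0n fact_gt0.
  move=> h; rewrite mulrC -ler_pdivrMr//; apply: le_trans h.
  by rewrite lerDr.
apply: (@le_trans _ _ (j`!%:R * expR (1 + t) * gauss x)).
  by rewrite ler_wpM2r ?gauss_ge0.
by rewrite -mulrA -expRD /t addrK.
Qed.

Lemma poly_gauss_decay P N : poly_fun P ->
  exists2 M, 0 <= M & forall x, (1 + enorm x) ^+ N * `|poly_gauss P x| <= M.
Proof.
move=> /poly_fun_bounds[C [k [C0 P1 _]]].
have [M M0 HM] := l1_gauss_bounded (N + k).
exists (C * M); first exact: mulr_ge0.
move=> x; rewrite /poly_gauss normrM (ger0_norm (gauss_ge0 x)).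
apply: (@le_trans _ _ (l1 x ^+ N * (C * l1 x ^+ k * gauss x))).
  apply: ler_pM; rewrite ?exprn_ge0 ?mulr_ge0 ?enorm1_ge0 ?gauss_ge0//.
    by rewrite lerXn2r ?nnegrE ?enorm1_ge0 ?l1_ge0// lerD2l le_enorm_sum.
  by rewrite ler_wpM2r ?gauss_ge0.
rewrite [leLHS](_ : _ = C * (l1 x ^+ (N + k) * gauss x)); last by rewrite exprD; ring.
by rewrite ler_wpM2l.
Qed.

Lemma normc_real (a : R) : normc (a%:C%C) = `|a|.
Proof. by rewrite /normc/= expr0n/= addr0 sqrtr_sqr. Qed.

Lemma is_schwartz_gauss : is_schwartz gaussC.
Proof.
split=> [s x|N].
  have [P pP ->] := pderivs_gauss s; split.
    exact: (poly_gauss_differentiable x pP).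
  by rewrite (_ : @complex.Im R \o _ = cst 0); [exact: differentiable_cst|apply/funext].
apply/schwartz_normP => b _; rewrite /multi_pderiv.
have [P pP ->] := pderivs_gauss (flatten [seq nseq (b i) i | i <- enum 'I_n]).
have [M _ HM] := poly_gauss_decay N pP.
by exists M => x; rewrite normc_real.
Qed.

Lemma gaussN x : gauss (- x) = gauss x.
Proof. by rewrite /gauss; congr expR; congr -%R; apply: eq_bigr => i _; rewrite mxE sqrrN. Qed.

End gaussian.

(** * Gaussians as test functions of the grand maximal function *)

Section gaussian_maximal.
Context {R : realType} (n : nat).
Implicit Types (x y z w h : 'cV[R]_n) (F : schwartz R n -> R[i]).

Lemma enorm_le_l1 x : 1 + enorm x <= l1 x.
Proof. by rewrite lerD2l le_enorm_sum. Qed.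

Lemma l1_le_enorm x : l1 x <= (1 + n%:R) * (1 + enorm x).
Proof.
have e0 := enorm_ge0 x; rewrite /l1.
apply: (@le_trans _ _ (1 + n%:R * enorm x)).
  rewrite lerD2l -[X in X%:R]card_ord mulr_natl -sumr_const.
  by apply: ler_sum => i _; exact: le_entry_enorm.
by have : 0 <= n%:R :> R by []; nra.
Qed.

Lemma l1_le_mul x h : l1 x <= l1 h * l1 (h - x).
Proof.
apply: (@le_trans _ _ (l1 h + (l1 (h - x) - 1))).
  rewrite /l1 [X in _ <= _ + X]addrC addKr -addrA lerD2l -big_split/=.
  apply: ler_sum => i _; have -> : x i ord0 = h i ord0 - (h - x) i ord0.
    by rewrite !mxE opprB addrC subrK.
  exact: ler_normB.
by have := l1_ge1 h; have := l1_ge1 (h - x); move: (l1 _) (l1 _) => u v *; nra.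
Qed.

Lemma poly_gauss_l1_decay (P : 'cV[R]_n -> R) N : poly_fun P ->
  exists2 M, 0 <= M & forall x, l1 x ^+ N * `|poly_gauss P x| <= M.
Proof.
move=> /(poly_gauss_decay N)[M M0 HM]; exists ((1 + n%:R) ^+ N * M).
  by rewrite mulr_ge0// exprn_ge0// addr_ge0.
move=> x; apply: (@le_trans _ _ (((1 + n%:R) * (1 + enorm x)) ^+ N * `|poly_gauss P x|)).
  rewrite ler_wpM2r// lerXn2r ?nnegrE ?l1_ge0 ?l1_le_enorm//.
  by apply: mulr_ge0; [apply: addr_ge0|exact: enorm1_ge0].
by rewrite exprMn -mulrA ler_wpM2l// exprn_ge0// addr_ge0.
Qed.

(** The scale [c] is an inverse width: this is the function [exp(- c^2 |z - y|^2)] of [y]. *)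
Definition gauss_at z (c : {posnum R}) : schwartz R n :=
  mk_schwartz (is_schwartz_affine z [gt0 of c%:num] (@is_schwartz_gauss R n)).

Lemma pderivs_gauss_affine (s : seq 'I_n) : exists2 P, poly_fun P &
  forall (c : R) z y,
    pderivs s (@gaussC R n \o (fun y => c *: (z - y))) y =
    ((- c) ^+ size s * poly_gauss P (c *: (z - y)))%:C%C.
Proof.
have [P pP PE] := @pderivs_gauss R n s; exists P => // c z y.
rewrite pderivs_affine; last by case: (@is_schwartz_gauss R n).
by rewrite PE !fctE [RHS](rmorphM (real_complex R)) (rmorphXn (real_complex R)) (rmorphN (real_complex R)).
Qed.

(** Since [1 + |y|] is at most a constant times [(1 + |h|) (1 + |h - y|)], moving the unit Gaussian
    to [h] costs the power [L] of [1 + |h|]. After division by it, the translate belongs to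
    [unit_schwartz L]. *)
Lemma gauss_shift_norm L : exists2 C0 : R, 0 < C0 & forall h,
  (schwartz_norm L (((C0 * (1 + enorm h) ^+ L)^-1)%:C%C *:
     (@gaussC R n \o (fun y => 1 *: (h - y)))) <= 1)%E.
Proof.
pose D : R := (1 + n%:R) ^+ 2.
have D0 : 0 <= D by rewrite exprn_ge0// addr_ge0.
have bnd (b : {ffun 'I_n -> 'I_L.+1}) : exists M, 0 <= M /\ forall (a : R) h y, 0 <= a ->
    (1 + enorm y) ^+ L * normc (multi_pderiv (fun i => b i) (a%:C%C *:
     (@gaussC R n \o (fun y => 1 *: (h - y)))) y) <= a * (1 + enorm h) ^+ L * M.
  rewrite /multi_pderiv; set s := flatten _.
  have [P pP PE] := pderivs_gauss_affine s.
  have [M M0 HM] := poly_gauss_decay L pP.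
  exists (D ^+ L * M); split; first by rewrite mulr_ge0// exprn_ge0.
  move=> a h y a0.
  have sg : smooth (@gaussC R n \o (fun y => 1 *: (h - y))).
    by case: (is_schwartz_affine h ltr01 (@is_schwartz_gauss R n)).
  have -> : pderivs s (a%:C%C *: (@gaussC R n \o (fun y => 1 *: (h - y)))) y =
     (a * ((- 1) ^+ size s * poly_gauss P (1 *: (h - y))))%:C%C.
    rewrite -[X in pderivs s X]addr0 pderivsZD//; last exact: smooth0.
    by rewrite pderivs0 addr0 !fctE PE [RHS](rmorphM (real_complex R)).
  rewrite normc_real scale1r; have := HM (h - y); move: (poly_gauss P (h - y)) => v Hv.
  rewrite !normrM normrX normrN1 expr1n mul1r (ger0_norm a0).
  have yh : (1 + enorm y) ^+ L <= D ^+ L * ((1 + enorm h) ^+ L * (1 + enorm (h - y)) ^+ L).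
    rewrite -!exprMn lerXn2r ?nnegrE ?mulr_ge0 ?enorm1_ge0//.
    apply: (le_trans (enorm_le_l1 y)); apply: (le_trans (l1_le_mul y h)).
    rewrite /D expr2 mulrACA; apply: ler_pM; rewrite ?l1_ge0//; exact: l1_le_enorm.
  apply: (@le_trans _ _ (D ^+ L * ((1 + enorm h) ^+ L * (1 + enorm (h - y)) ^+ L) *
     (a * `|v|))).
    by rewrite ler_wpM2r// mulr_ge0.
  rewrite [leLHS](_ : _ = a * (1 + enorm h) ^+ L * (D ^+ L *
    ((1 + enorm (h - y)) ^+ L * `|v|))); last by ring.
  rewrite ler_wpM2l ?mulr_ge0 ?exprn_ge0 ?enorm1_ge0//.
  by rewrite ler_wpM2l ?exprn_ge0.
have [M HM] := choice bnd.
pose S := \sum_(b : {ffun 'I_n -> 'I_L.+1} | (\sum_i b i <= L)%N) M b.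
have S0 : 0 <= S by apply: sumr_ge0 => b _; exact: (HM b).1.
exists (1 + S); first exact: ltr_wpDr.
move=> h; set K := (1 + S) * _; have h0 : 0 < (1 + enorm h) ^+ L.
  by rewrite exprn_gt0// ltr_wpDr ?enorm_ge0.
have K0 : 0 < K by rewrite mulr_gt0// ltr_wpDr.
apply: (@le_trans _ _ (\sum_(b : {ffun 'I_n -> 'I_L.+1} | (\sum_i b i <= L)%N)
   ((1 + S)^-1 * M b)%:E)%E).
  apply: lee_sum => b bL; apply: ge_ereal_sup => _ [y _ <-]; rewrite lee_fin.
  apply: (le_trans ((HM b).2 _ _ _ _)); first by rewrite invr_ge0 ltW.
  by rewrite /K invfM -mulrA mulrA divfK ?gt_eqF.
rewrite sumEFin lee_fin -mulr_sumr -/S mulrC ler_pdivrMr ?ltr_wpDr// mul1r.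
by rewrite lerDr.
Qed.

Lemma linear_scale F (a : R[i]) f : linear F -> F (a *: f) = a * F f.
Proof.
move=> lF; have F0 : F 0 = 0.
  by have := lF (-1) 0 0; rewrite scaler0 addr0 scaleN1r addNr.
by have := lF a f 0; rewrite !addr0 F0 addr0.
Qed.

Lemma linear_sub F f g : linear F -> F (f - g) = F f - F g.
Proof.
move=> lF; rewrite addrC -scaleN1r lF [RHS]addrC; congr (_ + _); exact: mulN1r.
Qed.

(** Seen from [w], the Gaussian at [z] is the dilation by [1 / c] of a unit Gaussian displaced by
    [h = c (w - z)], and the displaced Gaussian is admissible up to the factor [(1 + |h|)^L]. *)
Lemma gauss_at_le_grand_maximal L : exists2 C : R, 0 < C &
  forall F, linear F -> forall (c : {posnum R}) z w,
  ((normc (F (gauss_at z c)))%:E <=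
   (C * c%:num ^- n * (1 + c%:num * enorm (w - z)) ^+ L)%:E * grand_maximal L F w)%E.
Proof.
have [C0 C00 HC] := gauss_shift_norm L.
exists C0 => // F lF c z w; pose h := c%:num *: (w - z).
have eh : enorm h = c%:num * enorm (w - z).
  rewrite /enorm (_ : \sum_i h i ord0 ^+ 2 = c%:num ^+ 2 * \sum_i (w - z) i ord0 ^+ 2).
    by rewrite sqrtrM ?sqr_ge0// sqrtr_sqr ger0_norm.
  by rewrite mulr_sumr; apply: eq_bigr => i _; rewrite !mxE exprMn.
rewrite -eh; pose K := C0 * (1 + enorm h) ^+ L.
have K0 : 0 < K by rewrite mulr_gt0// exprn_gt0// ltr_wpDr ?enorm_ge0.
pose f1 : schwartz R n := mk_schwartz (is_schwartz_affine h ltr01 (@is_schwartz_gauss R n)).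
pose phi : schwartz R n := (K^-1)%:C%C *: f1.
have cn : c%:num^-1 ^- n = c%:num ^+ n by rewrite exprVn invrK.
(* The reflection in the convolution turns the argument into its opposite, which the evenness of the
   Gaussian undoes. *)
have key : schwartz_reflect w (dilation (c%:num^-1%:pos) phi) =
    (c%:num ^+ n / K)%:C%C *: gauss_at z c.
  apply: val_inj; apply/funext => y /=.
  rewrite cn invrK -[RHS]/((c%:num ^+ n / K)%:C%C * gaussC (c%:num *: (z - y))).
  rewrite -[X in _ * X = _]/((K^-1)%:C%C * gaussC (1 *: (h - c%:num *: (w - y)))).
  rewrite mulrA -(rmorphM (real_complex R)) scale1r; congr (_ * _).
  have -> : h - c%:num *: (w - y) = - (c%:num *: (z - y)).
    by rewrite /h -scalerBr -scalerN !opprB addrC addrA addrNK.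
  by rewrite /gaussC gaussN.
have : ((normc (F (schwartz_reflect w (dilation (c%:num^-1%:pos) phi))))%:E <= grand_maximal L F w)%E.
  by apply: ereal_sup_ubound; exists (c%:num^-1%:pos) => //; exists phi => //; exact: HC.
rewrite key linear_scale// normcM normc_real ger0_norm ?divr_ge0 ?(ltW K0)//.
move=> H; rewrite [(C0 * _ * _)%R](_ : _ = c%:num ^- n * K); last first.
  by rewrite /K mulrAC mulrC.
have q0 : 0 < c%:num ^- n * K by rewrite mulr_gt0.
rewrite [X in (X <= _)%E](_ : _ = (c%:num ^- n * K)%:E *
   (c%:num ^+ n / K * normc (F (gauss_at z c)))%:E)%E; last first.
  rewrite -EFinM; congr EFin; rewrite mulrA (mulrC (c%:num ^+ n)) mulrA mulfK ?gt_eqF//.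
  by rewrite mulVf ?mul1r.
by apply: lee_wpmul2l; rewrite ?lee_fin ?(ltW q0).
Qed.

End gaussian_maximal.

(** * Continuity and measurability of the pairing with a moving Gaussian *)

Section gaussian_continuity.
Context {R : realType} (n : nat).
Implicit Types (x y z w : 'cV[R]_n) (F : schwartz R n -> R[i]).

Lemma exprn_lip (q a b : R) k : 1 <= q -> `|a| <= q -> `|b| <= q ->
  `|a ^+ k - b ^+ k| <= k%:R * q ^+ k * `|a - b|.
Proof.
move=> q1 aq bq; have q0 : 0 <= q by exact: le_trans q1.
elim: k => [|k IH]; first by rewrite !expr0 subrr normr0 !mul0r.
have -> : a ^+ k.+1 - b ^+ k.+1 = a * (a ^+ k - b ^+ k) + b ^+ k * (a - b).
  by rewrite !exprS; ring.
apply: (le_trans (ler_normD _ _)); rewrite !normrM -natr1 !mulrDl mul1r.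
apply: lerD; last first.
  rewrite ler_wpM2r// normrX (@le_trans _ _ (q ^+ k))//.
    by rewrite lerXn2r// nnegrE.
  by rewrite exprS ler_peMl// exprn_ge0.
rewrite exprS (mulrCA _ q) -(mulrA q); apply: ler_pM => //.
Qed.

(** Far out, one extra power of decay makes both functions small separately; on the remaining
    bounded region the Lipschitz bounds are uniform. *)
Lemma gauss_affine_continuity (P : 'cV[R]_n -> R) (k N : nat) (c0 : R) z0 (e : R) :
  poly_fun P -> 0 < c0 -> 0 < e -> exists2 d : R, 0 < d & forall c z,
    `|c - c0| < d -> (forall i, `|z i ord0 - z0 i ord0| < d) -> forall y,
    (1 + enorm y) ^+ N * `|(- c) ^+ k * poly_gauss P (c *: (z - y)) -
                          (- c0) ^+ k * poly_gauss P (c0 *: (z0 - y))| <= e.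
Proof.
move=> pP c00 e0.
have [C [j [C0 lipP]]] := poly_gauss_lip pP.
have [M M0 HM] := poly_gauss_l1_decay N.+1 pP.
have n0 : 0 <= n%:R :> R by [].
pose q := c0 + 1; have q1 : 1 <= q by rewrite /q; lra.
pose Z := l1 z0 + n%:R; have Z1 : 1 <= Z by have := l1_ge1 z0; rewrite /Z; lra.
pose B := Z + 2 / c0.
have B0 : 0 <= B by rewrite /B addr_ge0 ?divr_ge0 ?(ltW c00)//; lra.
pose M1 := q ^+ k * (B ^+ N.+1 * M).
have M10 : 0 <= M1 by rewrite !mulr_ge0 ?exprn_ge0//; lra.
(* Beyond [r] the two functions, each bounded by [M1] with weight exponent [N.+1], differ by at most
   [2 * M1 / r = e] with weight exponent [N]. *)
pose r := 2 * M1 / e.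
have r0 : 0 <= r by apply: divr_ge0; [exact: mulr_ge0|exact: ltW].
pose B' := 1 + q * (Z + r).
have B'1 : 1 <= B' by rewrite /B' lerDl mulr_ge0//; lra.
pose big := r ^+ N * (k%:R * q ^+ k * M + q ^+ k * (C * (B' * B') ^+ j * (Z + r + q * n%:R))).
have big0 : 0 <= big.
  have ? : 0 <= q by lra.
  have ? : 0 <= Z by lra.
  have ? : 0 <= B' by lra.
  apply: mulr_ge0; first exact: exprn_ge0.
  apply: addr_ge0; first by apply: mulr_ge0 => //; apply: mulr_ge0 => //; exact: exprn_ge0.
  apply: mulr_ge0; first exact: exprn_ge0.
  apply: mulr_ge0; first by apply: mulr_ge0 => //; apply: exprn_ge0; exact: mulr_ge0.
  by apply: addr_ge0; [exact: addr_ge0|exact: mulr_ge0].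
(* The first two bounds keep [c] between [c0 / 2] and [q] and the centre within [Z]; the third
   compensates [big], the Lipschitz constant on the bounded region. *)
pose d := Num.min 1 (Num.min (c0 / 2) (e / (big + 1))).
have d0 : 0 < d by rewrite !lt_min ltr01/= !divr_gt0//; lra.
have d1 : d <= 1 by rewrite ge_min lexx.
have d2 : d <= c0 / 2 by rewrite !ge_min lexx orbT.
have d3 : d <= e / (big + 1) by rewrite !ge_min lexx !orbT.
exists d => // c z cd zd y.
have far c' z' : c0 / 2 <= c' <= q -> l1 z' <= Z ->
    l1 y ^+ N.+1 * `|(- c') ^+ k * poly_gauss P (c' *: (z' - y))| <= M1.
  move=> /andP[c1 c2] zZ; have c'0 : 0 < c' by apply: lt_le_trans c1; lra.
  set u := c' *: (z' - y).
  have yu : l1 y <= B * l1 u.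
    apply: (@le_trans _ _ (l1 z' + c'^-1 * (l1 u - 1))).
      rewrite /l1 [X in _ * X]addrC addKr mulr_sumr -addrA lerD2l -big_split/=.
      apply: ler_sum => i _; have -> : y i ord0 = z' i ord0 - c'^-1 * u i ord0.
        by rewrite !mxE mulrA mulVf ?gt_eqF// mul1r opprB addrC subrK.
      apply: (le_trans (ler_normB _ _)); rewrite normrM (ger0_norm (_ : 0 <= c'^-1))//.
      by rewrite invr_ge0 ltW.
    have ci : c'^-1 <= 2 / c0.
      by rewrite -[leRHS]invrK invf_div lef_pV2 ?posrE ?divr_gt0.
    have ci0 : 0 <= c'^-1 by rewrite invr_ge0 ltW.
    have := l1_ge1 u; have := l1_ge1 z'; rewrite /B.
    move: (2 / c0) (c'^-1) (l1 u) (l1 z') zZ ci ci0 => *; nra.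
  rewrite normrM normrX normrN (gtr0_norm c'0) mulrCA.
  apply: ler_pM; rewrite ?mulr_ge0 ?exprn_ge0 ?l1_ge0 ?(ltW c'0)//.
    by rewrite lerXn2r ?nnegrE ?(ltW c'0)//; lra.
  apply: (@le_trans _ _ ((B * l1 u) ^+ N.+1 * `|poly_gauss P u|)).
    by rewrite ler_wpM2r// lerXn2r ?nnegrE ?l1_ge0 ?mulr_ge0 ?l1_ge0.
  by rewrite exprMn -mulrA ler_wpM2l ?exprn_ge0.
have zZ : l1 z <= Z.
  rewrite /Z /l1 -addrA lerD2l -[X in _ + X%:R]card_ord -sumr_const -big_split/=.
  apply: ler_sum => i _; have -> : z i ord0 = z0 i ord0 + (z i ord0 - z0 i ord0) by rewrite addrC subrK.
  apply: (le_trans (ler_normD _ _)); rewrite lerD2l.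
  exact: le_trans (ltW (zd i)) d1.
have z0Z : l1 z0 <= Z by rewrite /Z lerDl.
have /andP[c1 c2] : c0 / 2 <= c <= q.
  move: cd; rewrite ltr_norml => /andP[h1 h2]; apply/andP; rewrite /q; split; lra.
have f1 := far c z (introT andP (conj c1 c2)) zZ.
have f0 : l1 y ^+ N.+1 * `|(- c0) ^+ k * poly_gauss P (c0 *: (z0 - y))| <= M1.
  by apply: far => //; rewrite /q; lra.
have l1y := l1_ge1 y; have l1y0 := l1_ge0 y.
apply: (@le_trans _ _ (l1 y ^+ N * `|(- c) ^+ k * poly_gauss P (c *: (z - y)) -
                          (- c0) ^+ k * poly_gauss P (c0 *: (z0 - y))|)).
  by rewrite ler_wpM2r// lerXn2r ?nnegrE ?enorm1_ge0 ?enorm_le_l1.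
have [yr|yr] := leP r (l1 y).
  have y0 : 0 < l1 y by exact: lt_le_trans l1y.
  rewrite -(ler_pM2l y0) mulrA -exprS.
  apply: (@le_trans _ _ (2 * M1)); last by rewrite -ler_pdivrMr.
  apply: (@le_trans _ _ (l1 y ^+ N.+1 * (`|(- c) ^+ k * poly_gauss P (c *: (z - y))| +
                          `|(- c0) ^+ k * poly_gauss P (c0 *: (z0 - y))|))).
    by rewrite ler_wpM2l ?exprn_ge0// ler_normB.
  by rewrite mulrDr; lra.
set u := c *: (z - y); set u0 := c0 *: (z0 - y).
have uB c' z' : 0 <= c' -> c' <= q -> l1 z' <= Z -> l1 (c' *: (z' - y)) <= B'.
  move=> c'0 c'q z'Z; rewrite /l1 /B' lerD2l.
  apply: (@le_trans _ _ (c' * (l1 z' + l1 y))); last first.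
    by apply: ler_pM => //; [rewrite addr_ge0 ?l1_ge0|apply: lerD => //; exact: ltW].
  rewrite /l1 addrACA mulrDr -[leLHS]add0r; apply: lerD; first by rewrite mulr_ge0.
  rewrite -big_split mulr_sumr/=; apply: ler_sum => i _.
  by rewrite !mxE normrM (ger0_norm c'0) ler_wpM2l// ler_normB.
have cge0 : 0 <= c by lra.
have u1 : l1 u <= B' by apply: uB.
have u01 : l1 u0 <= B' by apply: uB => //; rewrite /q; lra.
have du : l1dist u u0 <= d * (Z + r + q * n%:R).
  apply: (@le_trans _ _ (\sum_i (d * (`|z i ord0| + `|y i ord0|) + d * q))).
    apply: ler_sum => i _; rewrite !mxE.
    have -> : c * (z i ord0 - y i ord0) - c0 * (z0 i ord0 - y i ord0) =
      (c - c0) * (z i ord0 - y i ord0) + c0 * (z i ord0 - z0 i ord0) by ring.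
    apply: (le_trans (ler_normD _ _)); rewrite !normrM; apply: lerD.
      by apply: ler_pM => //; [exact: ltW|exact: ler_normB].
    rewrite mulrC; apply: ler_pM => //; first exact/ltW/zd.
    by rewrite ger0_norm /q; lra.
  rewrite big_split/= -mulr_sumr sumr_const card_ord -mulrnAr -mulr_natr -mulrDr.
  rewrite ler_wpM2l ?(ltW d0)// lerD2r big_split/=; apply: lerD.
    by apply: le_trans zZ; rewrite lerDr.
  by apply: le_trans (ltW yr); rewrite lerDr.
have psi_le v : `|poly_gauss P v| <= M.
  apply: le_trans (HM v); rewrite ler_peMl// exprn_ege1// l1_ge1//.
have pu : `|poly_gauss P u - poly_gauss P u0| <=
    C * (B' * B') ^+ j * (d * (Z + r + q * n%:R)).
  apply: (le_trans (lipP _ _)); apply: ler_pM => //.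
  - by rewrite mulr_ge0 ?exprn_ge0 ?mulr_ge0 ?l1_ge0.
  - exact: l1dist_ge0.
  rewrite ler_wpM2l// lerXn2r ?nnegrE ?mulr_ge0 ?l1_ge0//; try lra.
  by apply: ler_pM; rewrite ?l1_ge0.
have ck : `|(- c) ^+ k - (- c0) ^+ k| <= k%:R * q ^+ k * d.
  have := @exprn_lip q (- c) (- c0) k q1; rewrite !normrN (ger0_norm cge0) (gtr0_norm c00).
  rewrite -opprD normrN => /(_ c2 _)/le_trans; apply; first by rewrite /q; lra.
  by rewrite ler_wpM2l ?mulr_ge0 ?exprn_ge0 ?(ltW cd)//; lra.
apply: (@le_trans _ _ (r ^+ N * (k%:R * q ^+ k * d * M +
   q ^+ k * (C * (B' * B') ^+ j * (d * (Z + r + q * n%:R)))))).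
  apply: ler_pM; rewrite ?exprn_ge0//; first by rewrite lerXn2r ?nnegrE// ltW.
  have -> : (- c) ^+ k * poly_gauss P u - (- c0) ^+ k * poly_gauss P u0 =
    ((- c) ^+ k - (- c0) ^+ k) * poly_gauss P u +
    (- c0) ^+ k * (poly_gauss P u - poly_gauss P u0) by ring.
  apply: (le_trans (ler_normD _ _)); rewrite (normrM (_ - _)) (normrM (_ ^+ k)).
  apply: lerD; apply: ler_pM => //.
  rewrite normrX normrN gtr0_norm// lerXn2r ?nnegrE ?(ltW c00)//; rewrite /q; lra.
rewrite [leLHS](_ : _ = d * big); last by rewrite /big; ring.
have : d * (big + 1) <= e by rewrite -ler_pdivlMr//; lra.
move: d0 big0; move: (d) (big) => d' b' *; nra.
Qed.

(** Extended by 0 to nonpositive scales, so that it becomes a function on a product of measurable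
    spaces. *)
Definition gauss_val F (c : R) z : R[i] :=
  if pselect (0 < c) is left c0 then F (gauss_at z (PosNum c0)) else 0.

Lemma gauss_val_continuity F (c0 : R) z0 (e : R) : tempered_distribution F ->
  0 < c0 -> 0 < e -> exists2 d : R, 0 < d & forall c z,
    `|c - c0| < d -> (forall i, `|z i ord0 - z0 i ord0| < d) -> 0 < c ->
    normc (gauss_val F c z - gauss_val F c0 z0) <= e.
Proof.
move=> [lF [N [C FC]]] c00 e0.
pose T := {ffun 'I_n -> 'I_N.+1}.
(* The sign of [C] is not known, hence [|C|]; the cardinal of [T] bounds the number of derivatives
   that enter [schwartz_norm N]. *)
pose e1 : R := e / ((`|C| + 1) * (#|{: T}|%:R + 1)).
have den0 : 0 < (`|C| + 1) * (#|{: T}|%:R + 1) :> R by rewrite mulr_gt0// ltr_wpDl.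
have e10 : 0 < e1 by rewrite divr_gt0.
have bnd (b : T) : exists d : R, 0 < d /\ forall c z,
    `|c - c0| < d -> (forall i, `|z i ord0 - z0 i ord0| < d) -> forall y,
    (1 + enorm y) ^+ N * normc (multi_pderiv (fun i => b i)
       ((@gaussC R n \o (fun y => c *: (z - y)))) y -
     multi_pderiv (fun i => b i) ((@gaussC R n \o (fun y => c0 *: (z0 - y)))) y) <= e1.
  rewrite /multi_pderiv; set s := flatten _.
  have [P pP PE] := @pderivs_gauss_affine R n s.
  have [d d0 Hd] := gauss_affine_continuity (size s) N z0 pP c00 e10.
  exists d; split=> // c z cd zd y.
  by rewrite !PE -(rmorphB (real_complex R)) normc_real; exact: Hd.
have [dd Hdd] := choice bnd.
pose d := \big[Num.min/1]_(b : T) dd b.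
exists d; first by apply: lt_bigmin => // b _; exact: (Hdd b).1.
move=> c z cd zd cpos; rewrite /gauss_val.
case: pselect => // cp; case: pselect => // c0p.
rewrite -linear_sub//.
have := FC (gauss_at z (PosNum cp) - gauss_at z0 (PosNum c0p)).
set f := _ - _.
have -> : schwartz_fun f = (-1 : R[i]) *: (@gaussC R n \o (fun y => c0 *: (z0 - y))) +
    (@gaussC R n \o (fun y => c *: (z - y))).
  by rewrite scaleN1r addrC.
have sg c' z' : 0 < c' -> smooth (@gaussC R n \o (fun y => c' *: (z' - y))).
  by move=> c'0; case: (is_schwartz_affine z' c'0 (@is_schwartz_gauss R n)).
set G := _ + _; move=> H.
have nG : (schwartz_norm N G <= (#|{: T}|%:R * e1)%:E)%E.
  apply: (@le_trans _ _ (\sum_(b : T | (\sum_i b i <= N)%N) e1%:E)%E).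
    apply: lee_sum => b bN; apply: ge_ereal_sup => _ [y _ <-]; rewrite lee_fin.
    rewrite /G multi_pderivZD; [|exact: sg..].
    rewrite scaleN1r !fctE addrC; apply: (Hdd b).2.
      by apply: (lt_le_trans cd); exact: bigmin_le.
    by move=> i; apply: (lt_le_trans (zd i)); exact: bigmin_le.
  rewrite sumEFin lee_fin sumr_const -[leLHS]mulr_natl ler_wpM2r ?(ltW e10)// ler_nat.
  exact: max_card.
rewrite -lee_fin; apply: (le_trans H).
apply: (@le_trans _ _ (`|C|%:E * schwartz_norm N G)%E).
  apply: lee_wpmul2r; last by rewrite lee_fin ler_norm.
  apply: sume_ge0 => b _; apply: (@le_trans _ _ ((1 + enorm 0) ^+ N *
     normc (multi_pderiv (fun i => b i) G 0))%:E).
    by rewrite lee_fin mulr_ge0 ?enormX_ge0 ?normc_ge0.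
  by apply: ereal_sup_ubound; exists 0.
apply: (@le_trans _ _ (`|C|%:E * (#|{: T}|%:R * e1)%:E)%E).
  by apply: lee_wpmul2l => //; rewrite lee_fin.
rewrite -EFinM lee_fin /e1; set t := #|_|%:R in den0 *.
rewrite [leLHS](_ : _ = e * (`|C| * t / ((`|C| + 1) * (t + 1)))); last by ring.
rewrite -[leRHS]mulr1 ler_wpM2l ?(ltW e0)// ler_pdivrMr// mul1r.
have : 0 <= t by []. have := normr_ge0 C; move: `|C| => v v0 t0; nra.
Qed.

Lemma box_continuous_measurable k (D : set 'cV[R]_k) (f : 'cV[R]_k -> R) :
  box_open D ->
  (forall x : 'cV[R]_k, D x -> forall e, 0 < e -> exists2 d : R, 0 < d & forall y : 'cV[R]_k,
    (forall i, `|y i ord0 - x i ord0| < d) -> D y -> `|f y - f x| <= e) ->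
  measurable_fun D f.
Proof.
move=> oD cf; have mD := box_open_measurable oD; move=> _; apply: (measurability _ (RGenOInfty.measurableE R)) => //.
move=> _ [_ [a ->] <-]; apply: box_open_measurable => x [Dx /=].
rewrite in_itv/= andbT => afx.
have [d1 d10 D1] := oD x Dx.
have [|d2 d20 D2] := cf x Dx ((f x - a) / 2); first by rewrite divr_gt0// subr_gt0.
exists (Num.min d1 d2); first by rewrite lt_min d10.
move=> y xy; have Dy : D y.
  by apply: D1 => i; apply: (lt_le_trans (xy i)); rewrite ge_min lexx.
split=> //=; rewrite in_itv/= andbT.
have xy2 i : `|y i ord0 - x i ord0| < d2.
  by apply: (lt_le_trans (xy i)); rewrite ge_min lexx orbT.
by have := D2 y xy2 Dy; rewrite ler_norml => /andP[h _]; lra.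
Qed.

Lemma uncons_cV_close (v w : 'cV[R]_n.+1) (d : R) :
  (forall i, `|w i ord0 - v i ord0| < d) ->
  `|(uncons_cV w).1 - (uncons_cV v).1| < d /\
  forall i, `|(uncons_cV w).2 i ord0 - (uncons_cV v).2 i ord0| < d.
Proof.
by move=> vw; rewrite /uncons_cV/=; split=> [|i]; rewrite !mxE; exact: vw.
Qed.

(** Here [g] stands for the real or the imaginary part. Pairs are read as points of the space of one
    more dimension through [cons_cV]; there the function is continuous on the open half-space of
    positive scales and constant off it. *)
Lemma measurable_gauss_val_comp F (g : R[i] -> R) : tempered_distribution F ->
  (forall a b, `|g a - g b| <= normc (a - b)) ->
  measurable_fun setT (fun p : R * 'cV[R]_n => g (gauss_val F p.1 p.2)).
Proof.
move=> tF lg.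
pose D : set 'cV[R]_n.+1 := [set v | 0 < (uncons_cV v).1].
have oD : box_open D.
  move=> v Dv; exists (uncons_cV v).1 => // w /uncons_cV_close[+ _].
  by rewrite /D/= ltr_norml => /andP[h1 h2]; lra.
pose f (v : 'cV[R]_n.+1) := g (gauss_val F (uncons_cV v).1 (uncons_cV v).2).
have mf : measurable_fun D f.
  apply: box_continuous_measurable => // v Dv e e0.
  have [d d0 Hd] := gauss_val_continuity (uncons_cV v).2 tF Dv e0.
  exists d => // w /uncons_cV_close[h1 h2] Dw.
  by apply: (le_trans (lg _ _)); exact: Hd.
have mT : measurable_fun setT f.
  have mD : measurable D by exact: box_open_measurable.
  rewrite -(setUv D); apply/measurable_funU => //; first exact: measurableC.
  split=> //; apply: (eq_measurable_fun (cst (g 0))); last exact: measurable_cst.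
  move=> v; rewrite inE /D/= => /negP Dv; rewrite /f /gauss_val.
  by case: pselect => // h; case/negP: Dv.
rewrite (_ : (fun p : R * 'cV[R]_n => _) = f \o @cons_cV R n).
  by apply: measurableT_comp => //; exact: measurable_cons_cV.
apply/funext => p; rewrite -[RHS]/(f (cons_cV p)).
by rewrite /f cons_cVK.
Qed.

End gaussian_continuity.

(** * Rearrangements and the Gaussian maximal function *)

Section rearrangements.
Context {R : realType} (n : nat).
Implicit Types (g : 'cV[R]_n -> \bar R).
Local Open Scope ereal_scope.

Lemma rearrangement_ge0 g t : 0 <= rearrangement g t.
Proof. by apply: le_ereal_inf_tmp => _ [s [s0 _] <-]; rewrite lee_fin. Qed.

Lemma rearrangement_nonincreasing g t t' : (t <= t')%R ->
  rearrangement g t' <= rearrangement g t.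
Proof.
move=> tt'; apply: le_ereal_inf => _ [s [s0 st] <-]; exists s => //; split=> //.
by apply: (le_trans st); rewrite lee_fin.
Qed.

Lemma rearrangement_le (C : R) g1 g2 t : (0 < C)%R ->
  (forall x, g1 x <= C%:E * g2 x) ->
  rearrangement g1 t <= C%:E * rearrangement g2 t.
Proof.
move=> C0 g12; rewrite muleC -lee_pdivrMr//.
apply: le_ereal_inf_tmp => _ [s [s0 st] <-]; rewrite lee_pdivrMr// -EFinM.
apply: ereal_inf_lbound; exists (s * C)%R => //; split; first by rewrite mulr_ge0// ltW.
apply: le_trans st; apply: le_lebesgue_rnW => x /= sg.
have := lt_le_trans sg (g12 x); rewrite EFinM muleC.
by rewrite lte_pmul2l// lte_fin.
Qed.

(** The infimum in the rearrangement is attained: the level set is the increasing union of those at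
    the heights [r + 1/(k+1)], each of measure at most [t]. *)
Lemma rearrangement_level g (t : R) :
  (forall s : R, measurable [set x | s%:E < g x]) -> rearrangement g t < +oo ->
  lebesgue_rn n [set x | rearrangement g t < g x] <= t%:E.
Proof.
move=> mg foo; have fin : rearrangement g t \is a fin_num.
  by rewrite ge0_fin_numE// rearrangement_ge0.
move: (fin); rewrite -(fineK fin); set r := fine _; move=> _.
have -> : [set x | r%:E < g x] = \bigcup_k [set x | (r + k.+1%:R^-1)%:E < g x].
  apply/seteqP; split=> x /=; last first.
    by move=> [k _ /=]; apply: lt_trans; rewrite lte_fin ltrDl invr_gt0.
  case gx: (g x) => [y| |]//; last by exists 0%N => //=; rewrite gx ltry.
  rewrite lte_fin => ry; have yr0 : (0 < y - r)%R by rewrite subr_gt0.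
  exists (Num.truncn (y - r)^-1); rewrite //= gx lte_fin -ltrBrDl.
  by rewrite -[ltRHS]invrK ltf_pV2 ?posrE ?invr_gt0// truncnS_gt.
have mono i j : (i <= j)%N -> [set x | (r + i.+1%:R^-1)%:E < g x] `<=`
    [set x | (r + j.+1%:R^-1)%:E < g x].
  move=> ij x /=; apply: le_lt_trans; rewrite lee_fin lerD2l lef_pV2 ?posrE//.
  by rewrite ler_nat.
have := @nondecreasing_cvg_mu _ _ _ (lebesgue_rn n)
  (fun k => [set x | (r + k.+1%:R^-1)%:E < g x]).
move=> /(_ _ _ _)/cvg_lim <- //.
- apply: lime_le.
    apply: ereal_nondecreasing_is_cvgn => i j ij; apply: le_lebesgue_rnW.
    exact: mono.
  near=> k.
  have : rearrangement g t < (r + k.+1%:R^-1)%:E.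
    by rewrite -(fineK fin) lte_fin ltrDl invr_gt0.
  move=> /ereal_inf_lt[_ [s [s0 st] <-]]; rewrite lte_fin => sr.
  apply: le_trans st; apply: le_lebesgue_rnW => x /=; apply: lt_trans.
  by rewrite lte_fin.
- by apply: bigcupT_measurable => k; exact: mg.
- by move=> i j ij; apply/subsetPset; exact: mono.
Unshelve. all: by end_near. Qed.

End rearrangements.

Section gaussian_maximal_function.
Context {R : realType} (n : nat).
Context (L : nat) (F : schwartz R n -> R[i]).
Implicit Types (z w : 'cV[R]_n) (c : {posnum R}).

(* Tangential maximal function of the Gaussian averages of [F].  Unlike the grand
   maximal function its level sets are open for trivial reasons. *)
Definition gauss_maximal w : \bar R :=
  ereal_sup (range (fun p : 'cV[R]_n * {posnum R} =>
    (normc (F (gauss_at p.1 p.2)) * p.2%:num ^+ n *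
       ((1 + p.2%:num * l1dist w p.1) ^+ L)^-1)%:E)).

Lemma tangential_gt0 c w z : 0 < (1 + c%:num * l1dist w z) ^+ L.
Proof. by rewrite exprn_gt0// ltr_wpDr// mulr_ge0// l1dist_ge0. Qed.

Lemma gauss_maximal_ge0 w : (0 <= gauss_maximal w)%E.
Proof.
apply: le_trans (ereal_sup_ubound _); last by exists (0, 1%:pos).
by rewrite lee_fin !mulr_ge0 ?normc_ge0 ?exprn_ge0// invr_ge0 ltW ?tangential_gt0.
Qed.

Lemma gauss_at_le_gauss_maximal c z w :
  ((normc (F (gauss_at z c)))%:E <=
   (c%:num ^- n * (1 + c%:num * l1dist w z) ^+ L)%:E * gauss_maximal w)%E.
Proof.
have : ((normc (F (gauss_at z c)) * c%:num ^+ n *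
       ((1 + c%:num * l1dist w z) ^+ L)^-1)%:E <= gauss_maximal w)%E.
  by apply: ereal_sup_ubound; exists (z, c).
have t0 := tangential_gt0 c w z.
have q0 : 0 < c%:num ^- n * (1 + c%:num * l1dist w z) ^+ L.
  by rewrite mulr_gt0.
move=> H; rewrite [X in (X <= _)%E](_ : _ = (c%:num ^- n * (1 + c%:num * l1dist w z) ^+ L)%:E *
  (normc (F (gauss_at z c)) * c%:num ^+ n * ((1 + c%:num * l1dist w z) ^+ L)^-1)%:E)%E.
  by apply: lee_wpmul2l; rewrite ?lee_fin ?(ltW q0).
rewrite -EFinM; congr EFin.
have := gt_eqF t0; have : c%:num ^+ n == 0 = false by rewrite gt_eqF// exprn_gt0.
move: (normc _) (c%:num ^+ n) (_ ^+ L) => N A T A0 T0.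
by field; rewrite A0 T0.
Qed.

(** For one fixed Gaussian the quotient is continuous in [w], and a supremum of continuous functions
    is lower semicontinuous. *)
Lemma gauss_maximal_box_open (s : R) : box_open [set w | (s%:E < gauss_maximal w)%E].
Proof.
move=> w /= /ereal_sup_gt[_ [[z c] _ <-]]/=; rewrite lte_fin.
set N := normc _ * _ => sN.
have [s0|s0] := ltP s 0.
  exists 1 => // y _; apply: lt_le_trans (gauss_maximal_ge0 y).
  by rewrite lte_fin.
have t0 := tangential_gt0 c w z.
have {}sN : s * (1 + c%:num * l1dist w z) ^+ L < N by rewrite -ltr_pdivlMr.
pose d := l1dist w z; have d0 : 0 <= d by exact: l1dist_ge0.
pose q := 1 + c%:num * (d + n%:R).
have q1 : 1 <= q by rewrite lerDl mulr_ge0// addr_ge0.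
pose K := s * (L%:R * q ^+ L * (c%:num * n%:R)).
have K0 : 0 <= K by rewrite /K !mulr_ge0// exprn_ge0// (le_trans _ q1).
pose e := Num.min 1 ((N - s * (1 + c%:num * d) ^+ L) / (K + 1)).
have e0 : 0 < e by rewrite lt_min ltr01 divr_gt0 ?subr_gt0// ltr_wpDl.
have e1 : e <= 1 by rewrite ge_min lexx.
exists e => // y yw.
have yd : l1dist y z <= d + n%:R * e.
  rewrite /d /l1dist -[X in _ + X%:R * _]card_ord mulr_natl -sumr_const -big_split/=.
  apply: ler_sum => i _; have -> : y i ord0 - z i ord0 = (w i ord0 - z i ord0) + (y i ord0 - w i ord0) by ring.
  by apply: (le_trans (ler_normD _ _)); rewrite lerD2l ltW.
apply: (@lt_le_trans _ _ (N * ((1 + c%:num * l1dist y z) ^+ L)^-1)%:E); last first.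
  by apply: ereal_sup_ubound; exists (z, c).
rewrite lte_fin ltr_pdivlMr ?tangential_gt0//.
have h0 : 0 <= 1 + c%:num * (d + n%:R * e).
  by apply: addr_ge0 => //; apply: mulr_ge0 => //; apply: addr_ge0 => //; apply: mulr_ge0; rewrite ?(ltW e0).
apply: (@le_lt_trans _ _ (s * (1 + c%:num * (d + n%:R * e)) ^+ L)).
  rewrite ler_wpM2l// lerXn2r ?nnegrE ?h0 ?addr_ge0 ?mulr_ge0 ?l1dist_ge0//.
  by rewrite lerD2l ler_pM2l.
have h1 : 1 + c%:num * (d + n%:R * e) <= q.
  by rewrite /q lerD2l ler_pM2l// lerD2l ler_piMr.
have h3 : 1 + c%:num * d <= q by rewrite /q lerD2l ler_pM2l// lerDl.
have h4 : 0 <= 1 + c%:num * d by rewrite addr_ge0 ?mulr_ge0.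
have h : (1 + c%:num * (d + n%:R * e)) ^+ L - (1 + c%:num * d) ^+ L <=
    L%:R * q ^+ L * (c%:num * n%:R * e).
  apply: (le_trans (ler_norm _)); apply: (le_trans (@exprn_lip R q _ _ L q1 _ _)).
  - by rewrite ger0_norm.
  - by rewrite ger0_norm.
  rewrite (_ : _ - _ = c%:num * n%:R * e); last by ring.
  by rewrite ger0_norm// !mulr_ge0// ltW.
have h' : s * (1 + c%:num * (d + n%:R * e)) ^+ L <= s * (1 + c%:num * d) ^+ L + K * e.
  have := ler_wpM2l s0 h; rewrite /K mulrBr lerBlDl => /le_trans; apply.
  by rewrite lerD2l le_eqVlt; apply/orP; left; apply/eqP; ring.
have h'' : (K + 1) * e <= N - s * (1 + c%:num * d) ^+ L.
  by rewrite mulrC -ler_pdivlMr ?ltr_wpDl// ge_min lexx orbT.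
move: h' h'' e0 K0; rewrite mulrDl mul1r; move: (K * e) => u; lra.
Qed.

(** A cube about [z] of half side [1 / (n c)] has measure above [t], so it is not contained in a
    level set of measure at most [t]. It has a point [w] where the maximal function is at most [s],
    and there [c * l1dist w z <= 1] bounds the tangential factor by [2^L]. *)
Lemma gauss_at_le_rearrangement c z (t : R) : (0 < n)%N ->
  t < (2 / (n%:R * c%:num)) ^+ n ->
  ((normc (F (gauss_at z c)))%:E <=
   (c%:num ^- n * 2 ^+ L)%:E * rearrangement gauss_maximal t)%E.
Proof.
move=> n0 tc; have nR : 0 < n%:R :> R by rewrite ltr0n.
have q0 : 0 < c%:num ^- n * 2 ^+ L by rewrite mulr_gt0// exprn_gt0.
rewrite muleC -lee_pdivrMr//.
apply: le_ereal_inf_tmp => _ [s [s0 st] <-]; rewrite lee_pdivrMr//.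
pose r := (n%:R * c%:num)^-1.
have r0 : 0 < r by rewrite invr_gt0 mulr_gt0.
pose lo i := z i ord0 - r; pose hi i := z i ord0 + r.
have [w wB ws] : exists2 w, box lo hi w & (gauss_maximal w <= s%:E)%E.
  apply: contrapT => /forall2NP H.
  have : (lebesgue_rn n (box lo hi) <= t%:E)%E.
    apply: le_trans st; apply: le_lebesgue_rnW => w wB /=.
    by have [|/negP] := H w; [|rewrite -ltNge].
  apply/negP; rewrite -ltNge lebesgue_rn_box; last by move=> i; rewrite /lo /hi; lra.
  rewrite lte_fin (eq_bigr (fun=> 2 * r)); last by move=> i _; rewrite /lo /hi; ring.
  by rewrite prodr_const card_ord.
apply: (le_trans (gauss_at_le_gauss_maximal c z w)); rewrite muleC.
apply: (@le_trans _ _ (s%:E * (c%:num ^- n * (1 + c%:num * l1dist w z) ^+ L)%:E)%E).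
  by apply: lee_wpmul2r => //; rewrite lee_fin mulr_ge0// ltW ?tangential_gt0.
rewrite -!EFinM lee_fin ler_wpM2l// ler_wpM2l//.
rewrite lerXn2r ?nnegrE ?addr_ge0 ?mulr_ge0 ?l1dist_ge0//.
have : l1dist w z <= n%:R * r.
  rewrite /l1dist -[X in X%:R * _]card_ord mulr_natl -sumr_const; apply: ler_sum => i _.
  by have := wB i; rewrite /lo /hi ler_norml => /andP[h1 /ltW h2]; apply/andP; split; lra.
rewrite /r invfM mulrA mulfV ?gt_eqF// mul1r => h.
have : c%:num * l1dist w z <= c%:num * c%:num^-1 by rewrite ler_pM2l.
by rewrite mulfV ?gt_eqF//; lra.
Qed.

End gaussian_maximal_function.

(** The tangential weight cancels the loss incurred in the grand maximal bound, as the Euclidean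
    distance is at most [l1dist]. *)
Lemma gauss_maximal_le_grand_maximal {R : realType} n L : exists2 C : R, 0 < C &
  forall F : schwartz R n -> R[i], linear F -> forall w,
  (gauss_maximal L F w <= C%:E * grand_maximal L F w)%E.
Proof.
have [C C0 HC] := @gauss_at_le_grand_maximal R n L.
exists C => // F lF w; apply: ge_ereal_sup => _ [[z c] _ <-]/=.
have t0 := tangential_gt0 L c w z.
have cn0 : 0 < c%:num ^+ n by rewrite exprn_gt0.
(* The zero test function is admissible, so the supremum has a nonnegative competitor. *)
have M0 : (0 <= grand_maximal L F w)%E.
  have [r []] : exists r, [set (normc (convolution (dilation t phi) F w))%:E
    | t in [set: {posnum R}] & phi in unit_schwartz L] r /\ (0 <= r)%E.
    exists (normc (convolution (dilation 1%:pos 0) F w))%:E; split.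
      exists 1%:pos => //; exists 0 => //; rewrite /unit_schwartz/=.
      apply: (@le_trans _ _ 0%E) => //; rewrite /schwartz_norm big1// => b _.
      apply/eqP; rewrite eq_le; apply/andP; split.
        apply: ge_ereal_sup => _ [x _ <-]; rewrite lee_fin.
        by rewrite /multi_pderiv pderivs0 [normc _](_ : _ = 0) ?mulr0//; exact: normc0.
      apply: le_trans (ereal_sup_ubound _); last by exists 0.
      by rewrite lee_fin mulr_ge0 ?enormX_ge0 ?normc_ge0.
    by rewrite lee_fin normc_ge0.
  by move=> h r0; apply: (le_trans r0); exact: ereal_sup_ubound.
set T := (1 + _) ^+ L in t0 *; set N := normc _.
have k0 : 0 <= c%:num ^+ n * T^-1 by rewrite mulr_ge0 ?invr_ge0 ?(ltW t0)// ltW.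
apply: (@le_trans _ _ ((c%:num ^+ n * T^-1)%:E *
   ((C * c%:num ^- n * (1 + c%:num * enorm (w - z)) ^+ L)%:E * grand_maximal L F w))%E).
  rewrite [X in (X <= _)%E](_ : _ = (c%:num ^+ n * T^-1)%:E * N%:E)%E.
    by apply: lee_wpmul2l; rewrite ?lee_fin//; exact: HC.
  by rewrite -EFinM; congr EFin; ring.
rewrite muleA -EFinM; apply: lee_wpmul2r => //; rewrite lee_fin.
rewrite [leLHS](_ : _ = C * (c%:num ^+ n * c%:num ^- n) * ((1 + c%:num * enorm (w - z)) ^+ L * T^-1)); last by ring.
rewrite mulfV ?gt_eqF// mulr1 ler_piMr ?(ltW C0)// ler_pdivrMr// mul1r.
rewrite lerXn2r ?nnegrE ?addr_ge0 ?mulr_ge0 ?enorm_ge0 ?l1dist_ge0//.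
rewrite lerD2l ler_pM2l// (le_trans (le_enorm_sum _))//.
by apply: ler_sum => i _; rewrite !mxE.
Qed.

(** * Products of Gaussians *)

Section real_bounds.
Context {R : realType}.

Lemma exp_poly_le (j : nat) (t : R) : 0 <= t -> (1 + t) ^+ j * expR (- t) <= j`!%:R * expR 1.
Proof.
move=> t0; have h : (1 + t) ^+ j <= j`!%:R * expR (1 + t).
  case: j => [|j]; first by rewrite expr0 fact0 mul1r -expR0 ler_expR addr_ge0.
  have := @expR_ge1Dxn R (1 + t) j (addr_ge0 ler01 t0).
  have f0 : 0 < j.+1`!%:R :> R by rewrite ltr0n fact_gt0.
  by move=> h; rewrite mulrC -ler_pdivrMr//; apply: le_trans h; rewrite lerDr.
apply: (@le_trans _ _ (j`!%:R * expR (1 + t) * expR (- t))).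
  by rewrite ler_wpM2r ?expR_ge0.
by rewrite -mulrA -expRD addrK.
Qed.

(** With [v] the dispersion, half of the exponential pays for the tangential weight and the other
    half survives. *)
Lemma exp_sqrt_poly_le (K : R) L : 0 <= K -> exists2 C : R, 0 < C &
  forall v, 0 <= v -> (1 + K * Num.sqrt v) ^+ L * expR (- v) <= C * expR (- (v / 2)).
Proof.
move=> K0; exists ((1 + 2 * K) ^+ L * (L`!%:R * expR 1)).
  by rewrite !mulr_gt0 ?exprn_gt0 ?ltr_wpDr ?mulr_ge0 ?expR_gt0// ltr0n fact_gt0.
move=> v v0; have s0 := sqrtr_ge0 v; have sv := sqr_sqrtr v0.
have h : 1 + K * Num.sqrt v <= (1 + 2 * K) * (1 + v / 2).
  have : Num.sqrt v <= 1 + v by rewrite -[in leRHS]sv; move: (Num.sqrt v) s0 => u u0; nra.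
  by move: (Num.sqrt v) => u u1; nra.
have v20 : 0 <= v / 2 by rewrite divr_ge0.
apply: (@le_trans _ _ (((1 + 2 * K) * (1 + v / 2)) ^+ L * expR (- v))).
  rewrite ler_wpM2r ?expR_ge0// lerXn2r ?nnegrE//; first by rewrite addr_ge0// mulr_ge0.
  by rewrite mulr_ge0// addr_ge0// mulr_ge0.
have -> : - v = - (v / 2) + - (v / 2) by lra.
rewrite expRD exprMn mulrA ler_wpM2r ?expR_ge0// -mulrA.
rewrite ler_wpM2l ?exprn_ge0 ?addr_ge0 ?mulr_ge0//.
exact: exp_poly_le.
Qed.

Lemma exp_powR_le (kappa e : R) n : 0 < kappa -> e <= n%:R -> exists2 C : R, 1 <= C &
  forall v, 1 <= v -> expR (- (kappa * v)) <= C * v `^ (- e).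
Proof.
move=> k0 en; exists (1 + kappa ^- n * (n`!%:R * expR 1)).
  by rewrite lerDl !mulr_ge0 ?expR_ge0// invr_ge0 exprn_ge0// ltW.
move=> v v1; have v0 : 0 < v by exact: lt_le_trans v1.
rewrite powRN ler_pdivlMr ?powR_gt0//.
apply: (@le_trans _ _ (kappa ^- n * (n`!%:R * expR 1))); last by rewrite lerDr.
have kn : 0 < kappa ^+ n by rewrite exprn_gt0.
rewrite [leRHS]mulrC ler_pdivlMr// [leLHS](_ : _ = kappa ^+ n * v `^ e * expR (- (kappa * v))); last by ring.
have kv0 : 0 <= kappa * v by rewrite mulr_ge0 ?ltW.
apply: le_trans (exp_poly_le n kv0); rewrite ler_wpM2r ?expR_ge0//.
apply: (@le_trans _ _ (kappa ^+ n * v ^+ n)).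
  by rewrite ler_wpM2l ?(ltW kn)// -powR_mulrn ?(ltW v0)// ler_powR.
by rewrite -exprMn lerXn2r ?nnegrE ?addr_ge0// lerDr.
Qed.

Lemma powR_le_neg (x y e : R) : 0 <= e -> 0 < x -> x <= y -> y `^ (- e) <= x `^ (- e).
Proof.
move=> e0 x0 xy; have y0 : 0 < y by exact: lt_le_trans xy.
rewrite !powRN lef_pV2 ?posrE ?powR_gt0//.
by apply: ge0_ler_powR; rewrite ?nnegrE ?(ltW x0) ?(ltW y0).
Qed.

Lemma prod_powR (I : Type) (r : seq I) (P : pred I) (x : R) (f : I -> R) : 0 < x ->
  \prod_(i <- r | P i) x `^ (f i) = x `^ (\sum_(i <- r | P i) f i).
Proof.
move=> x0; elim/big_rec2 : _ => [|i y z _ ->]; first by rewrite powRr0.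
by rewrite powRD// (gt_eqF x0) implybT.
Qed.

End real_bounds.

Section sqnorm.
Context {R : realType}.

Definition sqnorm n (v : 'cV[R]_n) : R := \sum_i v i ord0 ^+ 2.

Lemma sqnorm_ge0 n (v : 'cV[R]_n) : 0 <= sqnorm v.
Proof. by apply: sumr_ge0 => i _; exact: sqr_ge0. Qed.

Lemma enormE n (v : 'cV[R]_n) : enorm v = Num.sqrt (sqnorm v). Proof. by []. Qed.

Lemma enorm_sqr n (v : 'cV[R]_n) : enorm v ^+ 2 = sqnorm v.
Proof. by rewrite enormE sqr_sqrtr ?sqnorm_ge0. Qed.

Lemma sqnormE n (v : 'cV[R]_n) : sqnorm v = (v^T *m v) ord0 ord0.
Proof. by rewrite mxE; apply: eq_bigr => i _; rewrite mxE expr2. Qed.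

Lemma sqnormN n (v : 'cV[R]_n) : sqnorm (- v) = sqnorm v.
Proof. by apply: eq_bigr => i _; rewrite mxE sqrrN. Qed.

Lemma sqnorm_orthogonal n (B : 'M[R]_n) (v : 'cV[R]_n) : B^T *m B = 1%:M ->
  sqnorm (B *m v) = sqnorm v.
Proof. by move=> BB; rewrite !sqnormE trmx_mul mulmxA -(mulmxA _ B^T) BB mulmx1. Qed.

Lemma sqnorm_mulmx_le n (B : 'M[R]_n) (v : 'cV[R]_n) :
  sqnorm (B *m v) <= (\sum_i (\sum_j `|B i j|) ^+ 2) * sqnorm v.
Proof.
rewrite mulr_suml; apply: ler_sum => i _.
have : `|(B *m v) i ord0| <= (\sum_j `|B i j|) * enorm v.
  rewrite mxE; apply: (le_trans (ler_norm_sum _ _ _)); rewrite mulr_suml.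
  by apply: ler_sum => j _; rewrite normrM ler_wpM2l// le_entry_enorm.
move=> h; rewrite -enorm_sqr -exprMn -[leLHS]real_normK ?num_real//.
by rewrite lerXn2r ?nnegrE// mulr_ge0 ?enorm_ge0// sumr_ge0.
Qed.

Lemma sqnorm_triangle n (u v z : 'cV[R]_n) :
  sqnorm (u - v) <= 2 * (sqnorm (z - u) + sqnorm (z - v)).
Proof.
rewrite /sqnorm -big_split mulr_sumr/=; apply: ler_sum => i _; rewrite !mxE.
move: (u _ _) (v _ _) (z _ _) => a b c.
rewrite -subr_ge0 [leRHS](_ : _ = (c - a + (c - b)) ^+ 2); first exact: sqr_ge0.
by ring.
Qed.

End sqnorm.

Section operator.
Context {R : realType} (n m : nat) (alpha : R).
Context (a : 'I_m -> R) (A : 'I_m -> 'M[R]_n).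
Implicit Types (x y z : 'cV[R]_n) (s : 'cV[R]_m).

Definition pole x (l : 'I_m) : 'cV[R]_n := (A l)^T *m x.

Definition total s : R := \sum_l s l ord0.

(** The inverse is written as a power, for which measurability is available. *)
Definition barycenter x s : 'cV[R]_n :=
  (total s `^ (-1)) *: \sum_l s l ord0 *: pole x l.

Definition dispersion x s : R := \sum_l s l ord0 * sqnorm (barycenter x s - pole x l).

(** The density of the Gamma integral, extended by 0 so that all integrals run over the whole
    line. *)
Definition gamma_weight (k t : R) : R := if 0 < t then t `^ (k - 1) else 0.

Definition weight s : R := \prod_l gamma_weight (a l / 2) (s l ord0).

Lemma gamma_weight_ge0 k t : 0 <= gamma_weight k t.
Proof. by rewrite /gamma_weight; case: ifP => // _; exact: powR_ge0. Qed.

Lemma weight_ge0 s : 0 <= weight s.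
Proof. by apply: prodr_ge0 => l _; exact: gamma_weight_ge0. Qed.

Lemma weight_eq0 s : ~ (forall l, 0 < s l ord0) -> weight s = 0.
Proof.
move=> /existsNP[l /negP sl]; rewrite /weight (bigD1 l)//= /gamma_weight.
by rewrite (negbTE sl) mul0r.
Qed.

Context (hA : forall l, A l *m (A l)^T = 1%:M).

Lemma sqnorm_pole x y l : sqnorm (x - A l *m y) = sqnorm (pole x l - y).
Proof.
rewrite -(@sqnorm_orthogonal _ _ (A l) (pole x l - y)); last exact: mulmx1C.
by rewrite mulmxBr mulmxA hA mul1mx.
Qed.

(* Leibniz' identity for the moment of inertia. *)
Lemma gaussian_product x y s : 0 < total s ->
  \sum_l s l ord0 * sqnorm (pole x l - y) =
  total s * sqnorm (barycenter x s - y) + dispersion x s.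
Proof.
move=> b0; rewrite /dispersion /sqnorm mulr_sumr.
under eq_bigr do rewrite mulr_sumr.
under [X in _ + X]eq_bigr do rewrite mulr_sumr.
rewrite exchange_big [X in _ + X]exchange_big -big_split/=; apply: eq_bigr => i _.
have subE (u v : 'cV[R]_n) : (u - v) i ord0 = u i ord0 - v i ord0 by rewrite !mxE.
have bz : total s * barycenter x s i ord0 = \sum_l s l ord0 * pole x l i ord0.
  rewrite mxE summxE powR_inv1 ?(ltW b0)// mulrA mulfV ?gt_eqF// mul1r.
  by apply: eq_bigr => l _; rewrite mxE.
under eq_bigr do rewrite subE.
under [X in _ + X]eq_bigr do rewrite subE.
rewrite subE; move: (y i ord0) (barycenter x s i ord0) bz => yi zi bz.
(* The cross terms sum to 0 by [bz], which characterizes the barycenter. *)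
transitivity (\sum_l (s l ord0 * (zi - yi) ^+ 2 +
   2 * (zi - yi) * (s l ord0 * pole x l i ord0 - s l ord0 * zi) +
   s l ord0 * (zi - pole x l i ord0) ^+ 2)).
  by apply: eq_bigr => l _; ring.
by rewrite !big_split/= -mulr_suml -mulr_sumr sumrB -mulr_suml -bz subrr mulr0 addr0.
Qed.

End operator.

(** * Pointwise bounds for the pairing with one Gaussian *)

Section operator_bound.
Context {R : realType} (n m : nat) (alpha : R).
Context (a : 'I_m -> R) (A : 'I_m -> 'M[R]_n).
Context (hn : (0 < n)%N) (halpha : 0 <= alpha < n%:R) (hm : 1 - alpha / n%:R < m%:R)
  (ha : forall i, 0 < a i) (hasum : \sum_i a i = n%:R - alpha)
  (hA : forall i, A i *m (A i)^T = 1%:M)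
  (hA0 : alpha = 0 -> forall i j, i != j -> A i - A j \in unitmx).
Implicit Types (x y z : 'cV[R]_n) (s : 'cV[R]_m).
Local Notation pole := (pole A).
Local Notation barycenter := (barycenter A).
Local Notation dispersion := (dispersion A).
Local Notation weight := (weight a).

(** The largest variable is comparable to [total s] up to the factor [m]; it serves as the parameter
    of the product Gaussian and selects the pole at which the maximal function is evaluated. *)
Definition max_at s i := (forall l, 0 < s l ord0) /\ forall l, s l ord0 <= s i ord0.

Lemma max_at_exists s : (0 < m)%N -> (forall l, 0 < s l ord0) -> exists i, max_at s i.
Proof.
move=> m0 s0; have [i _ imax] := @arg_maxP _ _ _ (Ordinal m0) xpredT (fun l => s l ord0) isT.
by exists i; split=> // l; exact: imax.
Qed.

Lemma total_ge s i : max_at s i -> s i ord0 <= total s.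
Proof.
move=> [s0 _]; rewrite /total (bigD1 i)//= lerDl; apply: sumr_ge0 => l _; exact: ltW.
Qed.

Lemma total_le s i : max_at s i -> total s <= m%:R * s i ord0.
Proof.
move=> [_ smax]; rewrite /total -[X in X%:R * _]card_ord mulr_natl -sumr_const.
by apply: ler_sum => l _; exact: smax.
Qed.

Lemma total_gt0 s i : max_at s i -> 0 < total s.
Proof. by move=> si; apply: lt_le_trans (total_ge si); exact: si.1. Qed.

Lemma dispersion_ge0 x s : (forall l, 0 < s l ord0) -> 0 <= dispersion x s.
Proof. by move=> s0; apply: sumr_ge0 => l _; rewrite mulr_ge0 ?sqnorm_ge0 ?ltW. Qed.

(** Only the terms [i] and [l] are kept; as [s l <= s i], both may be given the coefficient [s l],
    and the triangle inequality for squares passes from the barycenter to the two poles. *)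
Lemma dispersion_ge x s i l : max_at s i -> l != i ->
  s l ord0 * sqnorm (pole x i - pole x l) / 2 <= dispersion x s.
Proof.
move=> [s0 smax] li; rewrite /dispersion (bigD1 i)//= (bigD1 l)//=.
have rest : 0 <= \sum_(k < m | (k != i) && (k != l))
    s k ord0 * sqnorm (barycenter x s - pole x k).
  by apply: sumr_ge0 => k _; rewrite mulr_ge0 ?sqnorm_ge0 ?ltW.
have := sqnorm_triangle (pole x i) (pole x l) (barycenter x s).
have := sqnorm_ge0 (barycenter x s - pole x i).
have := sqnorm_ge0 (barycenter x s - pole x l).
have := s0 l; have := smax l.
move: (sqnorm (barycenter x s - pole x i)) (sqnorm (barycenter x s - pole x l))
  (sqnorm (pole x i - pole x l)) (s l ord0) (s i ord0) rest => p q r u v.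
move: (\sum_(_ < _ | _) _) => w w0 uv u0 q0 p0 rpq.
have : u * r <= u * (2 * (p + q)) by rewrite ler_pM2l.
have : u * p <= v * p by rewrite ler_wpM2r.
nra.
Qed.

(** The difference of two poles is an invertible matrix applied to [x], so [x] is controlled through
    the inverse matrix. *)
Lemma pole_separated i j : alpha = 0 -> i != j ->
  exists2 kappa : R, 0 < kappa & forall x, kappa * sqnorm x <= sqnorm (pole x i - pole x j).
Proof.
move=> a0 ij; pose B := (A i - A j)^T.
have uB : B \in unitmx by rewrite unitmx_tr; exact: hA0.
pose K := \sum_i (\sum_j `|invmx B i j|) ^+ 2.
have K0 : 0 <= K by apply: sumr_ge0 => k _; exact: sqr_ge0.
exists (K + 1)^-1; first by rewrite invr_gt0 ltr_wpDl.
move=> x; rewrite mulrC ler_pdivrMr ?ltr_wpDl//.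
have -> : pole x i - pole x j = B *m x by rewrite /pole /B linearB/= mulmxBl.
rewrite -[in leLHS](mulKmx uB x); apply: (le_trans (sqnorm_mulmx_le _ _)).
by rewrite mulrC ler_wpM2l ?sqnorm_ge0// lerDl.
Qed.

Lemma max_powR_ge s i (l : 'I_m) (S e : R) : 0 < S -> 0 <= e -> max_at s i -> S <= s i ord0 ->
  s i ord0 `^ (- e) <= Num.max (s l ord0) S `^ (- e).
Proof.
move=> S0 e0 [_ smax] Ss; apply: powR_le_neg => //; first by rewrite lt_max S0 orbT.
by rewrite ge_max smax.
Qed.

(* How the factor [b^(-n/2)] of a Gaussian is spread over the [m] variables.
   For [alpha = 0] there is no room, and the dispersion provides it. *)
Lemma distributed_decay i : exists mu : 'I_m -> R, exists E C : R,
  [/\ 0 < C, forall l, 0 < a l / 2 < mu l, \sum_l mu l = E + n%:R / 2 &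
   forall x (r : R) s, 0 < r -> (alpha = 0 -> r <= enorm x) -> max_at s i ->
    r `^ (- 2) < s i ord0 ->
    expR (- (dispersion x s / 2)) * s i ord0 `^ (- (n%:R / 2)) <=
    C * (r `^ (- 2)) `^ E * \prod_l Num.max (s l ord0) (r `^ (- 2)) `^ (- mu l)].
Proof.
have a20 l : 0 < a l / 2 by rewrite divr_gt0.
have nR : 0 < n%:R :> R by rewrite ltr0n.
have [a_gt0|a_le0] := ltP 0 alpha.
  have na : 0 < n%:R - alpha by move/andP: halpha => [_ ?]; rewrite subr_gt0.
  (* The exponents [a l / 2] are stretched proportionally so that their sum becomes [n / 2]; the
     ratio exceeds 1 because [alpha > 0]. *)
  exists (fun l => a l / 2 * (n%:R / (n%:R - alpha))), 0, 1; split=> //.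
  - move=> l; rewrite a20 ltr_pMr// ltr_pdivlMr// mul1r; lra.
  - rewrite -mulr_suml -mulr_suml hasum add0r mulrC mulrA divfK ?gt_eqF//.
  move=> x r s r0 _ si rs; rewrite powRr0 !mul1r.
  have S0 : 0 < r `^ (- 2) by rewrite powR_gt0.
  have si0 : 0 < s i ord0 by exact: si.1.
  apply: (@le_trans _ _ (s i ord0 `^ (- (n%:R / 2)))).
    rewrite ler_piMl ?powR_ge0// expR_le1 oppr_le0 divr_ge0 ?dispersion_ge0//.
    exact: si.1.
  have -> : - (n%:R / 2) = \sum_l - (a l / 2 * (n%:R / (n%:R - alpha))).
    rewrite sumrN -mulr_suml -mulr_suml hasum; congr -%R.
    by rewrite [RHS]mulrC mulrA divfK ?gt_eqF.
  rewrite -prod_powR//; apply: ler_prod => l _; rewrite powR_ge0/=.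
  apply: max_powR_ge => //; last exact: ltW.
  by rewrite mulr_ge0 ?(ltW (a20 l))// divr_ge0 ?ltW.
have a0 : alpha = 0 by apply/eqP; rewrite eq_le a_le0; move/andP: halpha => [].
have m1 : (1 < m)%N by move: hm; rewrite a0 mul0r subr0 (ltr_nat _ 1).
(* For [alpha = 0] the condition on [m] reads [1 < m], which provides a second pole. *)
have [l0 l0i] : exists l : 'I_m, l != i.
  have [i0|i0] := eqVneq i (Ordinal (ltnW m1)); last by exists (Ordinal (ltnW m1)); rewrite eq_sym.
  by exists (Ordinal m1); rewrite i0.
have [kappa k0 Hk] := pole_separated a0 l0i.
have k40 : 0 < kappa / 4 by rewrite divr_gt0.
have n2n : n%:R / 2 <= n%:R :> R by rewrite ler_pdivrMr// ler_peMr// ler1n.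
have [C C1 HC] := exp_powR_le k40 n2n.
have sum_l0 : \sum_(l | l != l0) a l = n%:R - a l0.
  by move: hasum; rewrite (bigD1 l0)//= a0 subr0 => <-; rewrite addrC addrK.
have na : 0 < n%:R - a l0.
  rewrite -sum_l0 (bigD1 i)//=; last by rewrite eq_sym.
  by rewrite ltr_wpDr// sumr_ge0// => l _; exact: ltW.
(* The variable [l0] receives its exponent [n / 2] from the dispersion. The other variables share
   the [n / 2] of the Gaussian in proportion to [a l], stretched by a ratio that exceeds 1 because
   [a l0 > 0]. *)
exists (fun l => if l == l0 then n%:R / 2 else a l / 2 * (n%:R / (n%:R - a l0))), (n%:R / 2), C.
have C0 : 0 < C by exact: lt_le_trans C1.
split=> //.
- move=> l; rewrite a20/=; case: eqP => [->|_]; first by rewrite ltr_pM2r// -subr_gt0.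
  by rewrite ltr_pMr// ltr_pdivlMr// mul1r ltrBlDr ltrDl.
- rewrite (bigD1 l0)//= eqxx; congr (_ + _).
  rewrite (eq_bigr (fun l => a l / 2 * (n%:R / (n%:R - a l0)))); last first.
    by move=> l /negbTE ->.
  by rewrite -mulr_suml -mulr_suml sum_l0 mulrC mulrA divfK ?gt_eqF.
move=> x r s r0 rx si rs; set S := r `^ (- 2) in rs *.
have S0 : 0 < S by rewrite powR_gt0.
have si0 : 0 < s i ord0 by exact: si.1.
have SE : S = (r ^+ 2)^-1 by rewrite /S powRN powR_mulrn ?ltW.
have xS : S^-1 <= sqnorm x.
  by rewrite SE invrK -enorm_sqr lerXn2r ?nnegrE ?enorm_ge0 ?(ltW r0)//; exact: rx.
pose M := Num.max (s l0 ord0) S.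
have M0 : 0 < M by rewrite lt_max S0 orbT.
(* Since [|x|^2 >= 1 / S], half the dispersion is at least [(kappa / 4) * s l0 / S]; one factor 2
   comes from the halving and one from [dispersion_ge]. *)
have eV : expR (- (dispersion x s / 2)) <= C * (M / S) `^ (- (n%:R / 2)).
  have [sS|Ss] := leP (s l0 ord0) S.
    rewrite /M (max_idPr sS) divff ?gt_eqF// powR1 mulr1; apply: le_trans C1.
    by rewrite expR_le1 oppr_le0 divr_ge0// dispersion_ge0//; exact: si.1.
  rewrite /M (max_idPl (ltW Ss)).
  have : 1 <= s l0 ord0 / S by rewrite ler_pdivlMr// mul1r ltW.
  move=> /HC; apply: le_trans; rewrite ler_expR lerN2.
  have := dispersion_ge x si l0i; have := Hk x.
  have -> : sqnorm (pole x l0 - pole x i) = sqnorm (pole x i - pole x l0).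
    by rewrite -sqnormN opprB.
  have s00 : 0 < s l0 ord0 by exact: si.1.
  have : s l0 ord0 * (kappa * S^-1) <= s l0 ord0 * (kappa * sqnorm x).
    by rewrite ler_pM2l// ler_pM2l.
  move=> h1 h2 h3.
  have : s l0 ord0 * (kappa * sqnorm x) <= s l0 ord0 * sqnorm (pole x i - pole x l0).
    by rewrite ler_pM2l.
  lra.
rewrite (bigD1 l0)//= eqxx -/M.
rewrite (eq_bigr (fun l => Num.max (s l ord0) S `^ (- (a l / 2 * (n%:R / (n%:R - a l0)))))); last first.
  by move=> l /negbTE ->.
rewrite mulrA; apply: ler_pM; rewrite ?expR_ge0 ?powR_ge0//.
  apply: (le_trans eV); rewrite -mulrA ler_pM2l//.
  rewrite powRM ?(ltW M0) ?invr_ge0 ?(ltW S0)// mulrC.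
  rewrite -(powR_inv1 (ltW S0)) -powRrM mulN1r opprK; exact: lexx.
have -> : - (n%:R / 2) = \sum_(l | l != l0) - (a l / 2 * (n%:R / (n%:R - a l0))).
  rewrite sumrN -mulr_suml -mulr_suml sum_l0; congr -%R.
  by rewrite [RHS]mulrC mulrA divfK ?gt_eqF.
rewrite -prod_powR//; apply: ler_prod => l _; rewrite powR_ge0/=.
apply: max_powR_ge => //; last exact: ltW.
by rewrite mulr_ge0 ?(ltW (a20 l))// divr_ge0 ?ltW.
Qed.

Lemma gauss_valE (F : schwartz R n -> R[i]) c z (c0 : 0 < c) :
  gauss_val F c z = F (gauss_at z (PosNum c0)).
Proof.
rewrite /gauss_val; case: pselect => // c0'; congr (F (gauss_at _ _)).
exact: val_inj.
Qed.

Lemma sqrt_powR (b : R) : 0 < b -> Num.sqrt b ^- n = b `^ (- (n%:R / 2)).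
Proof.
move=> b0; rewrite -powR12_sqrt ?(ltW b0)// -powR_mulrn ?powR_ge0// -powRrM powRN.
by rewrite mulrC.
Qed.

(** The maximal function is evaluated at the pole of the largest variable. Its distance to the
    barycenter, in units of the width of the Gaussian, is at most a constant times the square root
    of the dispersion, so half of [exp(-V)] absorbs the tangential weight. *)
Lemma gauss_val_le_pole L : exists2 C : R, 0 < C & forall F x s i, max_at s i ->
  ((expR (- dispersion x s) * normc (gauss_val F (Num.sqrt (total s)) (barycenter x s)))%:E <=
   (C * (expR (- (dispersion x s / 2)) * s i ord0 `^ (- (n%:R / 2))))%:E *
     gauss_maximal L F (pole x i))%E.
Proof.
pose K := n%:R * Num.sqrt m%:R : R.
have K0 : 0 <= K by rewrite mulr_ge0// sqrtr_ge0.
have [C C0 HC] := exp_sqrt_poly_le L K0.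
exists C => // F x s i si; have b0 := total_gt0 si.
have sb0 : 0 < Num.sqrt (total s) by rewrite sqrtr_gt0.
have si0 : 0 < s i ord0 by exact: si.1.
have V0 : 0 <= dispersion x s by apply: dispersion_ge0; exact: si.1.
rewrite (gauss_valE _ _ sb0).
have h := gauss_at_le_gauss_maximal L F (PosNum sb0) (barycenter x s) (pole x i).
rewrite EFinM.
apply: (@le_trans _ _ ((expR (- dispersion x s))%:E * ((Num.sqrt (total s) ^- n *
  (1 + Num.sqrt (total s) * l1dist (pole x i) (barycenter x s)) ^+ L)%:E *
  gauss_maximal L F (pole x i)))%E).
  by apply: lee_wpmul2l => //; rewrite lee_fin expR_ge0.
rewrite muleA -EFinM; apply: lee_wpmul2r; first exact: gauss_maximal_ge0.
rewrite lee_fin mulrCA mulrA [leRHS]mulrA; rewrite -[leLHS]mulrA [leRHS]mulrC.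
apply: ler_pM; rewrite ?invr_ge0 ?exprn_ge0 ?sqrtr_ge0 ?mulr_ge0 ?expR_ge0//.
- by rewrite exprn_ge0// addr_ge0// mulr_ge0 ?l1dist_ge0 ?sqrtr_ge0.
- rewrite sqrt_powR//; apply: powR_le_neg => //; last exact: total_ge.
rewrite mulrC; apply: le_trans (HC _ V0); rewrite ler_wpM2r ?expR_ge0//.
rewrite lerXn2r ?nnegrE ?addr_ge0 ?mulr_ge0 ?l1dist_ge0 ?sqrtr_ge0//.
rewrite lerD2l /K.
have h1 : l1dist (pole x i) (barycenter x s) <= n%:R * enorm (barycenter x s - pole x i).
  rewrite /l1dist -[X in X%:R * _]card_ord mulr_natl -sumr_const.
  apply: ler_sum => k _; rewrite distrC.
  by apply: le_trans (le_entry_enorm _ k); rewrite !mxE.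
apply: (@le_trans _ _ (Num.sqrt (total s) * (n%:R * enorm (barycenter x s - pole x i)))).
  by rewrite ler_pM2l.
rewrite mulrCA -mulrA ler_wpM2l// enormE -!sqrtrM ?ler0n ?(ltW b0)// ler_wsqrtr//.
apply: (@le_trans _ _ (m%:R * s i ord0 * sqnorm (barycenter x s - pole x i))).
  by rewrite ler_wpM2r ?sqnorm_ge0// total_le.
rewrite -mulrA ler_wpM2l// /dispersion (bigD1 i)//= lerDl.
by apply: sumr_ge0 => l _; rewrite mulr_ge0 ?sqnorm_ge0// ltW//; exact: si.1.
Qed.

(** As [total s] lies between [s i] and [m * s i], the Gaussian has a width comparable to [r],
    wherever its centre is. The factor 4 in the hypothesis produces [2 * r], and the bound by
    [m * s i] produces the denominator [n m]. *)
Lemma gauss_val_le_rearrangement L F x s i (r : R) : max_at s i -> 0 < r ->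
  r `^ (- 2) / 4 < s i ord0 <= r `^ (- 2) ->
  ((normc (gauss_val F (Num.sqrt (total s)) (barycenter x s)))%:E <=
   ((2 * r) ^+ n * 2 ^+ L)%:E *
   rearrangement (gauss_maximal L F) ((r / (n%:R * m%:R)) ^+ n))%E.
Proof.
move=> si r0 /andP[]; rewrite powRN powR_mulrn ?(ltW r0)// => rs sr.
have b0 := total_gt0 si.
have sb0 : 0 < Num.sqrt (total s) by rewrite sqrtr_gt0.
have si0 : 0 < s i ord0 by exact: si.1.
have m0 : (0 < m)%N by apply: leq_ltn_trans (ltn_ord i).
have nR : 0 < n%:R :> R by rewrite ltr0n.
have mR : 1 <= m%:R :> R by rewrite ler1n.
rewrite (gauss_valE _ _ sb0).
apply: (le_trans (gauss_at_le_rearrangement (t := (r / (n%:R * m%:R)) ^+ n) L F (barycenter x s) hn _)).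
  rewrite ltrXn2r ?nnegrE ?divr_ge0 ?mulr_ge0 ?sqrtr_ge0 ?(ltW r0)//; first by rewrite -lt0n.
  rewrite /= ltr_pdivrMr ?mulr_gt0 ?ltr0n//.
  rewrite [ltRHS](_ : _ = 2 * m%:R / Num.sqrt (total s)); last first.
    by field; rewrite (gt_eqF nR) (gt_eqF sb0).
  rewrite ltr_pdivlMr// mulrC.
  apply: (@le_lt_trans _ _ m%:R); last by rewrite ltr_pMl ?ltr1n ?ltr0n.
  have : Num.sqrt (total s) * r <= Num.sqrt m%:R.
    rewrite -[X in _ * X](@ger0_norm _ r) ?(ltW r0)// -sqrtr_sqr -sqrtrM ?(ltW b0)//.
    rewrite ler_wsqrtr//; apply: (@le_trans _ _ (m%:R * s i ord0 * r ^+ 2)).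
      by rewrite ler_wpM2r ?sqr_ge0// total_le.
    rewrite -mulrA ler_piMr// -ler_pdivlMr ?exprn_gt0// div1r//.
  move=> /le_trans; apply.
  rewrite -[leRHS]ger0_norm// -sqrtr_sqr ler_wsqrtr// expr2 ler_peMr//.
apply: lee_wpmul2r; first exact: rearrangement_ge0.
rewrite lee_fin ler_wpM2r ?exprn_ge0//= -exprVn lerXn2r ?nnegrE ?invr_ge0 ?mulr_ge0 ?sqrtr_ge0 ?(ltW r0)//.
rewrite -[leRHS]invrK lef_pV2 ?posrE ?invr_gt0 ?mulr_gt0//.
have ri : 0 <= (2 * r)^-1 by rewrite invr_ge0 mulr_ge0// ltW.
rewrite -(ger0_norm ri) -sqrtr_sqr ler_wsqrtr//.
apply: (le_trans _ (total_ge si)); apply: ltW; apply: le_lt_trans rs.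
by rewrite exprVn exprMn invfM mulrC -natrX.
Qed.

End operator_bound.

(** * The extended operator *)

Section complex_integrals.
Context {R : realType} (n : nat).
Local Notation mu := (lebesgue_rn n : {measure set 'cV[R]_n -> \bar R}).
Implicit Types (f g : 'cV[R]_n -> R[i]).
Local Notation Re := (@complex.Re R).
Local Notation Im := (@complex.Im R).

Lemma norm_Re_le (z : R[i]) : `|Re z| <= normc z.
Proof. by case: z => u v /=; rewrite -sqrtr_sqr ler_wsqrtr// lerDl sqr_ge0. Qed.

Lemma norm_Im_le (z : R[i]) : `|Im z| <= normc z.
Proof. by case: z => u v /=; rewrite -sqrtr_sqr ler_wsqrtr// lerDr sqr_ge0. Qed.

Lemma normc_le_ReIm (z : R[i]) : normc z <= `|Re z| + `|Im z|.
Proof.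
case: z => u v /=; rewrite -[leRHS]ger0_norm ?addr_ge0// -sqrtr_sqr ler_wsqrtr//.
rewrite -(real_normK (num_real u)) -(real_normK (num_real v)).
by have := normr_ge0 u; have := normr_ge0 v; move: `|u| `|v| => a b *; nra.
Qed.

Definition complex_measurable f :=
  measurable_fun setT (Re \o f) /\ measurable_fun setT (Im \o f).

Lemma complex_measurable_norm f : complex_measurable f ->
  measurable_fun setT (fun x => normc (f x)).
Proof.
move=> [mr mi]; rewrite (_ : (fun x => _) =
    fun x => ((Re \o f) x ^+ 2 + (Im \o f) x ^+ 2) `^ 2^-1); last first.
  apply/funext => x; rewrite powR12_sqrt ?addr_ge0 ?sqr_ge0//=.
  by case: (f x).
apply: (@measurableT_comp _ _ _ _ _ _ (@powR R ^~ 2^-1)) => //.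
by apply: measurable_funD; exact: measurable_funX.
Qed.

Definition complex_integrable f := complex_measurable f /\
  (\int[mu]_x (normc (f x))%:E < +oo)%E.

Lemma complex_integrable_Re f : complex_integrable f ->
  mu.-integrable setT (EFin \o (Re \o f)).
Proof.
move=> [[mr mi] foo]; apply/integrableP; split; first exact/measurable_EFinP.
apply: le_lt_trans foo; apply: ge0_le_integralW => x _ //=.
by rewrite lee_fin norm_Re_le.
Qed.

Lemma complex_integrable_Im f : complex_integrable f ->
  mu.-integrable setT (EFin \o (Im \o f)).
Proof.
move=> [[mr mi] foo]; apply/integrableP; split; first exact/measurable_EFinP.
apply: le_lt_trans foo; apply: ge0_le_integralW => x _ //=.
by rewrite lee_fin norm_Im_le.
Qed.

Lemma complex_integral_linear (c : R[i]) f g : complex_integrable f -> complex_integrable g ->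
  complex_integral (fun x => c * f x + g x) = c * complex_integral f + complex_integral g.
Proof.
move=> fi gi; have fr := complex_integrable_Re fi; have fm := complex_integrable_Im fi.
have gr := complex_integrable_Re gi; have gm := complex_integrable_Im gi.
have Z (k : R) h : mu.-integrable setT (EFin \o h) ->
    mu.-integrable setT (EFin \o (fun x => k * h x)).
  by move=> hi; have := integrableZl measurableT k hi.
have D (h1 h2 : 'cV[R]_n -> R) : mu.-integrable setT (EFin \o h1) ->
    mu.-integrable setT (EFin \o h2) -> mu.-integrable setT (EFin \o (fun x => h1 x + h2 x)).
  by move=> h1i h2i; have := integrableD measurableT h1i h2i.
have eRe : (\int[mu]_x Re (c * f x + g x) =
    Re c * (\int[mu]_x Re (f x)) - Im c * (\int[mu]_x Im (f x)) + \int[mu]_x Re (g x))%R.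
  rewrite -(RintegralZl (Re c) measurableT fr) -mulNr -(RintegralZl (- Im c) measurableT fm).
  rewrite -(RintegralD measurableT (Z _ _ fr) (Z _ _ fm)).
  rewrite -(RintegralD measurableT (D _ _ (Z _ _ fr) (Z _ _ fm)) gr).
  apply: eq_Rintegral => x _ /=.
  by case: (c) (f x) (g x) => [c1 c2] [f1 f2] [g1 g2] /=; ring.
have eIm : (\int[mu]_x Im (c * f x + g x) =
    Re c * (\int[mu]_x Im (f x)) + Im c * (\int[mu]_x Re (f x)) + \int[mu]_x Im (g x))%R.
  rewrite -(RintegralZl (Re c) measurableT fm) -(RintegralZl (Im c) measurableT fr).
  rewrite -(RintegralD measurableT (Z _ _ fm) (Z _ _ fr)).
  rewrite -(RintegralD measurableT (D _ _ (Z _ _ fm) (Z _ _ fr)) gm).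
  apply: eq_Rintegral => x _ /=.
  by case: (c) (f x) (g x) => [c1 c2] [f1 f2] [g1 g2] /=; ring.
by rewrite /complex_integral eRe eIm; case: (c).
Qed.

(** The factor 2 comes from treating real and imaginary parts separately. *)
Lemma normc_complex_integral_le f : complex_measurable f ->
  ((normc (complex_integral f))%:E <= 2%:E * \int[mu]_x (normc (f x))%:E)%E.
Proof.
move=> [mr mi].
have H (h : 'cV[R]_n -> R) : measurable_fun setT h -> (forall x, `|h x| <= normc (f x)) ->
    ((`|\int[mu]_x h x|)%:E <= \int[mu]_x (normc (f x))%:E)%E.
  move=> mh hf; apply: (@le_trans _ _ (`| \int[mu]_x (h x)%:E |)%E).
    by rewrite /Rintegral; case: (\int[mu]_x _)%E => //=; rewrite normr0 ?leey.
  apply: (le_trans (le_abse_integral _ _ _)) => //; first exact/measurable_EFinP.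
  by apply: ge0_le_integralW => x _ //=; rewrite lee_fin.
apply: (@le_trans _ _ ((`|\int[mu]_x Re (f x)| + `|\int[mu]_x Im (f x)|)%R)%:E).
  by rewrite lee_fin; exact: (normc_le_ReIm (complex_integral f)).
rewrite EFinD [X in (_ <= X * _)%E](_ : _ = 1%:E + 1%:E)%E; last by rewrite -EFinD; congr EFin; lra.
rewrite ge0_muleDl//= ?mul1e; apply: leeD; apply: H => // x; [exact: norm_Re_le|exact: norm_Im_le].
Qed.

End complex_integrals.

(** Positive and negative parts depend measurably on the parameter by Tonelli, and [fine] sends
    infinite values to 0 measurably. *)
Lemma measurable_Rintegral_param d1 d2 (T1 : measurableType d1) (T2 : measurableType d2)
  (R : realType) (mu : {sigma_finite_measure set T2 -> \bar R}) (f : T1 * T2 -> R) :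
  measurable_fun setT f -> measurable_fun setT (fun x => \int[mu]_y f (x, y))%R.
Proof.
move=> mf; have mfe : measurable_fun setT (EFin \o f) by exact/measurable_EFinP.
rewrite /Rintegral; apply: (@measurableT_comp _ _ _ _ _ _ (@fine R)).
  exact: fine_measurable.
rewrite (_ : (fun x => _) = fun x => (\int[mu]_y ((EFin \o f)^\+ (x, y)) -
    \int[mu]_y ((EFin \o f)^\- (x, y)))%E); last first.
  apply/funext => x; rewrite integralE; congr (_ - _)%E; apply: eq_integral => y _.
    by rewrite !funeposE.
  by rewrite !funenegE.
have H (h : T1 * T2 -> \bar R) : measurable_fun setT h -> (forall z, 0 <= h z)%E ->
    measurable_fun setT (fun x => \int[mu]_y h (x, y))%E.
  by move=> mh h0; exact: (measurable_fun_fubini_tonelli_F h mh h0).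
by apply: emeasurable_funB; apply: H => //; [exact: measurable_funepos|exact: measurable_funeneg].
Qed.

Section operator_integral.
Context {R : realType} (n m : nat) (alpha : R).
Context (a : 'I_m -> R) (A : 'I_m -> 'M[R]_n).
Implicit Types (F G : schwartz R n -> R[i]) (x : 'cV[R]_n) (s : 'cV[R]_m).
Local Notation pole := (pole A).
Local Notation barycenter := (barycenter A).
Local Notation dispersion := (dispersion A).
Local Notation weight := (weight a).
Local Notation Re := (@complex.Re R).
Local Notation Im := (@complex.Im R).

(** What is left of the density of the kernel in [s] once its Gaussian in [y] has been paired with
    [F]. The parameter of that Gaussian is [total s], hence the inverse width is its square root. *)
Definition op_integrand F x s : R[i] := (weight s * expR (- dispersion x s))%:C%C *
  gauss_val F (Num.sqrt (total s)) (barycenter x s).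

Lemma op_integrand_linear (c : R[i]) F G x s :
  op_integrand (c *: F + G) x s = c * op_integrand F x s + op_integrand G x s.
Proof.
rewrite /op_integrand mulrCA -mulrDr; congr (_ * _); rewrite /gauss_val.
by case: pselect => // _; rewrite mulr0 addr0.
Qed.

Lemma normc_op_integrand F x s : normc (op_integrand F x s) =
  weight s * (expR (- dispersion x s) *
    normc (gauss_val F (Num.sqrt (total s)) (barycenter x s))).
Proof.
by rewrite /op_integrand normcM normc_real ger0_norm ?mulrA// mulr_ge0 ?weight_ge0 ?expR_ge0.
Qed.

Lemma measurable_total : measurable_fun setT (fun p : 'cV[R]_n * 'cV[R]_m => total p.2).
Proof.
apply: measurable_sum => l.
by apply: (measurableT_comp (measurable_coord l)); exact: measurable_snd.
Qed.

Lemma measurable_pole l i :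
  measurable_fun setT (fun p : 'cV[R]_n * 'cV[R]_m => pole p.1 l i ord0).
Proof.
under eq_fun do rewrite mxE; apply: measurable_sum => k; apply: measurable_funM => //.
by apply: (measurableT_comp (measurable_coord k)); exact: measurable_fst.
Qed.

Lemma measurable_var l : measurable_fun setT (fun p : 'cV[R]_n * 'cV[R]_m => p.2 l ord0).
Proof. by apply: (measurableT_comp (measurable_coord l)); exact: measurable_snd. Qed.

Lemma measurable_barycenter_entry i :
  measurable_fun setT (fun p : 'cV[R]_n * 'cV[R]_m => barycenter p.1 p.2 i ord0).
Proof.
under eq_fun do rewrite mxE summxE; apply: measurable_funM.
  apply: (@measurableT_comp _ _ _ _ _ _ (@powR R ^~ (-1))) => //.
  exact: measurable_total.
apply: measurable_sum => l; under eq_fun do rewrite mxE.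
by apply: measurable_funM; [exact: measurable_var|exact: measurable_pole].
Qed.

Lemma measurable_dispersion :
  measurable_fun setT (fun p : 'cV[R]_n * 'cV[R]_m => dispersion p.1 p.2).
Proof.
apply: measurable_sum => l; apply: measurable_funM; first exact: measurable_var.
apply: measurable_sum => i; apply: measurable_funX.
rewrite (_ : (fun p : 'cV[R]_n * 'cV[R]_m => _) = fun p : 'cV[R]_n * 'cV[R]_m =>
    barycenter p.1 p.2 i ord0 - pole p.1 l i ord0); last first.
  by apply/funext => p; rewrite mxE; congr (_ + _); rewrite mxE.
by apply: measurable_funB; [exact: measurable_barycenter_entry|exact: measurable_pole].
Qed.

Lemma measurable_gamma_weight (k : R) : measurable_fun setT (gamma_weight k).
Proof. by apply: measurable_fun_ifT => //; exact: measurable_fun_ltr. Qed.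

Lemma measurable_op_integrand F (g : R[i] -> R) : tempered_distribution F ->
  (forall u v, `|g u - g v| <= normc (u - v)) ->
  (forall (k : R) u, g (k%:C%C * u) = k * g u) ->
  measurable_fun setT (fun p : 'cV[R]_n * 'cV[R]_m => g (op_integrand F p.1 p.2)).
Proof.
move=> tF glip gZ; under eq_fun do rewrite gZ.
apply: measurable_funM.
  apply: measurable_funM.
    apply: measurable_prod => l _.
    apply: (measurableT_comp (measurable_gamma_weight (a l / 2))); exact: measurable_var.
  apply: (measurableT_comp (@measurable_expR R)); apply: measurable_funN.
  exact: measurable_dispersion.
apply: (@measurableT_comp _ _ _ _ _ _ (fun p : R * 'cV[R]_n => g (gauss_val F p.1 p.2)) setT
  (fun p : 'cV[R]_n * 'cV[R]_m => (Num.sqrt (total p.2), barycenter p.1 p.2))).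
  exact: measurable_gauss_val_comp.
apply: measurable_fun_pair.
  rewrite (_ : (fun p : 'cV[R]_n * 'cV[R]_m => _) = fun p : 'cV[R]_n * 'cV[R]_m => Num.sqrt (Num.max (total p.2) 0)); last first.
    apply/funext => p; have [//|h] := leP 0 (total p.2).
    by rewrite sqrtr0 ler0_sqrtr// ltW.
  under eq_fun do rewrite -powR12_sqrt ?le_max ?lexx ?orbT//.
  apply: (@measurableT_comp _ _ _ _ _ _ (@powR R ^~ 2^-1)) => //.
  by apply: measurable_maxr => //; exact: measurable_total.
apply: measurable_fun_matrix => i j; rewrite (ord1 j).
exact: measurable_barycenter_entry.
Qed.

Lemma Re_lip (u v : R[i]) : `|Re u - Re v| <= normc (u - v).
Proof. by case: u v => [u1 u2] [v1 v2]; exact: (norm_Re_le (Complex (u1 - v1) (u2 - v2))). Qed.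

Lemma Im_lip (u v : R[i]) : `|Im u - Im v| <= normc (u - v).
Proof. by case: u v => [u1 u2] [v1 v2]; exact: (norm_Im_le (Complex (u1 - v1) (u2 - v2))). Qed.

Lemma ReZ (k : R) (u : R[i]) : Re (k%:C%C * u) = k * Re u.
Proof. by case: u => u1 u2 /=; rewrite mul0r subr0. Qed.

Lemma ImZ (k : R) (u : R[i]) : Im (k%:C%C * u) = k * Im u.
Proof. by case: u => u1 u2 /=; rewrite mul0r addr0. Qed.

Lemma op_integrand_measurable F x : tempered_distribution F ->
  complex_measurable (op_integrand F x).
Proof.
move=> tF; split.
  have := measurable_op_integrand tF Re_lip ReZ.
  by move=> /(measurableT_comp)/(_ (measurable_pair1 x)).
have := measurable_op_integrand tF Im_lip ImZ.
by move=> /(measurableT_comp)/(_ (measurable_pair1 x)).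
Qed.

(** The product of the values of the Gamma function at [a l / 2]. *)
Definition op_normalization : R := \prod_l
  fine (\int[@lebesgue_measure R]_t (gamma_weight (a l / 2) t * expR (- t))%:E).

(* [K(x,y)] is a superposition of Gaussians centered at the barycenters of the
   poles, which may be paired with any tempered distribution. *)
Definition rough_extension F x : R[i] :=
  (op_normalization^-1)%:C%C * complex_integral (op_integrand F x).

Lemma rough_extension_measurable F : tempered_distribution F ->
  complex_measurable (rough_extension F).
Proof.
move=> tF; split.
  rewrite (_ : _ \o _ = fun x => op_normalization^-1 *
     \int[lebesgue_rn m]_s Re (op_integrand F x s)); last first.
    by apply/funext => x; rewrite /= mul0r subr0.
  apply: measurable_funM => //.
  exact: (@measurable_Rintegral_param _ _ _ _ R (lebesgue_rn m) _ (measurable_op_integrand tF Re_lip ReZ)).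
rewrite (_ : _ \o _ = fun x => op_normalization^-1 *
   \int[lebesgue_rn m]_s Im (op_integrand F x s)); last first.
  by apply/funext => x; rewrite /= mul0r addr0.
apply: measurable_funM => //.
exact: (@measurable_Rintegral_param _ _ _ _ R (lebesgue_rn m) _ (measurable_op_integrand tF Im_lip ImZ)).
Qed.

End operator_integral.

(** * Integration over the parameters of the Gaussians *)

Section operator_estimate.
Context {R : realType} (n m : nat) (alpha : R).
Context (a : 'I_m -> R) (A : 'I_m -> 'M[R]_n).
Context (hn : (0 < n)%N) (halpha : 0 <= alpha < n%:R) (hm : 1 - alpha / n%:R < m%:R)
  (ha : forall i, 0 < a i) (hasum : \sum_i a i = n%:R - alpha)
  (hA : forall i, A i *m (A i)^T = 1%:M)
  (hA0 : alpha = 0 -> forall i j, i != j -> A i - A j \in unitmx).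
Implicit Types (x y z : 'cV[R]_n) (s : 'cV[R]_m).
Local Notation pole := (pole A).
Local Notation dispersion := (dispersion A).
Local Notation weight := (weight a).

(** Each factor depends on one variable only, so the integral over [s] is a product of
    one-dimensional integrals. *)
Definition weight_product (e : 'I_m -> R) (r : R) s : R :=
  \prod_l power_weight (a l / 2) (r `^ (- 2)) (e l) (s l ord0).

Definition weight_mass (e : 'I_m -> R) : R := \prod_l power_weight_mass (a l / 2) (e l).

Lemma weight_product_ge0 e r s : 0 <= weight_product e r s.
Proof. by apply: prodr_ge0 => l _; exact: power_weight_ge0. Qed.

Lemma weight_mass_ge0 e : 0 <= weight_mass e.
Proof. by apply: prodr_ge0 => l _; exact: power_weight_mass_ge0. Qed.

Lemma measurable_weight_product e r :
  measurable_fun setT (fun s => (weight_product e r s)%:E).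
Proof.
apply/measurable_EFinP.
apply: (measurable_rn_prod (f := fun l => power_weight (a l / 2) (r `^ (- 2)) (e l))) => l.
exact: measurable_power_weight.
Qed.

Lemma integral_weight_product (e : 'I_m -> R) (r : R) : 0 < r ->
  (forall l, 0 < a l / 2 < e l) ->
  (\int[lebesgue_rn m]_s (weight_product e r s)%:E =
   (r `^ (2 * \sum_l e l - (n%:R - alpha)) * weight_mass e)%:E)%E.
Proof.
move=> r0 ae.
rewrite (integral_rn_prod (f := fun l => power_weight (a l / 2) (r `^ (- 2)) (e l))
  (c := fun l => (r `^ (- 2)) `^ (a l / 2 - e l) * power_weight_mass (a l / 2) (e l))).
- rewrite big_split/=; congr (_ * _)%:E.
  under eq_bigr do rewrite -powRrM.
  rewrite prod_powR//; congr (_ `^ _).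
  by rewrite -mulr_sumr sumrB -mulr_suml hasum; lra.
- by move=> l; exact: measurable_power_weight.
- by move=> l t; exact: power_weight_ge0.
- by move=> l; apply: integral_power_weight => //; rewrite powR_gt0.
Qed.

Lemma weight_max_product (e : 'I_m -> R) (r : R) s : (forall l, 0 < s l ord0) ->
  weight s * \prod_l Num.max (s l ord0) (r `^ (- 2)) `^ (- e l) = weight_product e r s.
Proof.
move=> s0; rewrite -big_split; apply: eq_bigr => l _.
by rewrite /gamma_weight /power_weight s0.
Qed.

(** On the box every maximum equals the cutoff, so the cut-off weight is a constant multiple of
    [weight]. The exponents [a l] are chosen above [a l / 2] to make it integrable outside the box
    as well. *)
Lemma weight_box_product (r : R) s : 0 < r ->
  (forall l, 0 < s l ord0 <= r `^ (- 2)) ->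
  weight s = r `^ (- 2 * (n%:R - alpha)) * weight_product a r s.
Proof.
move=> r0 sr; rewrite -hasum mulr_sumr -prod_powR// -big_split; apply: eq_bigr => l _ /=.
have /andP[s0 s1] := sr l; rewrite /gamma_weight /power_weight s0 (max_idPr s1).
have S0 : 0 < r `^ (- 2) by rewrite powR_gt0.
by rewrite mulrCA powRrM -powRD ?(gt_eqF S0) ?implybT// subrr powRr0 mulr1.
Qed.

Definition scale_ratio : R := (n%:R * m%:R)^-1.

(** If the largest variable exceeds [r^-2], its pole supplies a term of the first sum. Otherwise it
    lies in a shell between [(2^k r)^-2 / 4] and [(2^k r)^-2], which supplies a term of the series.
    Adding all terms gives a measurable majorant whose integral splits. *)
Lemma op_integrand_pointwise L : exists mu : 'I_m -> 'I_m -> R, exists E C : 'I_m -> R,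
  [/\ forall i, 0 < C i, forall i l, 0 < a l / 2 < mu i l,
   forall i, \sum_l mu i l = E i + n%:R / 2 &
   forall F x (r : R) s, 0 < r -> (alpha = 0 -> r <= enorm x) ->
   ((normc (op_integrand a A F x s))%:E <=
    \sum_i ((C i * (r `^ (- 2)) `^ E i)%:E * gauss_maximal L F (pole x i)) * (weight_product (mu i) r s)%:E +
    \sum_(k <oo) (((2 * (2 ^+ k * r)) ^+ n * 2 ^+ L * (2 ^+ k * r) `^ (- 2 * (n%:R - alpha)))%:E *
      rearrangement (gauss_maximal L F) ((2 ^+ k * r * scale_ratio) ^+ n)) *
      (weight_product a (2 ^+ k * r) s)%:E)%E].
Proof.
have m0 : (0 < m)%N.
  rewrite lt0n; apply/eqP => m0; move: hm; rewrite m0 subr_lt0 ltNge => /negP; apply.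
  by rewrite ler_pdivrMr ?ltr0n// mul1r; move/andP: halpha => [_ /ltW].
have H i : exists t : ('I_m -> R) * R * R,
  [/\ 0 < t.2, forall l, 0 < a l / 2 < t.1.1 l, \sum_l t.1.1 l = t.1.2 + n%:R / 2 &
   forall x (r : R) s, 0 < r -> (alpha = 0 -> r <= enorm x) -> max_at s i ->
    r `^ (- 2) < s i ord0 ->
    expR (- (dispersion x s / 2)) * s i ord0 `^ (- (n%:R / 2)) <=
    t.2 * (r `^ (- 2)) `^ t.1.2 * \prod_l Num.max (s l ord0) (r `^ (- 2)) `^ (- t.1.1 l)].
  have [mu [E [C ?]]] := distributed_decay hn halpha hm ha hasum hA0 i.
  by exists (mu, E, C).
have [t Ht] := choice H.
have [C0 C00 HC] := gauss_val_le_pole A L.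
exists (fun i => (t i).1.1), (fun i => (t i).1.2), (fun i => C0 * (t i).2).
split.
- by move=> i; rewrite mulr_gt0//; have [] := Ht i.
- by move=> i; have [] := Ht i.
- by move=> i; have [] := Ht i.
move=> F x r s r0 rx; set S1 := (\sum_i _)%E; set S2 := (\sum_(k <oo) _)%E.
have G0 i : (0 <= (C0 * (t i).2 * (r `^ (- 2)) `^ (t i).1.2)%:E * gauss_maximal L F (pole x i) *
    (weight_product (t i).1.1 r s)%:E)%E.
  rewrite mule_ge0 ?lee_fin ?weight_product_ge0// mule_ge0 ?gauss_maximal_ge0//.
  by rewrite lee_fin !mulr_ge0 ?powR_ge0 ?(ltW C00)//; have [/ltW] := Ht i.
have H0 k : (0 <= ((2 * (2 ^+ k * r)) ^+ n * 2 ^+ L * (2 ^+ k * r) `^ (- 2 * (n%:R - alpha)))%:E *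
      rearrangement (gauss_maximal L F) ((2 ^+ k * r * scale_ratio) ^+ n) *
      (weight_product a (2 ^+ k * r) s)%:E)%E.
  rewrite mule_ge0 ?lee_fin ?weight_product_ge0// mule_ge0 ?rearrangement_ge0//.
  by rewrite lee_fin !mulr_ge0 ?powR_ge0 ?exprn_ge0 ?mulr_ge0 ?exprn_ge0// ltW.
have S10 : (0 <= S1)%E by apply: sume_ge0.
have S20 : (0 <= S2)%E by apply: nneseries_ge0 => k _ _; exact: H0.
have [s0|s0] := pselect (forall l, 0 < s l ord0); last first.
  by rewrite normc_op_integrand weight_eq0// mul0r adde_ge0.
have [i si] := max_at_exists m0 s0.
rewrite normc_op_integrand EFinM.
have w0 : (0 <= (weight s)%:E)%E by rewrite lee_fin weight_ge0.
have [rs|sr] := ltP (r `^ (- 2)) (s i ord0).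
  apply: (le_trans _ (leeDl _ S20)).
  apply: (@le_trans _ _ ((C0 * (t i).2 * (r `^ (- 2)) `^ (t i).1.2)%:E * gauss_maximal L F (pole x i) *
    (weight_product (t i).1.1 r s)%:E)%E); last first.
    by rewrite /S1 (bigD1 i)//= leeDl// sume_ge0.
  have [t0 _ _ Hi] := Ht i.
  apply: (le_trans (lee_wpmul2l w0 (HC F x s i si))).
  rewrite muleA -EFinM [leRHS]muleAC -EFinM.
  apply: lee_wpmul2r; first exact: gauss_maximal_ge0.
  rewrite lee_fin -weight_max_product// [leRHS](_ : _ = weight s * (C0 * ((t i).2 * (r `^ (- 2)) `^ (t i).1.2 *
     \prod_l Num.max (s l ord0) (r `^ (- 2)) `^ (- (t i).1.1 l)))); last by ring.
  rewrite ler_wpM2l ?weight_ge0// ler_pM2l//; exact: Hi.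
have S0 : 0 < r `^ (- 2) by rewrite powR_gt0.
have q01 : 0 < (4^-1 : R) < 1 by rewrite invr_gt0 ltr0n invf_lt1// ltr1n.
have sS : 0 < s i ord0 / r `^ (- 2) <= 1.
  by rewrite divr_gt0//= ?ler_pdivrMr ?mul1r//; exact: s0.
(* The ratio is [1/4] because the variables scale like the inverse square of a length. *)
have [k /andP[k1 k2]] := geometric_bracket q01 sS.
have k0 : 0 < 2 ^+ k :> R by rewrite exprn_gt0.
have rk : (2 ^+ k * r) `^ (- 2) = 4^-1 ^+ k * r `^ (- 2).
  rewrite powRM ?(ltW k0) ?(ltW r0)//; congr (_ * _).
  rewrite powRN powR_mulrn ?(ltW k0)// -exprM mulnC exprM exprVn.
  by congr (_ ^- k); rewrite expr2; lra.
apply: (le_trans _ (leeDr _ S10)).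
apply: (@le_trans _ _ (((2 * (2 ^+ k * r)) ^+ n * 2 ^+ L * (2 ^+ k * r) `^ (- 2 * (n%:R - alpha)))%:E *
      rearrangement (gauss_maximal L F) ((2 ^+ k * r * scale_ratio) ^+ n) *
      (weight_product a (2 ^+ k * r) s)%:E)%E); last first.
  exact: (nneseries_ge_term (u := fun k => ((((2 * (2 ^+ k * r)) ^+ n * 2 ^+ L *
    (2 ^+ k * r) `^ (- 2 * (n%:R - alpha)))%:E *
      rearrangement (gauss_maximal L F) ((2 ^+ k * r * scale_ratio) ^+ n)) *
      (weight_product a (2 ^+ k * r) s)%:E)%E)).
have kr0 : 0 < 2 ^+ k * r by rewrite mulr_gt0.
have sk : (2 ^+ k * r) `^ (- 2) / 4 < s i ord0 <= (2 ^+ k * r) `^ (- 2).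
  rewrite rk -ler_pdivrMr// k2 andbT mulrAC -ltr_pdivlMr//.
  by move: k1; rewrite exprSr.
have h := gauss_val_le_rearrangement A hn L F x si kr0 sk.
have sb l : 0 < s l ord0 <= (2 ^+ k * r) `^ (- 2).
  by rewrite s0/=; apply: (le_trans (si.2 l)); move/andP: sk => [].
rewrite (weight_box_product kr0 sb).
apply: (@le_trans _ _ (((2 ^+ k * r) `^ (- 2 * (n%:R - alpha)) * weight_product a (2 ^+ k * r) s)%:E *
   (((2 * (2 ^+ k * r)) ^+ n * 2 ^+ L)%:E *
    rearrangement (gauss_maximal L F) ((2 ^+ k * r / (n%:R * m%:R)) ^+ n)))%E).
  apply: lee_wpmul2l; first by rewrite lee_fin mulr_ge0 ?powR_ge0 ?weight_product_ge0.
  apply: le_trans h; rewrite lee_fin ler_piMl ?normc_ge0//.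
  by rewrite expR_le1 oppr_le0 dispersion_ge0.
rewrite muleA -EFinM [leRHS]muleAC -EFinM.
apply: lee_wpmul2r; first exact: rearrangement_ge0.
by rewrite lee_fin le_eqVlt; apply/orP; left; apply/eqP; ring.
Qed.

Lemma op_integrand_integral L : exists2 C : R, 0 < C &
  forall F x (r : R), 0 < r -> (alpha = 0 -> r <= enorm x) ->
  (\int[lebesgue_rn m]_s (normc (op_integrand a A F x s))%:E <=
   C%:E * ((r `^ alpha)%:E * \sum_i gauss_maximal L F (pole x i) +
    \sum_(k <oo) ((2 ^+ k * r) `^ alpha)%:E *
      rearrangement (gauss_maximal L F) ((2 ^+ k * r * scale_ratio) ^+ n)))%E.
Proof.
have [mu [E [C [C0 amu muE H]]]] := op_integrand_pointwise L.
pose D := \sum_i C i * weight_mass (mu i) + 2 ^+ n * 2 ^+ L * weight_mass a + 1.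
have D10 : 0 <= \sum_i C i * weight_mass (mu i).
  by apply: sumr_ge0 => i _; rewrite mulr_ge0 ?weight_mass_ge0// ltW.
have D20 : 0 <= 2 ^+ n * 2 ^+ L * weight_mass a.
  by rewrite !mulr_ge0 ?exprn_ge0 ?weight_mass_ge0.
have D0 : 0 < D by rewrite /D ltr_wpDl// addr_ge0.
exists D => // F x r r0 rx.
have rk0 k : 0 < 2 ^+ k * r by rewrite mulr_gt0 ?exprn_gt0.
pose g i : \bar R := ((C i * (r `^ (- 2)) `^ E i)%:E * gauss_maximal L F (pole x i))%E.
pose h k : \bar R := (((2 * (2 ^+ k * r)) ^+ n * 2 ^+ L * (2 ^+ k * r) `^ (- 2 * (n%:R - alpha)))%:E *
      rearrangement (gauss_maximal L F) ((2 ^+ k * r * scale_ratio) ^+ n))%E.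
have g0 i : (0 <= g i)%E.
  rewrite /g mule_ge0 ?gauss_maximal_ge0// lee_fin mulr_ge0 ?powR_ge0//; exact: ltW.
have h0 k : (0 <= h k)%E.
  rewrite /h mule_ge0 ?rearrangement_ge0// lee_fin.
  by rewrite !mulr_ge0 ?powR_ge0 ?exprn_ge0// mulr_ge0// ltW.
have gw i s : (0 <= g i * (weight_product (mu i) r s)%:E)%E.
  by rewrite mule_ge0 ?lee_fin ?weight_product_ge0.
have hw k s : (0 <= h k * (weight_product a (2 ^+ k * r) s)%:E)%E.
  by rewrite mule_ge0 ?lee_fin ?weight_product_ge0.
have mg i : measurable_fun setT (fun s => g i * (weight_product (mu i) r s)%:E)%E.
  by apply: measurable_funeM; exact: measurable_weight_product.
have mh k : measurable_fun setT (fun s => h k * (weight_product a (2 ^+ k * r) s)%:E)%E.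
  by apply: measurable_funeM; exact: measurable_weight_product.
apply: (@le_trans _ _ (\int[lebesgue_rn m]_s (\sum_i g i * (weight_product (mu i) r s)%:E +
   \sum_(k <oo) h k * (weight_product a (2 ^+ k * r) s)%:E))%E).
  apply: ge0_le_integralW => s _; first by rewrite lee_fin normc_ge0.
  exact: H.
rewrite ge0_integralD//; last 4 first.
- by move=> s _; apply: sume_ge0.
- by apply: emeasurable_sum => i; exact: mg.
- by move=> s _; apply: nneseries_ge0 => k _ _; exact: hw.
- by apply: ge0_emeasurable_sum => k *; [exact: hw|exact: mh].
rewrite ge0_integral_sum// integral_nneseries//.
have ia l : 0 < a l / 2 < a l.
  by rewrite divr_gt0//= ltr_pdivrMr// ltr_pMr// ltr1n.
(* Power count: [r^(-2 E)] times [r^(2 E + n - (n - alpha))] is [r^alpha]. For the series, with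
   [q = 2^k r], the powers [n], [-2 (n - alpha)] and [2 (n - alpha) - (n - alpha)] of [q] add up to
   [alpha]. *)
have gI i : (\int[lebesgue_rn m]_s (g i * (weight_product (mu i) r s)%:E) =
   (C i * weight_mass (mu i))%:E * ((r `^ alpha)%:E * gauss_maximal L F (pole x i)))%E.
  rewrite ge0_integralZl//; last 2 first.
  - exact: measurable_weight_product.
  - by move=> s _; rewrite lee_fin weight_product_ge0.
  rewrite (integral_weight_product r0 (amu i)) /g muleAC -EFinM muleA -EFinM; congr (_%:E * _)%E.
  rewrite muE -powRrM mulrACA -mulrA [in RHS]mulrAC -[RHS]mulrA; congr (_ * _).
  rewrite mulrA -powRD ?(gt_eqF r0) ?implybT//; congr (_ `^ _ * _); lra.
have hI k : (\int[lebesgue_rn m]_s (h k * (weight_product a (2 ^+ k * r) s)%:E) =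
   (2 ^+ n * 2 ^+ L * weight_mass a)%:E * (((2 ^+ k * r) `^ alpha)%:E *
      rearrangement (gauss_maximal L F) ((2 ^+ k * r * scale_ratio) ^+ n)))%E.
  rewrite ge0_integralZl//; last 2 first.
  - exact: measurable_weight_product.
  - by move=> s _; rewrite lee_fin weight_product_ge0.
  rewrite (integral_weight_product (rk0 k) ia) /h muleAC -EFinM muleA -EFinM; congr (_%:E * _)%E.
  move: (2 ^+ k * r) (rk0 k) => q q0.
  have -> : q `^ alpha = q `^ n%:R * q `^ (- 2 * (n%:R - alpha)) * q `^ (2 * (n%:R - alpha) - (n%:R - alpha)).
    rewrite -!powRD ?(gt_eqF q0) ?implybT//; congr (_ `^ _); lra.
  by rewrite hasum powR_mulrn ?(ltW q0)// exprMn; ring.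
under eq_bigr do rewrite gI.
under eq_eseriesr do rewrite hI.
have M0 i : (0 <= (r `^ alpha)%:E * gauss_maximal L F (pole x i))%E.
  by rewrite mule_ge0 ?gauss_maximal_ge0// lee_fin powR_ge0.
have N0 k : (0 <= ((2 ^+ k * r) `^ alpha)%:E *
      rearrangement (gauss_maximal L F) ((2 ^+ k * r * scale_ratio) ^+ n))%E.
  by rewrite mule_ge0 ?rearrangement_ge0// lee_fin powR_ge0.
rewrite nneseriesZl//.
rewrite ge0_muleDr; last 2 first.
- by rewrite mule_ge0 ?lee_fin ?powR_ge0// sume_ge0// => i _; exact: gauss_maximal_ge0.
- exact: nneseries_ge0.
apply: leeD.
  rewrite ge0_sume_distrr; last by move=> i _; exact: gauss_maximal_ge0.
  rewrite ge0_sume_distrr//; apply: lee_sum => i _.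
  apply: lee_wpmul2r => //; rewrite lee_fin /D -addrA.
  apply: (@le_trans _ _ (\sum_i C i * weight_mass (mu i))); last by rewrite lerDl addr_ge0.
  rewrite (bigD1 i) //= lerDl; apply: sumr_ge0 => j _.
  by rewrite mulr_ge0 ?weight_mass_ge0// ltW.
apply: lee_wpmul2r; first exact: nneseries_ge0.
by rewrite lee_fin /D addrAC lerDr addr_ge0.
Qed.

End operator_estimate.

Section finite_unions.
Context d (T : measurableType d) (R : realType) (mu : {measure set T -> \bar R}).

Lemma measure_finite_union (I : eqType) (r : seq I) (D : I -> set T) :
  (forall i, measurable (D i)) ->
  measurable [set x | exists2 i, i \in r & D i x] /\
  (mu [set x | exists2 i, i \in r & D i x] <= \sum_(i <- r) mu (D i))%E.
Proof.
move=> mD; elim: r => [|i r [mr IH]].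
  rewrite big_nil (_ : [set x | _] = set0) ?measure0//.
  by apply/seteqP; split => // x [].
have -> : [set x | exists2 j, j \in i :: r & D j x] =
    D i `|` [set x | exists2 j, j \in r & D j x].
  apply/seteqP; split=> [x [j]|x [Dx|[j jr Dx]]].
  - by rewrite inE => /predU1P[->|jr] Dx; [left|right; exists j].
  - by exists i => //; rewrite mem_head.
  - by exists j => //; rewrite inE jr orbT.
split; first exact: measurableU.
rewrite big_cons; apply: (@le_trans _ _ (mu (D i) + mu [set x | exists2 j, j \in r & D j x])%E).
  exact: measureU2.
exact: leeD2l.
Qed.

End finite_unions.

(** * The rearrangement of the extended operator *)

Section operator_rearrangement.
Context {R : realType} (n m : nat) (alpha : R).
Context (a : 'I_m -> R) (A : 'I_m -> 'M[R]_n).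
Context (hn : (0 < n)%N) (halpha : 0 <= alpha < n%:R) (hm : 1 - alpha / n%:R < m%:R)
  (ha : forall i, 0 < a i) (hasum : \sum_i a i = n%:R - alpha)
  (hA : forall i, A i *m (A i)^T = 1%:M)
  (hA0 : alpha = 0 -> forall i j, i != j -> A i - A j \in unitmx).
Implicit Types (x y z : 'cV[R]_n) (F : schwartz R n -> R[i]).
Local Notation ratio := (@scale_ratio R n m).
Local Notation rearr L F := (rearrangement (gauss_maximal L F)).

(** A dyadic form of the integral of [rho^(alpha - 1) (MF)^(c rho^n)] over [rho > r], with the
    rearrangement of the maximal function as second factor. *)
Definition tail_sum L F (r : R) : \bar R :=
  (\sum_(k <oo) ((2 ^+ k * r) `^ alpha)%:E * rearr L F ((2 ^+ k * r * ratio) ^+ n))%E.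

Lemma tail_sum_ge0 L F r : (0 <= tail_sum L F r)%E.
Proof.
by apply: nneseries_ge0 => k _ _; rewrite mule_ge0 ?rearrangement_ge0// lee_fin powR_ge0.
Qed.

Lemma orthogonal_bounded (B : 'M[R]_n) : B *m B^T = 1%:M -> matrix_bounded B.
Proof.
move=> BB i j; have : (B *m B^T) i i = 1 by rewrite BB mxE eqxx.
rewrite mxE => Bi; rewrite -sqrtr_sqr -[leRHS]sqrtr1 ler_wsqrtr// -Bi (bigD1 j)//= mxE.
rewrite -expr2 lerDl; apply: sumr_ge0 => k _; rewrite mxE -expr2; exact: sqr_ge0.
Qed.

(** A neighbourhood of the origin is removed together with the points having a pole where the
    maximal function exceeds its rearrangement at [(r * ratio)^n]. Elsewhere each pole term is at
    most the first term of [tail_sum]. Both removed parts have measure of order [r^n]. *)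
Lemma exceptional_set L : exists2 C : R, 0 < C & exists2 Lam : R, 0 < Lam &
  forall F r, 0 < r -> (tail_sum L F r < +oo)%E ->
  exists E : set 'cV[R]_n, [/\ measurable E, (lebesgue_rn n E <= (Lam * r ^+ n)%:E)%E &
   forall x, ~ E x -> (\int[lebesgue_rn m]_s (normc (op_integrand a A F x s))%:E <=
                      C%:E * tail_sum L F r)%E].
Proof.
have [C0 C00 HC] := op_integrand_integral hn halpha hm ha hasum hA0 L.
have nR : 0 < n%:R :> R by rewrite ltr0n.
have m0 : (0 < m)%N.
  rewrite lt0n; apply/eqP => m0; move: hm; rewrite m0 subr_lt0 ltNge => /negP; apply.
  by rewrite ler_pdivrMr ?ltr0n// mul1r; move/andP: halpha => [_ /ltW].
have mR : 0 < m%:R :> R by rewrite ltr0n.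
have ratio0 : 0 < ratio by rewrite invr_gt0 mulr_gt0.
pose D : R := (2 * n%:R + 1) ^+ n.
have D0 : 0 < D by rewrite exprn_gt0// ltr_wpDl// mulr_ge0.
exists (C0 * (m%:R + 1)); first by rewrite mulr_gt0// ltr_wpDl.
exists (2 ^+ n + m%:R * (D * ratio ^+ n)).
  by rewrite addr_gt0 ?exprn_gt0// !mulr_gt0// exprn_gt0.
move=> F r r0 Soo.
pose H1 := rearr L F ((r * ratio) ^+ n).
have H10 : (0 <= H1)%E by exact: rearrangement_ge0.
have ra0 : 0 < r `^ alpha by rewrite powR_gt0.
have H1S : ((r `^ alpha)%:E * H1 <= tail_sum L F r)%E.
  have := @nneseries_ge_term R (fun k => ((2 ^+ k * r) `^ alpha)%:E *
    rearr L F ((2 ^+ k * r * ratio) ^+ n))%E 0.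
  rewrite expr0 mul1r; apply=> i.
  by rewrite mule_ge0 ?rearrangement_ge0// lee_fin powR_ge0.
have H1oo : (H1 < +oo)%E.
  have := le_lt_trans H1S Soo; rewrite !ltey; apply: contra => /eqP ->.
  by rewrite gt0_muley ?lte_fin.
pose level (i : 'I_m) := [set x | (H1 < gauss_maximal L F (pole A x i))%E].
have H1E : H1 = (fine H1)%:E by rewrite fineK// ge0_fin_numE.
have mlevel i : measurable (level i).
  rewrite /level H1E -[X in measurable X]setTI.
  apply: (@measurable_mulmx R n ((A i)^T) measurableT [set w | ((fine H1)%:E < gauss_maximal L F w)%E]).
  apply: box_open_measurable; exact: gauss_maximal_box_open.
(* A cube that contains the open Euclidean ball of radius [r]. *)
pose ball : set 'cV[R]_n := box (fun=> - r) (fun=> r).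
have [mU Ule] := measure_finite_union (lebesgue_rn n) (enum 'I_m) mlevel.
exists (ball `|` [set x | exists2 i, i \in enum 'I_m & level i x]); split.
- by apply: measurableU => //; exact: measurable_box.
- apply: (@le_trans _ _ (lebesgue_rn n ball + lebesgue_rn n [set x | exists2 i, i \in enum 'I_m & level i x])%E).
    by apply: measureU2 => //; exact: measurable_box.
  rewrite mulrDl EFinD; apply: leeD.
    rewrite lebesgue_rn_box; last by move=> i; lra.
    by rewrite prodr_const card_ord -exprMn (_ : r - - r = 2 * r)//; lra.
  apply: (le_trans Ule).
  apply: (@le_trans _ _ (\sum_(i <- enum 'I_m) (D * (r * ratio) ^+ n)%:E)%E).
    apply: lee_sum => i _.
    apply: (@le_trans _ _ (D%:E * lebesgue_rn n [set w | (H1 < gauss_maximal L F w)%E])%E).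
      have := lebesgue_rn_preimage_le (hA i) (orthogonal_bounded (hA i))
        (@gauss_maximal_box_open R n L F (fine H1)).
      by rewrite -H1E.
    rewrite EFinM; apply: lee_wpmul2l; first by rewrite lee_fin ltW.
    apply: rearrangement_level => // s.
    apply: box_open_measurable; exact: gauss_maximal_box_open.
  rewrite sumEFin lee_fin big_const_seq count_predT size_enum_ord iter_addr addr0.
  by rewrite -mulr_natl exprMn le_eqVlt; apply/orP; left; apply/eqP; ring.
move=> x /not_orP[xb xl].
have xr : r <= enorm x.
  rewrite leNgt; apply/negP => xr; apply: xb => i /=.
  have := le_lt_trans (le_entry_enorm x i) xr; rewrite ltr_norml => /andP[/ltW -> ->]//.
apply: (le_trans (HC F x r r0 (fun=> xr))).
rewrite EFinM -muleA; apply: lee_wpmul2l; first by rewrite lee_fin ltW.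
rewrite EFinD ge0_muleDl//= mul1e; apply: leeD => //.
apply: (@le_trans _ _ ((r `^ alpha)%:E * \sum_(i < m) H1)%E).
  apply: lee_wpmul2l; first by rewrite lee_fin powR_ge0.
  apply: lee_sum => i _; rewrite leNgt; apply/negP => Hi; apply: xl.
  by exists i => //; rewrite mem_enum.
rewrite [X in (_ * X <= _)%E](_ : _ = m%:R%:E * H1)%E; last first.
  by rewrite H1E sumEFin sumr_const card_ord -EFinM mulr_natl.
rewrite muleCA; apply: lee_wpmul2l => //; rewrite lee_fin ler0n//.
Qed.

Definition norm_factor : R := `|(op_normalization a)^-1| * 2.

Lemma normc_rough_extension_le F x : tempered_distribution F ->
  ((normc (rough_extension a A F x))%:E <=
   norm_factor%:E * \int[lebesgue_rn m]_s (normc (op_integrand a A F x s))%:E)%E.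
Proof.
move=> tF; rewrite /rough_extension normcM normc_real EFinM /norm_factor EFinM -muleA.
apply: lee_wpmul2l; first by rewrite lee_fin.
exact/normc_complex_integral_le/op_integrand_measurable.
Qed.

(** Outside the exceptional set the operator is at most [C * tail_sum], so this value competes in
    the infimum that defines the rearrangement at the measure of the set. *)
Lemma rough_extension_rearrangement L : exists2 C : R, 0 < C & exists2 Lam : R, 0 < Lam &
  forall F r, tempered_distribution F -> 0 < r ->
  (rearrangement (modulus (rough_extension a A F)) (Lam * r ^+ n) <= C%:E * tail_sum L F r)%E.
Proof.
have [C C0 [Lam Lam0 H]] := exceptional_set L.
have N0 : 0 <= norm_factor by rewrite mulr_ge0.
exists ((norm_factor + 1) * C); first by rewrite mulr_gt0// ltr_wpDl.
exists Lam => // F r tF r0.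
have [Soo|] := ltP (tail_sum L F r) +oo%E; last first.
  rewrite leye_eq => /eqP ->; rewrite gt0_muley ?leey// lte_fin mulr_gt0// ltr_wpDl//.
have [E [mE Er HE]] := H F r r0 Soo.
have S0 := tail_sum_ge0 L F r.
have SE : tail_sum L F r = (fine (tail_sum L F r))%:E by rewrite fineK// ge0_fin_numE.
rewrite SE -EFinM; apply: ereal_inf_lbound.
exists ((norm_factor + 1) * C * fine (tail_sum L F r)) => //; split.
  by rewrite !mulr_ge0 ?addr_ge0 ?(ltW C0) ?fine_ge0.
apply: le_trans Er; apply: le_lebesgue_rnW => x /=; apply: contraPP => Ex.
apply/negP; rewrite -leNgt; apply: (le_trans (normc_rough_extension_le x tF)).
move: norm_factor N0 => N N0; rewrite EFinM -SE EFinM -muleA.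
apply: lee_pmul => //; first by apply: integral_ge0 => s _; rewrite lee_fin normc_ge0.
  by rewrite lee_fin lerDl.
exact: HE.
Qed.

(** The exceptional sets for [r = 1/(k+1)] have measures tending to 0, and a point outside any one
    of them has a convergent integral. Linearity of [complex_integral] depends on this
    convergence. *)
Lemma rough_extension_integrable_ae L F : tempered_distribution F ->
  (forall r, 0 < r -> (tail_sum L F r < +oo)%E) ->
  {ae lebesgue_rn n, forall x, complex_integrable (op_integrand a A F x)}.
Proof.
move=> tF Soo; have [C C0 [Lam Lam0 H]] := exceptional_set L.
pose r k : R := k.+1%:R^-1.
have r0 k : 0 < r k by rewrite invr_gt0.
have [E HE] := choice (fun k => H F (r k) (r0 k) (Soo _ (r0 k))).
exists (\bigcap_k E k); split.
- by apply: bigcapT_measurable => k; have [] := HE k.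
- apply/eqP; rewrite eq_le measure_ge0 andbT; apply/lee_addgt0Pr => e e0; rewrite add0e.
  pose k := Num.truncn (Lam / e).
  have [mE Er _] := HE k.
  apply: (@le_trans _ _ (lebesgue_rn n (E k))).
    by apply: le_lebesgue_rnW => x; exact.
  apply: (le_trans Er); rewrite lee_fin.
  apply: (@le_trans _ _ (Lam * r k)).
    rewrite ler_pM2l// -[leRHS]expr1 ler_wiXn2l ?(ltW (r0 k))//.
    by rewrite invf_le1 ?ler1n.
  by rewrite /r ler_pdivrMr// mulrC -ler_pdivrMr// ltW// truncnS_gt.
move=> x /= xint k _; apply: contrapT => Ex; apply: xint; split.
  exact: op_integrand_measurable.
have [_ _ /(_ x Ex)/le_lt_trans] := HE k; apply.
by rewrite lte_mul_pinfty ?lee_fin ?(ltW C0)//; exact: Soo.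
Qed.

Lemma rough_extension_linear (c : R[i]) F G x :
  complex_integrable (op_integrand a A F x) -> complex_integrable (op_integrand a A G x) ->
  rough_extension a A (c *: F + G) x = c * rough_extension a A F x + rough_extension a A G x.
Proof.
move=> iF iG; rewrite /rough_extension mulrCA -mulrDr; congr (_ * _).
rewrite -complex_integral_linear//; congr complex_integral.
by apply/funext => s; exact: op_integrand_linear.
Qed.

End operator_rearrangement.

(** * Variable exponents on the half-line *)

Lemma ae_impl d (T : measurableType d) (R : realType) (mu : {measure set T -> \bar R})
    (P Q : T -> Prop) : (forall t, P t -> Q t) ->
  {ae mu, forall t, P t} -> {ae mu, forall t, Q t}.
Proof. by move=> PQ; apply: filterS. Qed.

(* For a log-Hoelder exponent p, the power t^p(t) is comparable to t^p_0 near 0 and to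
   t^p_oo near oo, and X^p(t) is comparable to X^p_0 or X^p_oo for bounded
   X >= log_decay t = min(t, 1/t).  Where X is smaller than log_decay t, the integral
   of X^p(t) dt/t converges anyway. *)
Section variable_powers.
Context {R : realType}.

Definition two_valued (c0 c1 t : R) : R := if t <= 1 then c0 else c1.

Definition log_decay (t : R) : R := expR (- `|ln t|).

Lemma log_decay_gt0 t : 0 < log_decay t. Proof. exact: expR_gt0. Qed.

Lemma log_decay_le1 t : log_decay t <= 1.
Proof. by rewrite expR_le1 oppr_le0. Qed.

Lemma powRE (t x : R) : 0 < t -> t `^ x = expR (x * ln t).
Proof. by move=> t0; rewrite /powR gt_eqF. Qed.

(** The exponent [2 * c] turns the growth [t^c] below 1 into the decay [t^(-c)] above 1. *)
Lemma log_decay_powR (t c : R) : 0 < t ->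
  t^-1 * log_decay t `^ c = power_weight c 1 (2 * c) t.
Proof.
move=> t0; have ti : t^-1 = expR (- ln t) by rewrite expRN lnK.
rewrite /power_weight t0 (powRE _ (log_decay_gt0 t)) expRK (powRE _ t0) ti -expRD.
have [t1|t1] := leP t 1.
  rewrite powR1 mulr1 ler0_norm ?ln_le0//; congr expR; ring.
rewrite (powRE _ t0) -expRD gtr0_norm ?ln_gt0//; congr expR; ring.
Qed.

Lemma log_decayE (t : R) : 0 < t -> log_decay t = if t <= 1 then t else t^-1.
Proof.
move=> t0; rewrite /log_decay; have [t1|t1] := leP t 1.
  by rewrite ler0_norm ?ln_le0// opprK lnK.
by rewrite gtr0_norm ?ln_gt0// expRN lnK.
Qed.

(** As a function of [ln t], the logarithm of [t^E(t)] is continuous and piecewise linear: the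
    slopes [e0] and [e1] meet at [ln t = 0]. The jump of the exponent at 1 is therefore harmless. *)
Lemma powR_two_valued_scale (e0 e1 emin emax t l : R) :
  emin <= e0 <= emax -> emin <= e1 <= emax -> 0 < t -> 1 <= l ->
  l `^ emin * t `^ two_valued e0 e1 t <= (l * t) `^ two_valued e0 e1 (l * t) <=
  l `^ emax * t `^ two_valued e0 e1 t.
Proof.
move=> /andP[h1 h2] /andP[h3 h4] t0 l1; have l0 : 0 < l by exact: lt_le_trans l1.
have lt0 : 0 < l * t by rewrite mulr_gt0.
rewrite !(powRE _ t0) !(powRE _ l0) (powRE _ lt0) -!expRD !ler_expR.
rewrite lnM ?posrE// /two_valued.
have ll : 0 <= ln l by exact: ln_ge0.
have e (c : R) : c <= 1 -> ln c <= 0 by move=> c1; exact: ln_le0.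
have e' (c : R) : 1 < c -> 0 < ln c by move=> c1; exact: ln_gt0.
case: (leP t 1) => t1; case: (leP (l * t) 1) => lt1.
- by apply/andP; split; nra.
- have := e _ t1; have := e' _ lt1; rewrite lnM ?posrE// => a1 a2.
  by apply/andP; split; nra.
- have : 1 < l * t by apply: lt_le_trans t1 _; rewrite ler_peMl// ltW.
  by rewrite ltNge lt1.
- by apply/andP; split; nra.
Qed.

Lemma powR_near (t x y C : R) : 0 < t -> `|y - x| * `|ln t| <= C ->
  t `^ y <= expR C * t `^ x.
Proof.
move=> t0 h; rewrite !(powRE _ t0) -expRD ler_expR -lerBlDr -mulrBl.
by apply: le_trans h; rewrite -normrM ler_norm.
Qed.

(** For [X >= 1] the bound [M] controls the change of exponent. For [X < 1] the lower bound
    [log_decay t] gives [|ln X| <= |ln t|], and the log-Hoelder bound applies. *)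
Lemma powR_exponent_change (t X M y z C D : R) : 1 <= M -> X <= M ->
  log_decay t <= X -> `|y - z| * `|ln t| <= C -> `|y - z| <= D ->
  X `^ y <= (M `^ D + expR C) * X `^ z.
Proof.
move=> M1 XM dX yC yD; have X0 : 0 < X by apply: lt_le_trans dX; exact: log_decay_gt0.
have -> : X `^ y = X `^ (y - z) * X `^ z.
  by rewrite -powRD ?(gt_eqF X0) ?implybT// subrK.
rewrite ler_pM2r ?powR_gt0//; have [X1|X1] := leP 1 X.
  apply: (@le_trans _ _ (M `^ D)); last by rewrite lerDl expR_ge0.
  apply: (@le_trans _ _ (X `^ D)).
    by apply: ler_powR => //; exact: le_trans (ler_norm _) yD.
  have D0 : 0 <= D by exact: le_trans yD.
  by apply: ge0_ler_powR; rewrite ?nnegrE ?(ltW X0) ?(le_trans ler01 M1).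
apply: (@le_trans _ _ (expR C)); last by rewrite lerDr powR_ge0.
rewrite (powRE _ X0) ler_expR; apply: le_trans yC.
have lX : ln X <= 0 by apply: ln_le0; exact: ltW.
have : - `|ln t| <= ln X by rewrite -[leLHS]expRK ler_ln ?posrE ?expR_gt0.
have := ler_norm (- (y - z)); rewrite normrN.
have := normr_ge0 (y - z); have := normr_ge0 (ln t).
move: `|y - z| `|ln t| (ln X) lX => A B x *; nra.
Qed.

(** This puts the Lorentz modular in the form of an integral of [(t^e h)^q dt/t]. *)
Lemma poweR_shift (t e : R) (q : R) (h : R) : 0 < t -> 0 <= h ->
  t `^ (q * e - 1) * h `^ q = t^-1 * (t `^ e * h) `^ q.
Proof.
move=> t0 h0; rewrite powRM ?powR_ge0// mulrA; congr (_ * _).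
rewrite -powRrM -(powR_inv1 (ltW t0)) -powRD ?(gt_eqF t0) ?implybT//.
by congr (_ `^ _); ring.
Qed.

(** The geometric factor makes the series converge as soon as the [u k] are bounded by the root
    [T^(1/Q)], for small and large [Q] alike. *)
Lemma nneseries_geometric_powR (u : nat -> R) (x : R) (Q : R) (T : R) :
  0 < Q -> 0 <= x < 1 -> (forall k, 0 <= u k) -> 0 <= T ->
  (forall k, u k `^ Q <= T) ->
  (\sum_(k <oo) (x ^+ k * u k)%:E <= (T `^ Q^-1 / (1 - x))%:E)%E.
Proof.
move=> Q0 x01 u0 T0 uT.
apply: le_trans (nneseries_geometric_le (powR_ge0 T Q^-1) x01).
apply: lee_nneseries => k *.
  by rewrite lee_fin mulr_ge0// exprn_ge0//; move/andP: x01 => [].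
rewrite lee_fin mulrC ler_wpM2r ?exprn_ge0//; first by move/andP: x01 => [].
have -> : u k = (u k `^ Q) `^ Q^-1 by rewrite -powRrM divff ?gt_eqF// powRr1.
by apply: ge0_ler_powR; rewrite ?nnegrE ?powR_ge0 ?invr_ge0 ?(ltW Q0).
Qed.

End variable_powers.

(** * The one-dimensional inequality with variable exponents *)

Section one_dimensional_estimate.
Context {R : realType}.
Local Notation mu := (@lebesgue_measure R).
Context (beta b Lam C0 : R) (p q v : R -> R).
Context (e0 e1 q0 q1 v0 v1 delta eM qm vM Cp Cq Cv : R).
Context (beta0 : 0 <= beta) (b1 : 1 < b) (Lam1 : 1 <= Lam) (C00 : 0 < C0).
Context (delta0 : 0 < delta) (qm0 : 0 < qm).
Context (he0 : delta <= e0 - beta) (he1 : delta <= e1 - beta)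
  (he0M : e0 <= eM) (he1M : e1 <= eM).
Context (hq0 : qm <= q0 <= v0) (hq1 : qm <= q1 <= v1) (hv0 : v0 <= vM) (hv1 : v1 <= vM).
Local Notation E := (two_valued e0 e1).
Local Notation Q := (two_valued q0 q1).
Local Notation V := (two_valued v0 v1).
Context (good : {ae mu, forall t, 0 < t ->
  [/\ `|(p t)^-1 - E t| * `|ln t| <= Cp, `|q t - Q t| * `|ln t| <= Cq,
      `|v t - V t| * `|ln t| <= Cv & [/\ qm <= q t, q t <= v t & v t <= vM]]}).

(** [H] will be the rearrangement of the normalized maximal function and [N] below that of the
    operator. The constants [e0], [e1] are the limits of [1/p]; [q0], [q1] and [v0], [v1] are those
    of [q] and [v]. *)
Definition modular_lhs (H : R -> \bar R) : \bar R :=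
  (\int[mu]_(t in `]0%R, +oo[) ((t `^ (q t / p t - 1))%:E * H t `^ q t))%E.

(** The power of [t] is [v / u - 1], since [1/u = 1/p - beta]. *)
Definition modular_rhs (N : R -> \bar R) : \bar R :=
  (\int[mu]_(t in `]0%R, +oo[) ((t `^ (v t * ((p t)^-1 - beta) - 1))%:E * N t `^ v t))%E.

Let eM0 : 0 <= eM. Proof. by have := he0; have := he0M; have := beta0; have := delta0; lra. Qed.
Let vMqm : qm <= vM.
Proof. by move/andP: hq0 => [h1 h2]; apply: le_trans h1 _; exact: le_trans h2 hv0. Qed.
Let vM0 : 0 < vM. Proof. exact: lt_le_trans vMqm. Qed.

Let Qbounds t : qm <= Q t <= vM.
Proof.
rewrite /two_valued; case: ifP => _.
  by move/andP: hq0 => [-> h]/=; exact: le_trans h hv0.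
by move/andP: hq1 => [-> h]/=; exact: le_trans h hv1.
Qed.

Let QV t : Q t <= V t <= vM.
Proof.
by rewrite /two_valued; case: ifP => _; apply/andP; split => //; [move/andP: hq0 => []|move/andP: hq1 => []].
Qed.

Let Wscale t l : 0 < t -> 1 <= l ->
  l `^ (delta + beta) * t `^ E t <= (l * t) `^ E (l * t) <= l `^ eM * t `^ E t.
Proof. by move=> t0 l1; apply: powR_two_valued_scale => //; rewrite ?he0M ?he1M andbT addrC -lerBrDl. Qed.

(** The bound for [t^E(t) H(t)]: the first factor comes from integrating over an interval of length
    [t / 2], [expR Cp] from replacing [1/p] by its model, and [2^eM] from moving [t] within that
    interval. *)
Definition sup_const : R := 2 `^ qm^-1 * (expR Cp * 2 `^ eM).

Let Cp0 : 0 <= Cp.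
Proof.
have [N [mN N0 HN]] := good; apply: contrapT => /negP; rewrite -ltNge => Cpneg.
have sub : (`]0%R, 1%R[%classic : set R) `<=` N.
  move=> t /=; rewrite in_itv/= => /andP[t0 t1]; apply: HN => /= /(_ t0)[h _ _ _].
  have : 0 <= `|(p t)^-1 - E t| * `|ln t| by rewrite mulr_ge0.
  by move=> /le_trans/(_ h); rewrite leNgt Cpneg.
have : (mu (`]0%R, 1%R[%classic : set R) <= mu N)%E by apply: le_measure; rewrite ?inE.
by rewrite N0 lebesgue_measure_itv/= lte_fin ltr01 -EFinB subr0 leNgt lte_fin ltr01.
Qed.

Lemma sup_const_ge1 : 1 <= sup_const.
Proof.
rewrite /sup_const -[leLHS]mul1r; apply: ler_pM => //.
  by rewrite -[leLHS](powRr0 2); apply: ler_powR; rewrite ?ler1n ?invr_ge0 ?ltW.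
rewrite -[leLHS]mul1r; apply: ler_pM => //; first by rewrite -expR0 ler_expR.
by rewrite -[leLHS](powRr0 2); apply: ler_powR; rewrite ?ler1n.
Qed.

(** The gap [delta] yields [b^(-k delta)], that is [x^k x^k]. One [x^k] sums the series; the other,
    raised to a power at least [qm], is at most [b^(-2 k eta) = y^k y^k]. One [y^k] then sums the
    integrals and the other pays for jumps of the model exponent. *)
Definition tail_decay : R := b `^ (- (delta / 2)).
Definition tail_exponent : R := delta * qm / 4.
Local Notation x := tail_decay.
Local Notation eta := tail_exponent.
Local Notation y := (b `^ (- eta)).

Let b0 : 0 < b. Proof. exact: lt_trans b1. Qed.
Let Lam0 : 0 < Lam. Proof. exact: lt_le_trans Lam1. Qed.
Let eta0 : 0 < eta. Proof. by rewrite !mulr_gt0// invr_gt0. Qed.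

Let powb_lt1 e : 0 < e -> 0 < b `^ (- e) < 1.
Proof.
move=> e0'; rewrite powR_gt0//= (powRE _ b0) expR_lt1 mulNr oppr_lt0.
by rewrite mulr_gt0// ln_gt0.
Qed.

Let x01 : 0 < x < 1. Proof. by apply: powb_lt1; rewrite divr_gt0. Qed.
Let y01 : 0 < y < 1. Proof. exact: powb_lt1. Qed.

Let xX k : x ^+ k = (b ^+ k) `^ (- (delta / 2)).
Proof. by rewrite expr_powR. Qed.

(** Origin of the constants: [modular_const] pays for replacing [p] and [q] by their models in the
    modular of [H]; [value_bound] dominates [t^(1/u) N]; the factors of [power_const] pay in turn
    for passing from [v] to [V], from [V] to [Q], and from the sum of the series to its terms;
    [jump_const] serves the scales where [Q] changes; [total_mass] collects the integrals. *)
Definition modular_const : R := (sup_const `^ vM + expR Cq) * expR Cp `^ vM.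

Definition series_const : R := C0 * (expR Cp * Lam `^ eM).
Definition value_bound : R := 1 + series_const * (sup_const / (1 - x)).
Definition power_const : R :=
  (value_bound `^ vM + expR Cv) * value_bound `^ vM * (1 + series_const / (1 - x)) `^ vM.
Definition jump_const : R := sup_const `^ vM * Lam `^ eta.
Definition total_mass : R := power_weight_mass qm (2 * qm) + power_const *
  ((modular_const + power_weight_mass qm (2 * qm) +
    jump_const * power_weight_mass eta (2 * eta)) / (1 - y)).
(** Dividing [N] by [K >= 1] divides its modular by at least [K^qm], because [v >= qm]; this choice
    of [K] brings a modular bounded by [total_mass] below 1. *)
Definition one_dimensional_const : R := (1 + total_mass) `^ qm^-1.

Lemma series_const_ge0 : 0 <= series_const.
Proof. by rewrite mulr_ge0 ?(ltW C00)// mulr_ge0 ?expR_ge0 ?powR_ge0. Qed.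

Lemma inv_tail_gap_gt0 : 0 < (1 - x)^-1. Proof. by rewrite invr_gt0 subr_gt0; case/andP: x01. Qed.

Lemma inv_term_gap_gt0 : 0 < (1 - y)^-1. Proof. by rewrite invr_gt0 subr_gt0; case/andP: y01. Qed.

Lemma value_bound_ge1 : 1 <= value_bound.
Proof.
by rewrite lerDl (mulr_ge0 series_const_ge0)// mulr_ge0 ?(ltW inv_tail_gap_gt0)//; exact: le_trans sup_const_ge1.
Qed.

Lemma power_const_gt0 : 0 < power_const.
Proof.
have s0 := series_const_ge0; have i0 := ltW inv_tail_gap_gt0; have vb := value_bound_ge1.
rewrite !mulr_gt0//; last 2 first.
- by rewrite powR_gt0//; apply: lt_le_trans vb.
- by rewrite powR_gt0// ltr_pwDl// mulr_ge0.
by rewrite ltr_wpDl ?powR_ge0 ?expR_gt0.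
Qed.

Section bound.
Context (H : R -> \bar R) (H0 : forall t, (0 <= H t)%E)
  (Hmono : forall t t', 0 < t <= t' -> (H t' <= H t)%E)
  (Hmod : (modular_lhs H <= 1)%E).

Local Notation M1 := sup_const.

(** By monotonicity [H >= H t] on the interval from [t / 2] to [t]; a larger [X] would make the
    modular exceed 1 on this interval alone. Taking a real [X] below the product covers the case
    where [H t] is infinite. *)
Let sup_bound_aux t X : 0 < t -> 0 <= X -> (X%:E <= (t `^ E t)%:E * H t)%E -> X <= M1.
Proof.
move=> t0 X0 XH; rewrite leNgt; apply/negP => MX.
pose k := (expR Cp * 2 `^ eM)^-1; have kk : 0 < expR Cp * 2 `^ eM.
  by rewrite mulr_gt0 ?expR_gt0 ?powR_gt0.
pose Y := k * X.
have Y2 : 2 `^ qm^-1 < Y by rewrite /Y mulrC ltr_pdivlMr.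
have Y1 : 1 <= Y.
  by apply: le_trans (ltW Y2); rewrite -[leLHS](powRr0 2) ler_powR ?ler1n ?invr_ge0 ?(ltW qm0).
have Y0 : 0 <= Y by exact: le_trans Y1.
pose B : set R := `]t / 2, t[%classic.
have mB : measurable B by exact: measurable_itv.
pose c := t^-1 * Y `^ qm.
have c0 : 0 <= c by rewrite mulr_ge0 ?invr_ge0 ?powR_ge0 ?(ltW t0).
have : ((c * (t - t / 2))%:E <= modular_lhs H)%E.
  rewrite (_ : (c * (t - t / 2))%:E = \int[mu]_(s in `]0%R, +oo[) (c * \1_B s)%:E)%E; last first.
    under eq_integral do rewrite EFinM.
    rewrite ge0_integralZl//=; last exact/measurable_EFinP/measurable_funTS/measurable_indic.
    rewrite integral_indic//=.
    rewrite -[X in (_ * X)%E]/(mu (B `&` `]0%R, +oo[%classic)).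
    rewrite (_ : B `&` _ = B); last first.
      apply/seteqP; split=> s /=; rewrite !in_itv/= andbT; first by case.
      move=> st; split=> //; move/andP: st => [s1 _].
      by apply: lt_trans s1; rewrite divr_gt0.
    rewrite lebesgue_measure_itv/= lte_fin ltr_pdivrMr// ltr_pMr// ltr1n.
    by rewrite -EFinB -EFinM.
  rewrite /modular_lhs; apply: ae_le_ge0_integral.
  - by move=> s _; rewrite lee_fin mulr_ge0.
  - by move=> s _; rewrite mule_ge0 ?poweR_ge0// lee_fin powR_ge0.
  apply: ae_impl good => s gs /=; rewrite in_itv/= andbT => s0.
  rewrite indicE; have [/set_mem|_] := boolP (s \in B); last first.
    by rewrite mulr0 mule_ge0 ?poweR_ge0// lee_fin powR_ge0.
  rewrite /B/= in_itv/= mulr1 => /andP[ts st].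
  have [gp _ _ [qmq _ _]] := gs s0.
  have qs0 : 0 < q s by exact: lt_le_trans qmq.
  have : (H t <= H s)%E by apply: Hmono; rewrite s0 ltW.
  case: (H s) (H0 s) => [h h0 Hts|_ _|//]; last first.
    rewrite poweRyr ?gt_eqF// gt0_muley ?leey// lte_fin powR_gt0//.
  rewrite poweR_EFin -EFinM lee_fin poweR_shift//.
  have Xh : X <= t `^ E t * h.
    rewrite -lee_fin; apply: (le_trans XH); rewrite EFinM.
    by apply: lee_wpmul2l => //; rewrite lee_fin powR_ge0.
  have tl : t = (t / s) * s by rewrite divfK// gt_eqF.
  have l1 : 1 <= t / s by rewrite ler_pdivlMr// mul1r ltW.
  have l2 : t / s <= 2 by rewrite ler_pdivrMr// -ler_pdivrMl// mulrC ltW.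
  have W1 : t `^ E t <= 2 `^ eM * s `^ E s.
    have /andP[_] := Wscale s0 l1; rewrite -tl => /le_trans; apply.
    rewrite ler_wpM2r ?powR_ge0// ge0_ler_powR// nnegrE//.
    exact: le_trans l1.
  have W2 : s `^ E s <= expR Cp * s `^ (p s)^-1 by apply: powR_near => //; rewrite distrC.
  have Yh : Y <= s `^ (p s)^-1 * h.
    rewrite /Y mulrC ler_pdivrMr//; apply: (le_trans Xh).
    apply: (@le_trans _ _ (2 `^ eM * (expR Cp * s `^ (p s)^-1) * h)).
      rewrite ler_wpM2r//; apply: (le_trans W1); rewrite ler_wpM2l ?powR_ge0//.
    by rewrite le_eqVlt; apply/orP; left; apply/eqP; ring.
  rewrite /c; apply: ler_pM; rewrite ?invr_ge0 ?powR_ge0 ?(ltW t0)//.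
    by rewrite lef_pV2 ?posrE// ltW.
  apply: (@le_trans _ _ (Y `^ q s)); first exact: ler_powR.
  by apply: ge0_ler_powR; rewrite ?nnegrE ?(ltW qs0)// mulr_ge0 ?powR_ge0.
move=> /le_trans/(_ Hmod); rewrite lee_fin /c.
have -> : t^-1 * Y `^ qm * (t - t / 2) = Y `^ qm / 2 by field; rewrite gt_eqF.
rewrite ler_pdivrMr// mul1r; apply/negP; rewrite -ltNge.
have -> : 2 = (2 `^ qm^-1) `^ qm :> R by rewrite -powRrM mulVf ?gt_eqF// powRr1.
by apply: gt0_ltr_powR; rewrite ?nnegrE ?powR_ge0.
Qed.

Let sup_bound t : 0 < t -> ((t `^ E t)%:E * H t <= M1%:E)%E.
Proof.
move=> t0; case e : ((t `^ E t)%:E * H t)%E => [r| |]; last by rewrite leNye.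
  rewrite lee_fin; have [r0|/ltW r0] := leP 0 r; last first.
    by apply: (le_trans r0); exact: le_trans sup_const_ge1.
  by apply: (sup_bound_aux t0 r0); rewrite e.
have M0 : 0 <= M1 + 1 by have := sup_const_ge1; lra.
by have := sup_bound_aux t0 M0; rewrite e leey => /(_ isT); rewrite gerDl ler10.
Qed.

Let h t := fine (H t).

Let HE t : 0 < t -> H t = (h t)%:E.
Proof.
move=> t0; rewrite /h fineK// ge0_fin_numE// ltey; apply/eqP => Hoo.
have := sup_bound t0; rewrite Hoo gt0_muley ?lte_fin ?powR_gt0//.
Qed.

Let h0 t : 0 <= h t. Proof. exact: fine_ge0. Qed.

Let Phi t := t `^ E t * h t.

Let Phi0 t : 0 <= Phi t. Proof. by rewrite mulr_ge0 ?powR_ge0. Qed.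

Let PhiM t : 0 < t -> Phi t <= M1.
Proof. by move=> t0; have := sup_bound t0; rewrite HE// -EFinM lee_fin. Qed.

Let f t := t^-1 * Phi t `^ Q t.

Let f0 t : 0 < t -> 0 <= f t.
Proof. by move=> t0; rewrite mulr_ge0 ?powR_ge0 ?invr_ge0 ?(ltW t0). Qed.

Let measurable_two (c0 c1 : R) (g : R -> R) : measurable_fun (`]0%R, +oo[ : set R) g ->
  measurable_fun (`]0%R, +oo[ : set R) (fun t => g t `^ two_valued c0 c1 t).
Proof.
move=> mg; rewrite (_ : (fun t => _) =
    fun t => if t <= 1 then g t `^ c0 else g t `^ c1); last first.
  by apply/funext => t; rewrite /two_valued; case: ifP.
apply: measurable_fun_if => //.
- by apply: measurable_fun_ler => //; exact: measurable_id.
- apply: (@measurable_comp _ _ _ _ _ _ setT (@powR R ^~ c0)) => //.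
  by apply: measurable_funS mg => //; exact: subIsetl.
- apply: (@measurable_comp _ _ _ _ _ _ setT (@powR R ^~ c1)) => //.
  by apply: measurable_funS mg => //; exact: subIsetl.
Qed.

(** The finite monotone function [h] has intervals as preimages of half-lines. *)
Let measurable_Phi : measurable_fun (`]0%R, +oo[ : set R) Phi.
Proof.
apply: measurable_funM; first by apply: measurable_two; exact: measurable_id.
apply: (measurability (@RGenCInfty.G R)) => [|/= _ [_] [r] -> <-].
  exact: RGenCInfty.measurableE.
apply: is_interval_measurable => s t/=.
rewrite !in_itv/= !andbT => -[s0 fs] [t0 ft] u /andP[su ut].
have u0 : 0 < u by exact: lt_le_trans su.
rewrite !in_itv/= !andbT; split => //; apply: (le_trans ft).
by rewrite -lee_fin -!HE//; apply: Hmono; rewrite u0.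
Qed.

Let measurable_f : measurable_fun (`]0%R, +oo[ : set R) f.
Proof.
apply: measurable_funM; last exact: measurable_two measurable_Phi.
apply: (@eq_measurable_fun _ _ _ _ _ (@powR R ^~ (-1))); last exact/measurable_funTS.
by move=> t; rewrite inE/= in_itv/= andbT => t0; rewrite powR_inv1// ltW.
Qed.

Let mc0 : 0 < modular_const.
Proof. by rewrite mulr_gt0 ?powR_gt0 ?expR_gt0// ltr_wpDl ?powR_ge0 ?expR_gt0. Qed.

Let f_large t : 0 < t -> `|(p t)^-1 - E t| * `|ln t| <= Cp ->
  `|q t - Q t| * `|ln t| <= Cq -> qm <= q t <= vM -> log_decay t <= Phi t ->
  modular_const^-1 * f t <= t `^ (q t / p t - 1) * h t `^ q t.
Proof.
move=> t0 gp gq /andP[q1' q2'] dP; rewrite mulrC ler_pdivrMr// poweR_shift// mulrC /f.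
have qt0 : 0 <= q t by apply: le_trans q1'; exact: ltW.
have [Qa Qb] := andP (Qbounds t).
have M11 := sup_const_ge1.
have s1 : Phi t `^ Q t <= (M1 `^ vM + expR Cq) * Phi t `^ q t.
  apply: (powR_exponent_change M11 (PhiM t0) dP); first by rewrite distrC.
  by rewrite ler_norml; move: qm0 Qa Qb q1' q2'; move: (Q t) (q t) => u w *; apply/andP; split; lra.
have s2 : Phi t `^ q t <= expR Cp `^ vM * (t `^ (p t)^-1 * h t) `^ q t.
  apply: (@le_trans _ _ ((expR Cp * (t `^ (p t)^-1 * h t)) `^ q t)).
    apply: ge0_ler_powR; rewrite ?nnegrE// ?mulr_ge0 ?expR_ge0 ?powR_ge0//.
    by rewrite mulrA ler_wpM2r//; apply: powR_near => //; rewrite distrC.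
  have h1 : 0 <= t `^ (p t)^-1 * h t by rewrite mulr_ge0 ?powR_ge0.
  rewrite (powRM _ (expR_ge0 Cp) h1); apply: ler_wpM2r; first exact: powR_ge0.
  by apply: ler_powR q2'; rewrite -expR0 ler_expR; exact: Cp0.
have ti : 0 < t^-1 by rewrite invr_gt0.
rewrite (mulrCA modular_const) (ler_pM2l ti); apply: (le_trans s1).
rewrite /modular_const -(mulrA (_ + _)); apply: ler_wpM2l s2.
by rewrite addr_ge0 ?powR_ge0 ?expR_ge0.
Qed.

Let integral_f : (\int[mu]_(t in `]0%R, +oo[) (f t)%:E <=
  (modular_const + power_weight_mass qm (2 * qm))%:E)%E.
Proof.
pose g1 t := if log_decay t <= Phi t then f t else 0.
(* [g1] is compared with the modular by [f_large]; [g2] is dominated by [log_decay^qm dt/t]. *)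
pose g2 t := if log_decay t <= Phi t then 0 else f t.
have fg t : f t = g1 t + g2 t.
  by rewrite /g1 /g2; case: ifP; rewrite ?addr0 ?add0r.
have mD : measurable_fun (`]0%R, +oo[ : set R) (fun t => log_decay t <= Phi t).
  apply: measurable_fun_ler => //.
  apply: measurable_funTS; apply: (measurableT_comp (@measurable_expR R)).
  by apply: measurable_funN; apply: measurableT_comp => //; exact: measurable_ln.
have mg1 : measurable_fun (`]0%R, +oo[ : set R) g1.
  by apply: measurable_fun_if => //; apply: measurable_funS measurable_f => //; exact: subIsetl.
have mg2 : measurable_fun (`]0%R, +oo[ : set R) g2.
  by apply: measurable_fun_if => //; apply: measurable_funS measurable_f => //; exact: subIsetl.
have pos t : (`]0%R, +oo[%classic : set R) t -> 0 < t by rewrite /= in_itv/= andbT.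
have g10 t : 0 < t -> 0 <= g1 t by move=> t0; rewrite /g1; case: ifP => // _; exact: f0.
have g20 t : 0 < t -> 0 <= g2 t by move=> t0; rewrite /g2; case: ifP => // _; exact: f0.
under eq_integral do rewrite fg EFinD.
rewrite ge0_integralD//; last 4 first.
- by move=> t /pos t0; rewrite lee_fin g10.
- exact/measurable_EFinP.
- by move=> t /pos t0; rewrite lee_fin g20.
- exact/measurable_EFinP.
rewrite EFinD; apply: leeD.
  have : (\int[mu]_(t in `]0%R, +oo[) ((modular_const^-1)%:E * (g1 t)%:E) <= 1)%E.
    apply: le_trans Hmod; rewrite /modular_lhs; apply: ae_le_ge0_integral.
    - by move=> t /pos t0; rewrite -EFinM lee_fin mulr_ge0 ?g10// invr_ge0 ltW.
    - by move=> t _; rewrite mule_ge0 ?poweR_ge0// lee_fin powR_ge0.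
    apply: ae_impl good => t gt /pos t0; have [gp gq _ [g1' g2' g3']] := gt t0.
    rewrite HE// poweR_EFin -!EFinM lee_fin /g1; case: ifPn => [dP|_].
      by apply: f_large => //; rewrite g1' (le_trans g2' g3').
    by rewrite mulr0 mulr_ge0 ?powR_ge0.
  rewrite ge0_integralZl//; last 3 first.
  - exact/measurable_EFinP.
  - by move=> t /pos t0; rewrite lee_fin g10.
  - by rewrite lee_fin invr_ge0 ltW.
  by rewrite muleC lee_pdivrMr// mul1e.
have qq : 0 < qm < 2 * qm by rewrite qm0/= ltr_pMl// ltr1n.
rewrite -(power_weight_massE qq).
apply: (@le_trans _ _ (\int[mu]_(t in `]0%R, +oo[) (power_weight qm 1 (2 * qm) t)%:E)%E); last first.
  apply: ge0_subset_integral => //.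
  - by apply/measurable_EFinP; exact: measurable_power_weight.
  - by move=> t _; rewrite lee_fin power_weight_ge0.
apply: ge0_le_integralW => t /pos t0; rewrite lee_fin; first exact: g20.
rewrite /g2; case: ifPn => [_|]; first exact: power_weight_ge0.
rewrite -ltNge => Pd; have ti : 0 < t^-1 by rewrite invr_gt0.
rewrite -(log_decay_powR _ t0) /f (ler_pM2l ti).
have [Qa Qb] := andP (Qbounds t).
apply: (@le_trans _ _ (log_decay t `^ Q t)).
  apply: ge0_ler_powR; rewrite ?nnegrE ?(ltW Pd) ?(ltW (log_decay_gt0 t))//.
  by apply: le_trans Qa; exact: ltW.
by apply: ger_powR => //; rewrite log_decay_gt0 log_decay_le1.
Qed.


(** Passing from [t / Lam] to [w] multiplies [t^E(t)] by at least [b^(k (delta + beta))], while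
    [w^beta] costs only [b^(k beta)]. The surplus is [x^k x^k]. *)
Lemma shift_le k t : 0 < t ->
  t `^ (E t - beta) * ((b ^+ k * (t / Lam)) `^ beta * h (b ^+ k * (t / Lam))) <=
  Lam `^ eM * (x ^+ k * (x ^+ k * Phi (b ^+ k * (t / Lam)))).
Proof.
move=> t0; set w := b ^+ k * _; have tau0 : 0 < t / Lam by rewrite divr_gt0.
have bk1 : 1 <= b ^+ k by rewrite exprn_ege1// ltW.
have bk0 : 0 < b ^+ k by exact: lt_le_trans bk1.
have w0 : 0 < w by rewrite mulr_gt0.
have /andP[_ A1] := Wscale tau0 Lam1.
have /andP[A2 _] := Wscale tau0 bk1.
rewrite -/w in A2; rewrite [Lam * _]mulrC divfK ?gt_eqF// in A1.
have A3 : w `^ beta <= (b ^+ k) `^ beta * t `^ beta.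
  rewrite -powRM ?(ltW bk0) ?(ltW t0)//.
  apply: ge0_ler_powR; rewrite ?nnegrE ?(ltW w0) ?mulr_ge0 ?(ltW bk0) ?(ltW t0)//.
  by rewrite ler_pM2l// ler_pdivrMr// ler_peMr// ltW.
have A4 : t `^ (E t - beta) * t `^ beta = t `^ E t.
  by rewrite -powRD ?(gt_eqF t0) ?implybT// subrK.
have A5 : x ^+ k * x ^+ k * (b ^+ k) `^ (delta + beta) = (b ^+ k) `^ beta.
  rewrite xX -!powRD ?(gt_eqF bk0) ?implybT//; congr (_ `^ _); lra.
have h0w := h0 w.
apply: (@le_trans _ _ ((b ^+ k) `^ beta * t `^ E t * h w)).
  rewrite mulrA ler_wpM2r// -A4.
  apply: (@le_trans _ _ (t `^ (E t - beta) * ((b ^+ k) `^ beta * t `^ beta))).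
    by rewrite ler_wpM2l ?powR_ge0.
  by rewrite mulrCA mulrA.
have xk0 : 0 <= x ^+ k by rewrite exprn_ge0// ltW//; case/andP: x01.
rewrite /Phi !mulrA ler_wpM2r// -A5.
set s := (t / Lam) `^ E (t / Lam) in A1 A2.
apply: (@le_trans _ _ (x ^+ k * x ^+ k * (b ^+ k) `^ (delta + beta) * (Lam `^ eM * s))).
  by rewrite ler_wpM2l// !mulr_ge0 ?powR_ge0.
have -> : x ^+ k * x ^+ k * (b ^+ k) `^ (delta + beta) * (Lam `^ eM * s) =
   Lam `^ eM * x ^+ k * x ^+ k * ((b ^+ k) `^ (delta + beta) * s) by ring.
by rewrite ler_wpM2l// !mulr_ge0 ?powR_ge0.
Qed.

Let u k t := x ^+ k * Phi (b ^+ k * (t / Lam)).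

Let u0 k t : 0 <= u k t.
Proof. by rewrite mulr_ge0// exprn_ge0// ltW//; case/andP: x01. Qed.

Let w_gt0 k t : 0 < t -> 0 < b ^+ k * (t / Lam).
Proof. by move=> t0; rewrite mulr_gt0 ?exprn_gt0 ?divr_gt0. Qed.

Let uM k t : 0 < t -> u k t <= M1.
Proof.
move=> t0; rewrite -[leRHS]mul1r; apply: ler_pM => //; last exact/PhiM/w_gt0.
  by rewrite exprn_ge0// ltW//; case/andP: x01.
by rewrite exprn_ile1// ltW//; case/andP: x01.
Qed.

Let xle : 0 <= x < 1. Proof. by case/andP: x01 => /ltW -> ->. Qed.

Let sum_u t : 0 < t -> (\sum_(k <oo) (x ^+ k * u k t)%:E <= (M1 / (1 - x))%:E)%E.
Proof.
move=> t0; apply: le_trans (nneseries_geometric_le _ xle); last first.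
  exact: le_trans sup_const_ge1.
have xk0 k : 0 <= x ^+ k by rewrite exprn_ge0//; case/andP: xle.
apply: lee_nneseries => k *; first by rewrite lee_fin mulr_ge0.
by rewrite lee_fin mulrC ler_wpM2r// uM.
Qed.

Local Notation tail t :=
  (\sum_(k <oo) ((b ^+ k * t) `^ beta)%:E * H (b ^+ k * t)%R)%E.

Let tail_le t : 0 < t -> ((t `^ (E t - beta))%:E * tail (t / Lam) <=
  (Lam `^ eM)%:E * \sum_(k <oo) (x ^+ k * u k t)%:E)%E.
Proof.
move=> t0; have xk0 k : 0 <= x ^+ k by rewrite exprn_ge0//; case/andP: xle.
rewrite -nneseriesZl; last by move=> k _; rewrite mule_ge0// lee_fin powR_ge0.
rewrite -nneseriesZl; last by move=> k _; rewrite lee_fin mulr_ge0.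
apply: lee_nneseries => k *.
  by rewrite !mule_ge0// lee_fin powR_ge0.
by rewrite HE ?w_gt0// -!EFinM lee_fin; exact: shift_le.
Qed.

(** Finiteness at every [t] is what later gives the almost everywhere convergence of the integral
    defining the operator. *)
Lemma tail_lty t : 0 < t -> (tail t < +oo)%E.
Proof.
move=> t0; have Lt0 : 0 < Lam * t by rewrite mulr_gt0.
have := tail_le Lt0; rewrite [Lam * t]mulrC mulfK ?gt_eqF// [t * Lam]mulrC.
set c := (Lam * t) `^ _; have c0 : 0 < c by rewrite powR_gt0.
rewrite !ltey => hle; apply/eqP => e; move: hle; rewrite e gt0_muley ?lte_fin//.
rewrite leye_eq => /eqP; apply/eqP; rewrite lt_eqF//.
apply: (@le_lt_trans _ _ ((Lam `^ eM)%:E * (M1 / (1 - x))%:E)%E); last by rewrite -EFinM ltry.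
by apply: lee_wpmul2l; [rewrite lee_fin powR_ge0|exact: sum_u].
Qed.


(** If [Q] agrees at [t] and at the shifted point, the term is a value of [f]. Otherwise 1 separates
    the two points, which forces [b^(-k) <= Lam * log_decay t]; since [Phi] is bounded, the spare
    [y^k] provides an integrable power of [log_decay]. *)
Let term_le k t : 0 < t ->
  t^-1 * u k t `^ Q t <= y ^+ k * (b ^+ k / Lam * f (b ^+ k / Lam * t) +
    jump_const * power_weight eta 1 (2 * eta) t).
Proof.
move=> t0; have bk1 : 1 <= b ^+ k by rewrite exprn_ege1// ltW.
have bk0 : 0 < b ^+ k by exact: lt_le_trans bk1.
have -> : b ^+ k / Lam * t = b ^+ k * (t / Lam) by rewrite mulrAC mulrA.
rewrite /u; set w := b ^+ k * (t / Lam); have w0 : 0 < w by exact: w_gt0.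
have [Qa Qb] := andP (Qbounds t).
have Qt0 : 0 < Q t by exact: lt_le_trans Qa.
set yk := y ^+ k.
have yk0 : 0 < yk by rewrite exprn_gt0//; case/andP: y01.
have yk1 : yk <= 1 by case/andP: y01 => *; rewrite exprn_ile1// ltW.
have xk0 : 0 < x ^+ k by rewrite exprn_gt0//; case/andP: x01.
have xk1 : x ^+ k <= 1 by case/andP: x01 => *; rewrite exprn_ile1// ltW.
have ykE : yk = (b ^+ k) `^ (- eta) by rewrite /yk expr_powR.
have xq : (x ^+ k) `^ Q t <= yk * yk.
  apply: (@le_trans _ _ ((x ^+ k) `^ qm)); first by apply: ger_powR => //; rewrite xk0 xk1.
  rewrite ykE xX -powRrM -powRD ?(gt_eqF bk0) ?implybT// le_eqVlt; apply/orP; left.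
  by apply/eqP; congr (_ `^ _); rewrite /tail_exponent; lra.
have ti : 0 < t^-1 by rewrite invr_gt0.
have pw0 : 0 <= power_weight eta 1 (2 * eta) t by exact: power_weight_ge0.
have jc0 : 0 <= jump_const by rewrite mulr_ge0 ?powR_ge0.
rewrite powRM ?(ltW xk0)//.
apply: (@le_trans _ _ (yk * (yk * (t^-1 * Phi w `^ Q t)))).
  have -> : yk * (yk * (t^-1 * Phi w `^ Q t)) = t^-1 * (yk * yk * Phi w `^ Q t) by ring.
  by rewrite ler_pM2l// ler_wpM2r// powR_ge0.
rewrite ler_pM2l//.
have jump : Q t = Q w \/ yk <= Lam `^ eta * log_decay t `^ eta.
  have ykV : yk = (b ^+ k)^-1 `^ eta.
    by rewrite ykE -(powR_inv1 (ltW bk0)) -powRrM mulN1r.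
  have sf z : 0 <= z -> (b ^+ k)^-1 <= Lam * z -> yk <= Lam `^ eta * z `^ eta.
    move=> z0 bz; rewrite -powRM ?(ltW Lam0)// ykV.
    have Lz : 0 <= Lam * z by rewrite mulr_ge0// ltW.
    by apply: ge0_ler_powR => //; rewrite ?nnegrE ?invr_ge0 ltW.
  rewrite /two_valued log_decayE//; have [t1|t1] := leP t 1; have [w1|w1] := leP w 1.
  - by left.
  - right; apply: sf; first exact: ltW.
    have bt : 1 < b ^+ k * t.
      by move: w1; rewrite /w mulrA ltr_pdivlMr// mul1r; exact: le_lt_trans.
    apply: (@le_trans _ _ t); last by rewrite ler_peMl// ltW.
    by rewrite -[leLHS]mul1r ler_pdivrMr// mulrC ltW.
  - right; apply: sf; first exact: ltW.
    have h1 : b ^+ k * t <= Lam by move: w1; rewrite /w mulrA ler_pdivrMr// mul1r.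
    rewrite ler_pdivlMr//; apply: le_trans h1; rewrite ler_wpM2r ?(ltW t0)//.
    by apply: (le_trans _ bk1); rewrite invf_le1.
  - by left.
case: jump => [QQ|yL].
  rewrite -[leLHS]addr0; apply: lerD; last exact: mulr_ge0.
  apply: (@le_trans _ _ (t^-1 * Phi w `^ Q t)).
    by rewrite ler_piMl// mulr_ge0 ?powR_ge0 ?(ltW ti).
  rewrite QQ /f mulrA ler_wpM2r ?powR_ge0// /w le_eqVlt; apply/orP; left; apply/eqP.
  by field; rewrite !gt_eqF.
rewrite -[leLHS]add0r; apply: lerD.
  by rewrite mulr_ge0 ?f0// divr_ge0// ltW.
rewrite -log_decay_powR// /jump_const.
have PM : Phi w `^ Q t <= M1 `^ vM.
  apply: (@le_trans _ _ (M1 `^ Q t)).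
    apply: ge0_ler_powR; rewrite ?nnegrE ?(ltW Qt0) ?PhiM//.
    exact: le_trans sup_const_ge1.
  by apply: ler_powR => //; exact: sup_const_ge1.
have -> : M1 `^ vM * Lam `^ eta * (t^-1 * log_decay t `^ eta) =
  (Lam `^ eta * log_decay t `^ eta) * (t^-1 * M1 `^ vM) by ring.
apply: ler_pM => //; first exact: ltW.
  by rewrite mulr_ge0 ?powR_ge0 ?(ltW ti).
by rewrite ler_pM2l.
Qed.

Context (N : R -> \bar R) (N0 : forall t, (0 <= N t)%E)
  (HN : forall t, 0 < t -> (N (Lam * t)%R <= C0%:E * tail t)%E).

Let value_le t : 0 < t -> `|(p t)^-1 - E t| * `|ln t| <= Cp ->
  ((t `^ ((p t)^-1 - beta))%:E * N t <=
   series_const%:E * \sum_(k <oo) (x ^+ k * u k t)%:E)%E.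
Proof.
move=> t0 gp; have tau0 : 0 < t / Lam by rewrite divr_gt0.
have := HN tau0; rewrite mulrC divfK ?gt_eqF// => Nt.
have S0 : (0 <= \sum_(k <oo) (x ^+ k * u k t)%:E)%E.
  by apply: nneseries_ge0 => k _ _; rewrite lee_fin mulr_ge0// exprn_ge0//; case/andP: xle.
have T0 : (0 <= tail (t / Lam))%E.
  by apply: nneseries_ge0 => k _ _; rewrite mule_ge0// lee_fin powR_ge0.
have te : t `^ ((p t)^-1 - beta) <= expR Cp * t `^ (E t - beta).
  apply: powR_near => //; rewrite (_ : _ - _ - _ = (p t)^-1 - E t)//; ring.
apply: (@le_trans _ _ ((expR Cp * t `^ (E t - beta))%:E * (C0%:E * tail (t / Lam)))%E).
  by apply: lee_pmul => //; rewrite lee_fin ?powR_ge0.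
rewrite EFinM [leLHS](_ : _ = (C0%:E * (expR Cp)%:E) * ((t `^ (E t - beta))%:E * tail (t / Lam)))%E; last first.
  by rewrite muleCA -!muleA; congr (_ * _)%E; rewrite muleCA.
rewrite /series_const !EFinM -!muleA muleA.
apply: (@le_trans _ _ (C0%:E * (expR Cp)%:E * ((Lam `^ eM)%:E * \sum_(k <oo) (x ^+ k * u k t)%:E))%E); last first.
  by rewrite !muleA.
by apply: lee_wpmul2l; [rewrite -EFinM lee_fin mulr_ge0 ?expR_ge0 ?(ltW C00)|exact: tail_le].
Qed.

(** Write [X] for [t^(1/u) N(t)]. If [X] is below [log_decay t], then [X^v] is integrable against
    [dt/t]. Otherwise [v] may be replaced by [V], and [X^V = X^(V - Q) X^Q] where [Q <= V]: the
    first factor is bounded, the second is controlled by the largest of the [u k t], hence by the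
    sum of their powers. *)
Let pointwise t : 0 < t ->
  [/\ `|(p t)^-1 - E t| * `|ln t| <= Cp, `|q t - Q t| * `|ln t| <= Cq,
      `|v t - V t| * `|ln t| <= Cv & [/\ qm <= q t, q t <= v t & v t <= vM]] ->
  ((t `^ (v t * ((p t)^-1 - beta) - 1))%:E * N t `^ v t <=
   (power_weight qm 1 (2 * qm) t)%:E + power_const%:E *
   \sum_(k <oo) (y ^+ k * (b ^+ k / Lam * f (b ^+ k / Lam * t) +
    jump_const * power_weight eta 1 (2 * eta) t))%:E)%E.
Proof.
move=> t0 [gp gq gv [qmq qv vvM]]; have sc0 := series_const_ge0.
have ix0 := inv_tail_gap_gt0; have vb1 := value_bound_ge1; have pc0 := power_const_gt0.
set S := (\sum_(k <oo) (x ^+ k * u k t)%:E)%E.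
have SM : (S <= (M1 / (1 - x))%:E)%E by exact: sum_u.
have S0 : (0 <= S)%E.
  by apply: nneseries_ge0 => k _ _; rewrite lee_fin mulr_ge0// exprn_ge0//; case/andP: xle.
have XS := value_le t0 gp; rewrite -/S in XS.
set e := (p t)^-1 - beta in XS *.
have te0 : 0 < t `^ e by rewrite powR_gt0.
have XM : ((t `^ e)%:E * N t <= (series_const * (M1 / (1 - x)))%:E)%E.
  by apply: (le_trans XS); rewrite (EFinM _ (_ / _)); apply: lee_wpmul2l.
have Nfin : N t = (fine (N t))%:E.
  rewrite fineK// ge0_fin_numE// ltey; apply/eqP => Noo.
  by move: XM; rewrite Noo gt0_muley ?lte_fin.
set n0 := fine (N t) in Nfin; have n00 : 0 <= n0 by exact: fine_ge0.
rewrite Nfin -EFinM lee_fin in XM; rewrite Nfin -EFinM in XS.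
rewrite Nfin poweR_EFin -EFinM poweR_shift//.
set X := t `^ e * n0 in XM XS *; have X0 : 0 <= X by rewrite mulr_ge0// ltW.
have XM6 : X <= value_bound by apply: (le_trans XM); rewrite lerDr.
have vt0 : 0 < v t by apply: lt_le_trans qv; exact: lt_le_trans qmq.
have ti : 0 < t^-1 by rewrite invr_gt0.
have [Qa Qb] := andP (Qbounds t); have [QV1 QV2] := andP (QV t).
have Qt0 : 0 < Q t by exact: lt_le_trans Qa.
pose T := (\sum_(k <oo) (u k t `^ Q t)%:E)%E.
have T0 : (0 <= T)%E by apply: nneseries_ge0 => k _ _; rewrite lee_fin powR_ge0.
apply: (@le_trans _ _ ((t^-1 * log_decay t `^ qm)%:E + power_const%:E * (t^-1%:E * T))%E); last first.
  rewrite log_decay_powR//; apply: leeD2l; apply: lee_wpmul2l; first by rewrite lee_fin ltW.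
  rewrite -nneseriesZl; last by move=> k _; rewrite lee_fin powR_ge0.
  apply: lee_nneseries => k *; first by rewrite -EFinM lee_fin mulr_ge0 ?powR_ge0 ?(ltW ti).
  by rewrite -EFinM lee_fin; exact: term_le.
have ld0 : 0 <= t^-1 * log_decay t `^ qm by rewrite mulr_ge0 ?powR_ge0 ?(ltW ti).
case eT : T T0 => [T1| |//] T0; last first.
  by rewrite gt0_muley ?lte_fin// gt0_muley ?lte_fin// addey ?leey// -ltNye ltNyr.
rewrite -!EFinM -EFinD lee_fin mulrCA -mulrDr ler_pM2l//.
have uT k : u k t `^ Q t <= T1.
  rewrite -lee_fin -eT /T.
  by apply: (nneseries_ge_term (u := fun k => (u k t `^ Q t)%:E)) => i; rewrite lee_fin powR_ge0.
have T10 : 0 <= T1 by rewrite lee_fin in T0.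
have ST := nneseries_geometric_powR Qt0 xle (u0 ^~ t) T10 uT.
have XT : X <= series_const / (1 - x) * T1 `^ (Q t)^-1.
  rewrite -lee_fin; apply: (le_trans XS).
  apply: (@le_trans _ _ (series_const%:E * (T1 `^ (Q t)^-1 / (1 - x))%:E)%E).
    by apply: lee_wpmul2l.
  by rewrite -EFinM lee_fin mulrA mulrAC.
have sx0 : 0 <= series_const / (1 - x) by rewrite mulr_ge0// ltW.
have [Xs|Xl] := ltP X (log_decay t).
  rewrite -[leLHS]addr0; apply: lerD; last by rewrite mulr_ge0// ltW.
  apply: (@le_trans _ _ (log_decay t `^ v t)).
    by apply: ge0_ler_powR; rewrite ?nnegrE ?(ltW vt0) ?(ltW Xs) ?(ltW (log_decay_gt0 t)).
  apply: ger_powR; first by rewrite log_decay_gt0 log_decay_le1.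
  exact: le_trans qv.
have X0' : 0 < X by apply: lt_le_trans Xl; exact: log_decay_gt0.
rewrite -[leLHS]add0r; apply: lerD; first exact: powR_ge0.
have dv : `|v t - V t| <= vM.
  rewrite ler_norml; move: qm0 Qa QV1 QV2 vt0 vvM; move: (Q t) (V t) (v t) => a1 a2 a3 *.
  by apply/andP; split; lra.
apply: (le_trans (powR_exponent_change value_bound_ge1 XM6 Xl gv dv)).
rewrite /power_const -(mulrA _ _ T1) -(mulrA _ _ (_ * T1)) ler_wpM2l ?addr_ge0 ?powR_ge0 ?expR_ge0//.
have -> : X `^ V t = X `^ (V t - Q t) * X `^ Q t.
  by rewrite -powRD ?(gt_eqF X0') ?implybT// subrK.
apply: ler_pM; rewrite ?powR_ge0//.
  apply: (@le_trans _ _ (value_bound `^ (V t - Q t))).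
    by apply: ge0_ler_powR; rewrite ?nnegrE ?subr_ge0 ?(le_trans ler01 value_bound_ge1).
  by apply: ler_powR => //; move: Qt0 QV2; move: (Q t) (V t) => *; lra.
apply: (@le_trans _ _ ((series_const / (1 - x) * T1 `^ (Q t)^-1) `^ Q t)).
  have r0 : 0 <= series_const / (1 - x) * T1 `^ (Q t)^-1 by rewrite (mulr_ge0 sx0) ?powR_ge0.
  by apply: ge0_ler_powR; rewrite ?nnegrE ?(ltW Qt0).
rewrite powRM ?powR_ge0// -powRrM mulVf ?(gt_eqF Qt0)// powRr1// ler_wpM2r//.
apply: (@le_trans _ _ ((1 + series_const / (1 - x)) `^ Q t)).
  by apply: ge0_ler_powR; rewrite ?nnegrE ?(ltW Qt0) ?(addr_ge0 ler01 sx0)// lerDr.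
by apply: ler_powR; rewrite ?lerDl.
Qed.

Let pos t : (`]0%R, +oo[%classic : set R) t -> 0 < t.
Proof. by rewrite /= in_itv/= andbT. Qed.

Let ck0 k : 0 < b ^+ k / Lam. Proof. by rewrite divr_gt0 ?exprn_gt0. Qed.

Let jc0 : 0 <= jump_const. Proof. by rewrite mulr_ge0 ?powR_ge0. Qed.

Let measurable_scaled_f k :
  measurable_fun (`]0%R, +oo[ : set R) (fun t => f (b ^+ k / Lam * t)).
Proof.
apply: (@measurable_comp _ _ _ _ _ _ (`]0%R, +oo[ : set R) f) => //.
  by move=> _ [t /pos t0 <-]; rewrite /= in_itv/= andbT mulr_gt0.
Qed.

Let integral_power_weight_pos a : 0 < a ->
  (\int[mu]_(t in `]0%R, +oo[) (power_weight a 1 (2 * a) t)%:E <=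
   (power_weight_mass a (2 * a))%:E)%E.
Proof.
move=> a0; have aa : 0 < a < 2 * a by rewrite a0/= ltr_pMl// ltr1n.
rewrite -(power_weight_massE aa); apply: ge0_subset_integral => //.
- by apply/measurable_EFinP; exact: measurable_power_weight.
- by move=> t _; rewrite lee_fin power_weight_ge0.
Qed.

Let term k t := y ^+ k * (b ^+ k / Lam * f (b ^+ k / Lam * t) +
    jump_const * power_weight eta 1 (2 * eta) t).

Let term0 k t : 0 < t -> 0 <= term k t.
Proof.
move=> t0; rewrite mulr_ge0 ?exprn_ge0 ?powR_ge0// addr_ge0//.
  by rewrite mulr_ge0 ?(ltW (ck0 k))// f0// mulr_gt0.
by rewrite mulr_ge0// power_weight_ge0.
Qed.

Let measurable_pw a e : measurable_fun (`]0%R, +oo[ : set R) (power_weight a 1 e).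
Proof. by apply/measurable_funTS; exact: measurable_power_weight. Qed.

Let measurable_term k : measurable_fun (`]0%R, +oo[ : set R) (term k).
Proof.
apply: measurable_funM => //; apply: measurable_funD.
  by apply: measurable_funM => //; exact: measurable_scaled_f.
by apply: measurable_funM => //; exact: measurable_pw.
Qed.

Let term_mass_ge0 : 0 <= modular_const + power_weight_mass qm (2 * qm) +
  jump_const * power_weight_mass eta (2 * eta).
Proof.
apply: addr_ge0; last by apply: mulr_ge0 => //; exact: power_weight_mass_ge0.
by apply: addr_ge0; [exact: ltW mc0|exact: power_weight_mass_ge0].
Qed.

(** The factor [b^k / Lam] is the Jacobian of the dilation, so the integral of the dilated [f] does
    not depend on [k] and only [y^k] remains. *)
Let integral_term k : (\int[mu]_(t in `]0%R, +oo[) (term k t)%:E <=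
  ((modular_const + power_weight_mass qm (2 * qm) +
    jump_const * power_weight_mass eta (2 * eta)) * y ^+ k)%:E)%E.
Proof.
have yk0 : 0 <= y ^+ k by rewrite exprn_ge0 ?powR_ge0.
have fk0 t : 0 < t -> 0 <= f (b ^+ k / Lam * t) by move=> t0; rewrite f0// mulr_gt0.
rewrite /term; under eq_integral do rewrite EFinM.
have mf' := measurable_scaled_f k; have mpw := measurable_pw eta (2 * eta).
rewrite ge0_integralZl//; last 2 first.
- apply/measurable_EFinP; apply: measurable_funD.
    by apply: measurable_funM => //; exact: measurable_scaled_f.
  by apply: measurable_funM => //; exact: measurable_pw.
- move=> t /pos t0; rewrite lee_fin addr_ge0//; last by rewrite mulr_ge0// power_weight_ge0.
  by rewrite mulr_ge0 ?(ltW (ck0 k))// fk0.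
rewrite [leRHS]EFinM muleC; apply: lee_wpmul2r; first by rewrite lee_fin.
under eq_integral do rewrite EFinD.
rewrite ge0_integralD//; last 4 first.
- by move=> t /pos t0; rewrite lee_fin mulr_ge0 ?(ltW (ck0 k))// fk0.
- by apply/measurable_EFinP; apply: measurable_funM => //; exact: measurable_scaled_f.
- by move=> t _; rewrite lee_fin mulr_ge0// power_weight_ge0.
- by apply/measurable_EFinP; apply: measurable_funM => //; exact: measurable_pw.
rewrite [leRHS]EFinD; apply: leeD.
  under eq_integral do rewrite EFinM.
  rewrite ge0_integralZl//; last 3 first.
  - by apply/measurable_EFinP; exact: measurable_scaled_f.
  - by move=> t /pos t0; rewrite lee_fin fk0.
  - by rewrite lee_fin ltW.
  have mEf : measurable_fun (`]0%R, +oo[ : set R) (EFin \o f).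
    by apply/measurable_EFinP; exact: measurable_f.
  have Ef0 t : 0 < t -> (0 <= (EFin \o f) t)%E by move=> t0; rewrite lee_fin f0.
  rewrite (ge0_integral_scale (ck0 k) mEf Ef0).
  rewrite muleA -EFinM divff ?(gt_eqF (ck0 k))// mul1e; exact: integral_f.
under eq_integral do rewrite EFinM.
rewrite ge0_integralZl//; last 2 first.
- by apply/measurable_EFinP; exact: measurable_pw.
- by move=> t _; rewrite lee_fin power_weight_ge0.
rewrite (EFinM jump_const); apply: lee_wpmul2l; first by rewrite lee_fin.
exact: integral_power_weight_pos.
Qed.

Let dominant t : \bar R := ((power_weight qm 1 (2 * qm) t)%:E +
    power_const%:E * \sum_(k <oo) (term k t)%:E)%E.

Let dominant_ge0 t : 0 < t -> (0 <= dominant t)%E.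
Proof.
move=> t0; rewrite adde_ge0 ?mule_ge0 ?lee_fin ?power_weight_ge0 ?(ltW power_const_gt0)//.
by apply: nneseries_ge0 => k _ _; rewrite lee_fin term0.
Qed.

Let measurable_series :
  measurable_fun (`]0%R, +oo[ : set R) (fun t => \sum_(k <oo) (term k t)%:E)%E.
Proof.
apply: ge0_emeasurable_sum => [k t /pos t0 _|k _]; first by rewrite lee_fin term0.
by apply/measurable_EFinP; exact: measurable_term.
Qed.

Let measurable_dominant : measurable_fun (`]0%R, +oo[ : set R) dominant.
Proof.
apply: emeasurable_funD; last exact: measurable_funeM.
by apply/measurable_EFinP; exact: measurable_pw.
Qed.

Let integral_dominant : (\int[mu]_(t in `]0%R, +oo[) dominant t <= total_mass%:E)%E.
Proof.
have qm00 := qm0; have ms := measurable_series; have pc0 := power_const_gt0.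
have s0 t : 0 < t -> (0 <= \sum_(k <oo) (term k t)%:E)%E.
  by move=> t0; apply: nneseries_ge0 => k _ _; rewrite lee_fin term0.
rewrite ge0_integralD//; last 4 first.
- by move=> t _; rewrite lee_fin power_weight_ge0.
- by apply/measurable_EFinP; exact: measurable_pw.
- by move=> t /pos t0; rewrite mule_ge0 ?s0// lee_fin ltW.
- exact: measurable_funeM.
rewrite /total_mass EFinD; apply: leeD; first exact: integral_power_weight_pos.
rewrite ge0_integralZl//; last 2 first.
- by move=> t /pos t0; exact: s0.
- by rewrite lee_fin ltW.
rewrite (EFinM power_const); apply: lee_wpmul2l; first by rewrite lee_fin ltW.
rewrite integral_nneseries//; last 2 first.
- by move=> k; apply/measurable_EFinP; exact: measurable_term.
- by move=> k t /pos t0; rewrite lee_fin term0.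
have y1 : 0 <= y < 1 by case/andP: y01 => /ltW -> ->.
apply: le_trans (nneseries_geometric_le _ y1); last first.
  exact: term_mass_ge0.
apply: lee_nneseries => k *; last exact: integral_term.
by apply: integral_ge0 => t /pos t0; rewrite lee_fin term0.
Qed.

Lemma modular_rhs_le : (modular_rhs N <= total_mass%:E)%E.
Proof.
apply: le_trans integral_dominant; apply: ae_le_ge0_integral.
- by move=> t _; rewrite mule_ge0 ?poweR_ge0// lee_fin powR_ge0.
- by move=> t /pos; exact: dominant_ge0.
by apply: ae_impl good => t gt /pos t0; apply: pointwise => //; exact: gt.
Qed.

Let tm0 : 0 <= total_mass.
Proof.
apply: addr_ge0; first exact: power_weight_mass_ge0.
apply: mulr_ge0; first exact: ltW power_const_gt0.
apply: mulr_ge0; [exact: term_mass_ge0|exact: ltW inv_term_gap_gt0].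
Qed.

Lemma one_dimensional_const_gt0 : 0 < one_dimensional_const.
Proof. by rewrite powR_gt0// (lt_le_trans ltr01)// lerDl. Qed.

Lemma modular_rhs_scaled_le1 :
  (modular_rhs (fun t => (one_dimensional_const^-1)%:E * N t) <= 1)%E.
Proof.
have tm := tm0; have qi0 : 0 <= qm^-1 by rewrite invr_ge0 ltW.
have K1 : 1 <= one_dimensional_const.
  have -> : 1 = 1 `^ qm^-1 :> R by rewrite powR1.
  by apply: ge0_ler_powR; rewrite ?nnegrE ?lerDl ?(addr_ge0 ler01 tm).
have K0 : 0 < one_dimensional_const by exact: lt_le_trans K1.
have ki0 : 0 < one_dimensional_const^-1 by rewrite invr_gt0.
have ki1 : one_dimensional_const^-1 <= 1 by rewrite invf_le1.
have tm1 : 0 <= 1 + total_mass by exact: addr_ge0 tm.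
have Kq : one_dimensional_const^-1 `^ qm = (1 + total_mass)^-1.
  rewrite -(powR_inv1 (ltW K0)) -powRrM mulrC powRrM /one_dimensional_const.
  by rewrite -(powRrM _ _ qm) mulVf ?(gt_eqF qm0)// powRr1// powR_inv1.
apply: (@le_trans _ _ (((1 + total_mass)^-1)%:E * total_mass%:E)%E); last first.
  by rewrite -EFinM lee_fin mulrC ler_pdivrMr ?ltr_pwDl// mul1r lerDr.
apply: (@le_trans _ _ (((1 + total_mass)^-1)%:E *
    \int[mu]_(t in `]0%R, +oo[) dominant t)%E); last first.
  by apply: lee_wpmul2l; [rewrite lee_fin invr_ge0|exact: integral_dominant].
rewrite -ge0_integralZl//; last 2 first.
- by move=> t /pos t0; exact: dominant_ge0.
- by rewrite lee_fin invr_ge0.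
apply: ae_le_ge0_integral.
- by move=> t _; rewrite mule_ge0 ?poweR_ge0// lee_fin powR_ge0.
- by move=> t /pos t0; rewrite mule_ge0 ?dominant_ge0// lee_fin invr_ge0.
apply: ae_impl good => t gt /pos t0; have [_ _ _ [qmq qv _]] := gt t0.
have vt0 : qm <= v t by exact: le_trans qv.
rewrite poweRM ?lee_fin ?(ltW ki0)// poweR_EFin muleCA.
apply: lee_pmul.
- by rewrite lee_fin powR_ge0.
- by rewrite mule_ge0 ?poweR_ge0// lee_fin powR_ge0.
- by rewrite lee_fin -Kq; apply: ger_powR => //; rewrite ki0 ki1.
- by apply: pointwise => //; exact: gt.
Qed.

End bound.
End one_dimensional_estimate.

(** * Gamma integrals and the kernel *)

Section gamma_integrals.
Context {R : realType}.
Local Notation mu := (@lebesgue_measure R).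

(** The Gamma function. *)
Definition gamma_mass (k : R) : R := fine (\int[mu]_t (gamma_weight k t * expR (- t))%:E).

Lemma measurable_gamma_density (k l : R) :
  measurable_fun setT (fun t => gamma_weight k t * expR (- (l * t))).
Proof.
apply: measurable_funM; first exact: measurable_gamma_weight.
apply: (measurableT_comp (@measurable_expR R)); apply: measurable_funN.
exact: measurable_funM.
Qed.

Lemma gamma_massE (k : R) : 0 < k ->
  (\int[mu]_t (gamma_weight k t * expR (- t))%:E = (gamma_mass k)%:E)%E.
Proof.
move=> k0; rewrite fineK// ge0_fin_numE; last first.
  by apply: integral_ge0 => t _; rewrite lee_fin mulr_ge0 ?gamma_weight_ge0 ?expR_ge0.
have [C C1 HC] := exp_powR_le ltr01 (ltW (truncnS_gt (k + 1))).
have C0 : 0 <= C by exact: le_trans C1.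
have kk : 0 < k < k + 1 by rewrite k0 ltrDl ltr01.
apply: (@le_lt_trans _ _ (\int[mu]_t (C%:E * (power_weight k 1 (k + 1) t)%:E))%E); last first.
  rewrite ge0_integralZl//; last 2 first.
  - by apply/measurable_EFinP; exact: measurable_power_weight.
  - by move=> t _; rewrite lee_fin power_weight_ge0.
  by rewrite (power_weight_massE kk) -EFinM ltry.
apply: ge0_le_integralW => t _.
  by rewrite lee_fin mulr_ge0 ?gamma_weight_ge0 ?expR_ge0.
rewrite -EFinM lee_fin /gamma_weight /power_weight; case: ifPn => [t0|_]; last by rewrite mul0r mulr0.
rewrite mulrCA ler_wpM2l ?powR_ge0//; have [t1|t1] := leP t 1.
  by rewrite powR1 mulr1; apply: le_trans C1; rewrite expR_le1 oppr_le0 ltW.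
by have := HC t (ltW t1); rewrite mul1r.
Qed.

Lemma gamma_mass_gt0 (k : R) : 0 < k -> 0 < gamma_mass k.
Proof.
move=> k0; rewrite -lte_fin -gamma_massE//.
pose c : R := (2 `^ `|k - 1|)^-1 * expR (- 2).
have c0 : 0 < c by rewrite mulr_gt0 ?expR_gt0// invr_gt0 powR_gt0.
apply: (@lt_le_trans _ _ (\int[mu]_t (c * \1_(`]1%R, 2%R[ : set R) t)%:E)%E).
  under eq_integral do rewrite EFinM.
  rewrite ge0_integralZl//; last 2 first.
  - by apply/measurable_EFinP; exact: measurable_indic.
  - by rewrite lee_fin ltW.
  rewrite integral_indic//= setIT -[X in (_ * X)%E]/(mu `]1%R, 2%R[%classic).
  rewrite lebesgue_measure_itv/= lte_fin ltr1n -EFinB -EFinM lte_fin.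
  by apply: mulr_gt0 => //; lra.
apply: ge0_le_integralW => t _; first by rewrite lee_fin mulr_ge0 ?(ltW c0).
rewrite lee_fin indicE; have [/set_mem|_] := boolP (t \in _); last first.
  by rewrite mulr0 mulr_ge0 ?gamma_weight_ge0 ?expR_ge0.
rewrite /= in_itv/= => /andP[t1 t2]; have t0 : 0 < t by exact: lt_trans t1.
rewrite mulr1 /gamma_weight t0; apply: ler_pM; rewrite ?invr_ge0 ?powR_ge0 ?expR_ge0//; last first.
  by rewrite ler_expR lerN2 ltW.
rewrite -[leRHS]invrK lef_pV2 ?posrE ?invr_gt0 ?powR_gt0// -powRN -normrN.
by apply: powR_bounded_ratio; rewrite (ltW t2) andbT (le_trans _ (ltW t1))// invf_le1 ?ler1n.
Qed.

Lemma gamma_integral_scale (k l : R) : 0 < k -> 0 < l ->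
  (\int[mu]_t (gamma_weight k t * expR (- (l * t)))%:E =
   (l `^ (- k) * gamma_mass k)%:E)%E.
Proof.
move=> k0 l0; have := @ge0_integral_affine R l 0
  (fun t => (gamma_weight k t * expR (- t))%:E) l0.
have mg : measurable_fun setT (fun t : R => (gamma_weight k t * expR (- t))%:E).
  apply/measurable_EFinP; have := measurable_gamma_density k 1.
  by congr (measurable_fun _ _); apply/funext => t; rewrite mul1r.
have g0 t : (0 <= (gamma_weight k t * expR (- t))%:E)%E.
  by rewrite lee_fin mulr_ge0 ?gamma_weight_ge0 ?expR_ge0.
move=> /(_ mg g0); rewrite gamma_massE// => h.
have e : (\int[mu]_t (gamma_weight k (l * t + 0) * expR (- (l * t + 0)))%:E =
    (l `^ (k - 1))%:E * \int[mu]_t (gamma_weight k t * expR (- (l * t)))%:E)%E.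
  rewrite -ge0_integralZl//; last 3 first.
  - by apply/measurable_EFinP; exact: measurable_gamma_density.
  - by move=> t _; rewrite lee_fin mulr_ge0 ?gamma_weight_ge0 ?expR_ge0.
  - by rewrite lee_fin powR_ge0.
  apply: eq_integral => t _; rewrite addr0 -EFinM mulrA; congr (_ * _)%:E.
  rewrite /gamma_weight pmulr_rgt0//; case: ifPn => [t0|_]; last by rewrite mulr0.
  by rewrite powRM ?ltW.
have kk : ((l `^ (1 - k))%:E * (l `^ (k - 1))%:E = 1)%E.
  by rewrite -EFinM -powRD ?(gt_eqF l0) ?implybT// addrC subrKA subrr powRr0.
rewrite -[LHS]mul1e -kk -muleA -e h -!EFinM mulrA; congr (_ * _)%:E.
rewrite -(powR_inv1 (ltW l0)) -powRD ?(gt_eqF l0) ?implybT//; congr (_ `^ _); ring.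
Qed.

Lemma integral_gauss_scale (t c : R) : 0 < t ->
  (\int[mu]_u (expR (- (t * (u - c) ^+ 2)))%:E = (t `^ (- 2^-1) * Num.sqrt pi)%:E)%E.
Proof.
move=> t0; have s0 : 0 < Num.sqrt t by rewrite sqrtr_gt0.
have mg : measurable_fun setT (EFin \o @gauss_fun R).
  by apply/measurable_EFinP; exact: measurable_gauss_fun.
have := ge0_integral_affine (- (Num.sqrt t * c)) s0 mg (fun x => gauss_fun_ge0 x).
rewrite integralT_gauss -EFinM powRN (powR12_sqrt (ltW t0)) => <-.
apply: eq_integral => u _; congr (expR (- _))%:E.
by rewrite -mulrBr exprMn sqr_sqrtr// ltW.
Qed.

Lemma integral_gauss_rn n (t : R) (c : 'cV[R]_n) : 0 < t ->
  (\int[lebesgue_rn n]_x (expR (- (t * sqnorm (x - c))))%:E =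
   ((t `^ (- 2^-1) * Num.sqrt pi) ^+ n)%:E)%E.
Proof.
move=> t0.
rewrite (_ : (fun x : 'cV[R]_n => _) = fun x : 'cV[R]_n =>
   (\prod_i expR (- (t * (x i ord0 - c i ord0) ^+ 2)))%:E); last first.
  apply/funext => x; rewrite -expR_sum sumrN -mulr_sumr; congr (expR (- (_ * _)))%:E.
  by apply: eq_bigr => i _; rewrite !mxE.
rewrite (integral_rn_prod (f := fun i u => expR (- (t * (u - c i ord0) ^+ 2)))
  (c := fun=> t `^ (- 2^-1) * Num.sqrt pi)).
- by rewrite prodr_const card_ord.
- move=> i; apply: (measurableT_comp (@measurable_expR R)); apply: measurable_funN.
  by apply: measurable_funM => //; apply: measurable_funX; exact: measurable_funB.
- by move=> *; exact: expR_ge0.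
- by move=> i; exact: integral_gauss_scale.
Qed.

End gamma_integrals.

Section kernel_representation.
Context {R : realType} (n m : nat) (alpha : R).
Context (a : 'I_m -> R) (A : 'I_m -> 'M[R]_n).
Context (hn : (0 < n)%N) (halpha : 0 <= alpha < n%:R) (hm : 1 - alpha / n%:R < m%:R)
  (ha : forall i, 0 < a i) (hasum : \sum_i a i = n%:R - alpha)
  (hA : forall i, A i *m (A i)^T = 1%:M)
  (hA0 : alpha = 0 -> forall i j, i != j -> A i - A j \in unitmx).
Implicit Types (x y z : 'cV[R]_n) (s : 'cV[R]_m).
Local Notation pole := (pole A).
Local Notation dispersion := (dispersion A).
Local Notation weight := (weight a).
Local Notation kernel := (rough_kernel a A).

Definition kernel_density x y s : R :=
  weight s * expR (- \sum_l s l ord0 * sqnorm (x - A l *m y)).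

Lemma kernel_density_ge0 x y s : 0 <= kernel_density x y s.
Proof. by rewrite mulr_ge0 ?weight_ge0 ?expR_ge0. Qed.

Lemma kernel_densityE x y s : kernel_density x y s =
  \prod_l (gamma_weight (a l / 2) (s l ord0) *
           expR (- (sqnorm (x - A l *m y) * s l ord0))).
Proof.
rewrite /kernel_density -sumrN expR_sum -big_split; apply: eq_bigr => l _ /=.
by rewrite [_ * sqnorm _]mulrC.
Qed.

Lemma measurable_sqdist l : measurable_fun setT
  (fun p : 'cV[R]_n * 'cV[R]_n => sqnorm (p.1 - A l *m p.2)).
Proof.
apply: measurable_sum => i; apply: measurable_funX.
rewrite (_ : (fun p : 'cV[R]_n * 'cV[R]_n => _) = fun p : 'cV[R]_n * 'cV[R]_n =>
    p.1 i ord0 - (A l *m p.2) i ord0); last by apply/funext => p; rewrite !mxE.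
apply: measurable_funB.
  by apply: (measurableT_comp (measurable_coord i)); exact: measurable_fst.
apply: (measurableT_comp (measurable_coord i)).
by apply: (measurableT_comp (measurable_mulmx (A l))); exact: measurable_snd.
Qed.

Lemma measurable_kernel_density : measurable_fun setT
  (fun p : ('cV[R]_n * 'cV[R]_n) * 'cV[R]_m => kernel_density p.1.1 p.1.2 p.2).
Proof.
have ms l : measurable_fun setT (fun p : ('cV[R]_n * 'cV[R]_n) * 'cV[R]_m => p.2 l ord0).
  by apply: (measurableT_comp (measurable_coord l)); exact: measurable_snd.
apply: measurable_funM.
  apply: measurable_prod => l _.
  by apply: (measurableT_comp (measurable_gamma_weight (a l / 2))); exact: ms.
apply: (measurableT_comp (@measurable_expR R)); apply: measurable_funN.
apply: measurable_sum => l; apply: measurable_funM; first exact: ms.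
by apply: (measurableT_comp (measurable_sqdist l)); exact: measurable_fst.
Qed.

Lemma rough_kernel_ge0 x y : 0 <= kernel x y.
Proof. by apply: prodr_ge0 => l _; exact: powR_ge0. Qed.

Lemma rough_kernelE x y : kernel x y = \prod_l sqnorm (x - A l *m y) `^ (- (a l / 2)).
Proof.
apply: eq_bigr => l _; rewrite enormE -powR12_sqrt ?sqnorm_ge0// -powRrM.
by congr (_ `^ _); field.
Qed.

Lemma measurable_rough_kernel :
  measurable_fun setT (fun p : 'cV[R]_n * 'cV[R]_n => kernel p.1 p.2).
Proof.
under eq_fun do rewrite rough_kernelE.
apply: measurable_prod => l _.
apply: (@measurableT_comp _ _ _ _ _ _ (@powR R ^~ (- (a l / 2)))) => //.
exact: measurable_sqdist.
Qed.

Let a20 l : 0 < a l / 2. Proof. by rewrite divr_gt0. Qed.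

Lemma op_normalization_gt0 : 0 < op_normalization a.
Proof. by apply: prodr_gt0 => l _; exact: gamma_mass_gt0. Qed.

Lemma kernel_density_integral x y : (forall l, x != A l *m y) ->
  (\int[lebesgue_rn m]_s (kernel_density x y s)%:E =
   (op_normalization a * kernel x y)%:E)%E.
Proof.
move=> xy; under eq_integral do rewrite kernel_densityE.
rewrite (integral_rn_prod (f := fun l t => gamma_weight (a l / 2) t *
    expR (- (sqnorm (x - A l *m y) * t)))
  (c := fun l => sqnorm (x - A l *m y) `^ (- (a l / 2)) * gamma_mass (a l / 2))).
- by rewrite big_split/= -rough_kernelE mulrC.
- by move=> l; exact: measurable_gamma_density.
- by move=> l t; rewrite mulr_ge0 ?gamma_weight_ge0 ?expR_ge0.
- move=> l; apply: gamma_integral_scale => //.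
  have [i xyi] : exists i, (x - A l *m y) i ord0 != 0.
    apply: contrapT => /forallNP h; case/eqP: (xy l); apply/eqP; rewrite -subr_eq0.
    apply/eqP/matrixP => i j; rewrite (ord1 j) [RHS]mxE.
    by apply/eqP/negPn/negP; exact: h.
  rewrite /sqnorm (bigD1 i)//= ltr_wpDr//; first by apply: sumr_ge0 => *; exact: sqr_ge0.
  by rewrite lt_neqAle sqr_ge0 andbT eq_sym sqrf_eq0.
Qed.

Lemma kernel_le_density_integral x y :
  ((op_normalization a * kernel x y)%:E <= \int[lebesgue_rn m]_s (kernel_density x y s)%:E)%E.
Proof.
have [|/existsNP[l /negP/negPn/eqP xy]] := pselect (forall l, x != A l *m y).
  by move=> /kernel_density_integral ->.
(* At a pole one factor is 0 raised to a nonzero power, which is 0 by convention. *)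
rewrite [leLHS](_ : _ = 0%E); last first.
  rewrite rough_kernelE (bigD1 l)//= xy subrr [sqnorm _](_ : _ = 0).
    by rewrite powR0 ?mul0r ?mulr0// oppr_eq0 gt_eqF.
  by rewrite /sqnorm big1// => i _; rewrite mxE expr0n.
by apply: integral_ge0 => s _; rewrite lee_fin kernel_density_ge0.
Qed.

(** A cube with a ball about the origin removed: bounded, and kept away from the point where the
    poles merge. *)
Definition annulus (r k : R) : set 'cV[R]_n :=
  box (fun=> - k) (fun=> k) `&` [set x | r <= enorm x].

Lemma measurable_enorm : measurable_fun setT (fun x : 'cV[R]_n => enorm x).
Proof.
rewrite (_ : (fun x => _) = fun x : 'cV[R]_n => (sqnorm x) `^ 2^-1); last first.
  by apply/funext => x; rewrite enormE powR12_sqrt ?sqnorm_ge0.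
apply: (@measurableT_comp _ _ _ _ _ _ (@powR R ^~ 2^-1)) => //.
apply: measurable_sum => i; apply: measurable_funX; exact: measurable_coord.
Qed.

Lemma measurable_annulus r k : measurable (annulus r k).
Proof.
apply: measurableI; first exact: measurable_box.
rewrite -[X in measurable X]setTI; apply: measurable_fun_ler => //.
exact: measurable_enorm.
Qed.

(** Half of the exponent keeps the dispersion, the other half is a Gaussian in [x] about [A i *m y]
    whose mass is of order [s_i^(-n/2)]: this is the input of [distributed_decay]. When [s i <= S],
    the integrand is at most 1 on a bounded set. *)
Lemma density_gaussian_le (r k : R) i : 0 < r -> 0 <= k ->
  exists mu : 'I_m -> R, exists2 C : R, 0 <= C &
   (forall l, 0 < a l / 2 < mu l) /\
   forall y s, max_at s i ->
   (\int[lebesgue_rn n]_(x in annulus r k)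
      (expR (- \sum_l s l ord0 * sqnorm (x - A l *m y)))%:E <=
    (C * \prod_l Num.max (s l ord0) (r `^ (- 2)) `^ (- mu l))%:E)%E.
Proof.
move=> r0 k0; have [mu [E [C [C0 amu _ HC]]]] := distributed_decay hn halpha hm ha hasum hA0 i.
set S := r `^ (- 2) in HC *; have S0 : 0 < S by rewrite powR_gt0.
pose g := (2 `^ 2^-1 * Num.sqrt pi) ^+ n : R.
have g0 : 0 <= g by rewrite exprn_ge0// mulr_ge0 ?powR_ge0 ?sqrtr_ge0.
exists mu, (C * S `^ E * g + (2 * k) ^+ n * S `^ (\sum_l mu l)).
  by rewrite addr_ge0// !mulr_ge0 ?powR_ge0 ?(ltW C0)// exprn_ge0// mulr_ge0.
split=> // y s si; have s0 := si.1; have si0 := s0 i.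
set P := \prod_l _; have P0 : 0 <= P by apply: prodr_ge0 => l _; exact: powR_ge0.
have mD := measurable_annulus r k.
have sum_ge x : s i ord0 * sqnorm (x - A i *m y) <= \sum_l s l ord0 * sqnorm (x - A l *m y).
  rewrite (bigD1 i)//= lerDl; apply: sumr_ge0 => l _.
  by rewrite mulr_ge0 ?sqnorm_ge0// ltW.
have sum_disp x : dispersion x s <= \sum_l s l ord0 * sqnorm (x - A l *m y).
  under eq_bigr do rewrite sqnorm_pole//.
  rewrite (gaussian_product A x y (total_gt0 si)) lerDr mulr_ge0 ?sqnorm_ge0//.
  exact: ltW (total_gt0 si).
rewrite mulrDl EFinD; have [sS|Ss] := leP (s i ord0) S.
  apply: (@le_trans _ _ ((2 * k) ^+ n * S `^ (\sum_l mu l) * P)%:E); last first.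
    by rewrite leeDr// lee_fin !mulr_ge0// ?powR_ge0// ltW.
  have -> : P = S `^ (- \sum_l mu l).
    rewrite -sumrN -prod_powR//; apply: eq_bigr => l _; congr (_ `^ _).
    by apply/max_idPr; exact: le_trans (si.2 l) sS.
  rewrite -mulrA -powRD ?(gt_eqF S0) ?implybT// subrr powRr0 mulr1.
  apply: (@le_trans _ _ (\int[lebesgue_rn n]_(x in annulus r k) (cst 1 x))%E).
    apply: ge0_le_integralW => x _; rewrite lee_fin ?expR_ge0// expR_le1 oppr_le0.
    by apply: le_trans (sum_ge x); rewrite mulr_ge0 ?sqnorm_ge0// ltW.
  rewrite integral_cst// mul1e; apply: (@le_trans _ _ (lebesgue_rn n (box (fun=> - k) (fun=> k)))).
    by apply: le_lebesgue_rnW; exact: subIsetl.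
  rewrite lebesgue_rn_box; last by move=> _; rewrite ge0_cp.
  by rewrite prodr_const card_ord lee_fin opprK -mulr2n mulr_natl.
apply: (@le_trans _ _ (C * S `^ E * g * P)%:E); last first.
  by rewrite leeDl// lee_fin !mulr_ge0 ?exprn_ge0 ?mulr_ge0 ?powR_ge0.
pose B := C * S `^ E * P * s i ord0 `^ (n%:R / 2).
have B0 : 0 <= B by rewrite !mulr_ge0 ?powR_ge0 ?(ltW C0).
apply: (@le_trans _ _ (\int[lebesgue_rn n]_x
    (B%:E * (expR (- (s i ord0 / 2 * sqnorm (x - A i *m y))))%:E))%E).
  apply: (@le_trans _ _ (\int[lebesgue_rn n]_(x in annulus r k)
    (B%:E * (expR (- (s i ord0 / 2 * sqnorm (x - A i *m y))))%:E))%E); last first.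
    apply: ge0_subset_integral => //.
      apply: measurable_funeM; apply/measurable_EFinP.
      apply: (measurableT_comp (@measurable_expR R)); apply: measurable_funN.
      apply: measurable_funM => //.
      exact: (measurableT_comp (measurable_sqdist i) (measurable_pair2 y)).
    by move=> x _; rewrite mule_ge0// lee_fin expR_ge0.
  apply: ge0_le_integralW => x; first by rewrite lee_fin expR_ge0.
  move=> [_ /= rx]; rewrite -EFinM lee_fin.
  set T := \sum_l _.
  apply: (@le_trans _ _ (expR (- (dispersion x s / 2)) *
     expR (- (s i ord0 / 2 * sqnorm (x - A i *m y))))).
    rewrite -expRD ler_expR; have := sum_ge x; have := sum_disp x; rewrite -/T.
    move: T (dispersion x s) (s i ord0) (sqnorm _) => *; nra.
  rewrite ler_wpM2r ?expR_ge0// /B -ler_pdivrMr ?powR_gt0// -powRN.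
  by apply: HC => // _.
rewrite ge0_integralZl//; last first.
  apply/measurable_EFinP; apply: (measurableT_comp (@measurable_expR R)).
  apply: measurable_funN; apply: measurable_funM => //.
  exact: (measurableT_comp (measurable_sqdist i) (measurable_pair2 y)).
rewrite integral_gauss_rn ?divr_gt0// -EFinM lee_fin /B le_eqVlt; apply/orP; left; apply/eqP.
have -> : (s i ord0 / 2) `^ (- 2^-1) = s i ord0 `^ (- 2^-1) * 2 `^ 2^-1.
  rewrite powRM ?invr_ge0 ?(ltW si0)// -(powR_inv1 (ltW (ltr0Sn R 1))) -powRrM.
  by rewrite mulrN mulN1r opprK.
have sn : s i ord0 `^ (n%:R / 2) * (s i ord0 `^ (- 2^-1)) ^+ n = 1.
  rewrite -powR_mulrn ?powR_ge0// -powRrM -powRD ?(gt_eqF si0) ?implybT//.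
  by rewrite (_ : _ + _ = 0) ?powRr0//; ring.
rewrite -(mulrA (s i ord0 `^ _)) exprMn -/g.
transitivity (C * S `^ E * g * P * (s i ord0 `^ (n%:R / 2) * (s i ord0 `^ (- 2^-1)) ^+ n)).
  ring.
by rewrite sn mulr1.
Qed.

End kernel_representation.

(** * Absolute convergence of the integral operator *)

Section kernel_integrability.
Context {R : realType} (n m : nat) (alpha : R).
Context (a : 'I_m -> R) (A : 'I_m -> 'M[R]_n).
Context (hn : (0 < n)%N) (halpha : 0 <= alpha < n%:R) (hm : 1 - alpha / n%:R < m%:R)
  (ha : forall i, 0 < a i) (hasum : \sum_i a i = n%:R - alpha)
  (hA : forall i, A i *m (A i)^T = 1%:M)
  (hA0 : alpha = 0 -> forall i j, i != j -> A i - A j \in unitmx).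
Implicit Types (x y z : 'cV[R]_n) (s : 'cV[R]_m).
Local Notation kernel := (rough_kernel a A).
Local Notation density := (kernel_density a A).

Let na : 0 < n%:R - alpha. Proof. by rewrite subr_gt0; case/andP: halpha. Qed.

Lemma number_of_factors_gt0 : (0 < m)%N.
Proof.
case: (posnP m) => // m0; move: na; rewrite -hasum.
by case: {+}m a m0 => // a' _; rewrite big_ord0 ltxx.
Qed.

(** Tonelli in the Gamma representation: integrating in [x] first leaves weights that factor over
    the variables [s_l]. The bound is uniform in [y] because the Gaussian integral is insensitive to
    its centre. *)
Lemma kernel_integral_annulus (r k : R) : 0 < r -> 0 <= k ->
  exists2 C : R, 0 <= C & forall y,
    (\int[lebesgue_rn n]_(x in annulus r k) (kernel x y)%:E <= C%:E)%E.
Proof.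
move=> r0 k0; have m0 := number_of_factors_gt0.
have /choice[e He] : forall i, exists e : ('I_m -> R) * R, [/\ 0 <= e.2,
   forall l, 0 < a l / 2 < e.1 l & forall y s, max_at s i ->
   (\int[lebesgue_rn n]_(x in annulus r k)
      (expR (- \sum_l s l ord0 * sqnorm (x - A l *m y)))%:E <=
    (e.2 * \prod_l Num.max (s l ord0) (r `^ (- 2)) `^ (- e.1 l))%:E)%E].
  move=> i; have [mu [C C0 [amu H]]] :=
    density_gaussian_le hn halpha hm ha hasum hA hA0 i r0 k0.
  by exists (mu, C).
pose c i := (e i).2 * (r `^ (2 * (\sum_l (e i).1 l) - (n%:R - alpha)) * weight_mass a (e i).1).
have c0 i : 0 <= c i.
  by have [e0 _ _] := He i; rewrite !mulr_ge0 ?powR_ge0 ?weight_mass_ge0.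
have on0 := op_normalization_gt0 ha.
exists ((op_normalization a)^-1 * \sum_i c i).
  by rewrite mulr_ge0 ?invr_ge0 ?(ltW on0)// sumr_ge0.
move=> y; rewrite EFinM lee_pdivlMl//.
have mD := measurable_annulus r k : measurable (annulus r k : set 'cV[R]_n).
have mK : measurable_fun setT (fun x => kernel x y).
  exact: (measurableT_comp (measurable_rough_kernel a A) (measurable_pair2 y)).
rewrite -ge0_integralZl//; last 3 first.
- by apply/measurable_EFinP; exact: measurable_funTS.
- by move=> x _; rewrite lee_fin rough_kernel_ge0.
- by rewrite lee_fin ltW.
pose g (p : 'cV[R]_n * 'cV[R]_m) : \bar R := (density p.1 y p.2 * \1_(annulus r k) p.1)%:E.
have mg : measurable_fun setT g.
  apply/measurable_EFinP; apply: measurable_funM.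
    apply: (@measurableT_comp _ _ _ _ _ _ _ _
      (fun p : 'cV[R]_n * 'cV[R]_m => ((p.1, y), p.2)) (measurable_kernel_density a A)).
    apply: measurable_fun_pair; last exact: measurable_snd.
    by apply: measurable_fun_pair => //; exact: measurable_fst.
  have mI : measurable_fun setT (\1_(annulus r k) : 'cV[R]_n -> R).
    exact: measurable_indic.
  exact: (measurableT_comp mI measurable_fst).
have g0 p : (0 <= g p)%E by rewrite lee_fin mulr_ge0 ?kernel_density_ge0.
apply: (@le_trans _ _ (\int[lebesgue_rn n]_x \int[lebesgue_rn m]_s g (x, s))%E).
  rewrite integral_mkcond; apply: ge0_le_integralW => x _.
    rewrite patchE; case: ifP => // _.
    by rewrite -EFinM lee_fin mulr_ge0 ?(ltW on0) ?rough_kernel_ge0.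
  rewrite patchE; case: ifPn => [xD|_]; last exact: integral_ge0.
  rewrite -EFinM; apply: (le_trans (kernel_le_density_integral A ha x y)).
  by apply: ge0_le_integralW => s _; rewrite lee_fin ?kernel_density_ge0// /g/= indicE xD mulr1.
rewrite (fubini_tonelli g mg g0).
apply: (@le_trans _ _ (\int[lebesgue_rn m]_s
    \sum_i ((e i).2%:E * (weight_product a (e i).1 r s)%:E))%E).
  apply: ge0_le_integralW => s _; first exact: integral_ge0.
  have sum0 : (0 <= \sum_i ((e i).2%:E * (weight_product a (e i).1 r s)%:E))%E.
    apply: sume_ge0 => i _; have [e0 _ _] := He i.
    by rewrite -EFinM lee_fin mulr_ge0 ?weight_product_ge0.
  have [s0|s0] := pselect (forall l, 0 < s l ord0); last first.
    rewrite integral0_eq// => x _.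
    by rewrite /g/= /kernel_density (weight_eq0 _ s0) !mul0r.
  have [i si] := max_at_exists m0 s0; have [e0 _ H] := He i.
  apply: (@le_trans _ _ ((e i).2%:E * (weight_product a (e i).1 r s)%:E)%E); last first.
    rewrite (bigD1 i)//= leeDl// sume_ge0// => j _; have [ej0 _ _] := He j.
    by rewrite -EFinM lee_fin mulr_ge0 ?weight_product_ge0.
  rewrite [leLHS](_ : _ = ((weight a s)%:E * \int[lebesgue_rn n]_(x in annulus r k)
      (expR (- \sum_l s l ord0 * sqnorm (x - A l *m y)))%:E)%E); last first.
    rewrite [X in (_ * X)%E]integral_mkcond -ge0_integralZl//; last 3 first.
    - apply/(measurable_restrictT _ _).1 => //; apply: measurable_funTS.
      apply/measurable_EFinP; apply: (measurableT_comp (@measurable_expR R)).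
      apply: measurable_funN; apply: measurable_sum => l; apply: measurable_funM => //.
      exact: (measurableT_comp (measurable_sqdist A l) (measurable_pair2 y)).
    - by move=> x _; rewrite patchE; case: ifP => // _; rewrite lee_fin expR_ge0.
    - by rewrite lee_fin weight_ge0.
    apply: eq_integral => x _; rewrite patchE /g/= indicE.
    by case: ifPn => _; rewrite /= ?mulr1 ?mulr0 ?mule0 ?EFinM.
  rewrite -(weight_max_product a (e i).1 r s0) -EFinM mulrCA EFinM.
  by apply: lee_wpmul2l; [rewrite lee_fin weight_ge0|exact: H].
rewrite ge0_integral_sum//; last 2 first.
- by move=> i; apply: measurable_funeM; exact: measurable_weight_product.
- by move=> i s _; have [e0 _ _] := He i; rewrite -EFinM lee_fin mulr_ge0 ?weight_product_ge0.
rewrite -sumEFin; apply: lee_sum => i _; have [e0 ae _] := He i.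
rewrite ge0_integralZl//; last 2 first.
- exact: measurable_weight_product.
- by move=> s _; rewrite lee_fin weight_product_ge0.
by rewrite (integral_weight_product hasum r0 ae).
Qed.

(** The weight is a Gamma integral of Gaussians. Integrating these in [y] first gives [pi^(n/2)]
    times the Gamma function at [(N - n) / 2], finite since [N > n]. *)
Lemma integral_bessel_weight (N : R) : n%:R < N ->
  (\int[lebesgue_rn n]_y ((1 + sqnorm y) `^ (- (N / 2)))%:E < +oo)%E.
Proof.
move=> nN; have N0 : 0 < N / 2 by rewrite divr_gt0//; apply: le_lt_trans nN.
have nN0 : 0 < N / 2 - n%:R / 2 by rewrite -mulrBl divr_gt0// subr_gt0.
have gm0 := gamma_mass_gt0 N0.
pose g (p : 'cV[R]_n * measurableTypeR R) : \bar R :=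
  (gamma_weight (N / 2) p.2 * expR (- ((1 + sqnorm p.1) * p.2)))%:E.
have mg : measurable_fun setT g.
  apply/measurable_EFinP; apply: measurable_funM.
    by apply: (measurableT_comp (measurable_gamma_weight (N / 2))); exact: measurable_snd.
  apply: (measurableT_comp (@measurable_expR R)); apply: measurable_funN.
  apply: measurable_funM; last exact: measurable_snd.
  apply: measurable_funD => //; apply: measurable_sum => i; apply: measurable_funX.
  by apply: (measurableT_comp (measurable_coord i)); exact: measurable_fst.
have g0 p : (0 <= g p)%E by rewrite lee_fin mulr_ge0 ?gamma_weight_ge0 ?expR_ge0.
have := fubini_tonelli (m1 := lebesgue_rn n) (m2 := @lebesgue_measure R) g mg g0.
rewrite (_ : (fun x : 'cV[R]_n => _) = fun y : 'cV[R]_n =>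
    ((gamma_mass (N / 2))%:E * ((1 + sqnorm y) `^ (- (N / 2)))%:E)%E); last first.
  apply/funext => y; rewrite /g/= gamma_integral_scale//; first by rewrite mulrC EFinM.
  by rewrite ltr_pwDl ?sqnorm_ge0.
rewrite ge0_integralZl//; last 3 first.
- apply/measurable_EFinP; apply: (@measurableT_comp _ _ _ _ _ _ (@powR R ^~ (- (N / 2)))) => //.
  apply: measurable_funD => //; apply: measurable_sum => i; apply: measurable_funX.
  exact: measurable_coord.
- by move=> y _; rewrite lee_fin powR_ge0.
- by rewrite lee_fin ltW.
rewrite [RHS](_ : _ = \int[@lebesgue_measure R]_t ((Num.sqrt pi ^+ n)%:E *
    (gamma_weight (N / 2 - n%:R / 2) t * expR (- t))%:E))%E; last first.
  apply: eq_integral => t _; rewrite /g/= /gamma_weight; case: ifPn => [t0|_]; last first.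
    by under eq_integral do rewrite mul0r; rewrite integral0 mul0r mule0.
  transitivity (\int[lebesgue_rn n]_y ((t `^ (N / 2 - 1) * expR (- t))%:E *
      (expR (- (t * sqnorm (y - 0))))%:E))%E.
    apply: eq_integral => y _; rewrite -EFinM subr0 -mulrA -expRD; congr (_ * expR _)%:E; ring.
  rewrite ge0_integralZl//; last 2 first.
  - apply/measurable_EFinP; apply: (measurableT_comp (@measurable_expR R)).
    apply: measurable_funN; apply: measurable_funM => //; apply: measurable_sum => i.
    apply: measurable_funX; under eq_fun do rewrite subr0; exact: measurable_coord.
  - by rewrite lee_fin mulr_ge0 ?powR_ge0 ?expR_ge0.
  rewrite integral_gauss_rn// -!EFinM exprMn; congr EFin.
  have -> : N / 2 - n%:R / 2 - 1 = (N / 2 - 1) + - 2^-1 * n%:R by field.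
  have tn : t `^ (- 2^-1 * n%:R) = (t `^ (- 2^-1)) ^+ n.
    by rewrite powRrM powR_mulrn ?powR_ge0.
  rewrite [t `^ (_ + _ * n%:R)]powRD ?(gt_eqF t0) ?implybT// tn; ring.
rewrite ge0_integralZl//; last 2 first.
- apply/measurable_EFinP; have := measurable_gamma_density (N / 2 - n%:R / 2) 1.
  by congr (measurable_fun _ _); apply/funext => t; rewrite mul1r.
- by move=> t _; rewrite lee_fin mulr_ge0 ?gamma_weight_ge0 ?expR_ge0.
rewrite gamma_massE// -EFinM => h; rewrite ltey; apply/eqP => e.
by move: h; rewrite e gt0_muley ?lte_fin.
Qed.

End kernel_integrability.

Lemma measurable_rn_set1 {R : realType} n (c : 'cV[R]_n) : measurable [set c].
Proof.
have ms : measurable_fun setT (fun x : 'cV[R]_n => \sum_i `|x i ord0 - c i ord0|).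
  apply: measurable_sum => i; apply: measurableT_comp => //.
  by apply: measurable_funB => //; exact: measurable_coord.
have := ms measurableT _ (measurable_set1 0); rewrite setTI; congr measurable.
apply/seteqP; split => [x /= h|_ ->]; last by rewrite /= big1// => i _; rewrite subrr normr0.
apply/matrixP => i j; rewrite (ord1 j); apply/eqP; rewrite -subr_eq0 -normr_le0 -h.
by rewrite (bigD1 i)//= lerDl sumr_ge0.
Qed.

Lemma lebesgue_rn_set1 {R : realType} n (c : 'cV[R]_n) : (0 < n)%N ->
  lebesgue_rn n [set c] = 0%E.
Proof.
move=> n0; apply/eqP; rewrite eq_le measure_ge0 andbT; apply/lee_addgt0Pr => e e0.
rewrite add0e; pose d := Num.min e 1; have d0 : 0 < d by rewrite lt_min e0 ltr01.
have d1 : d <= 1 by rewrite ge_min lexx orbT.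
apply: (@le_trans _ _ (lebesgue_rn n (box (fun i => c i ord0) (fun i => c i ord0 + d)))).
  apply: le_lebesgue_rnW => _ -> i; by rewrite lexx/= ltrDl.
rewrite lebesgue_rn_box; last by move=> i; rewrite lerDl ltW.
rewrite (eq_bigr (fun=> d)); last by move=> i _; rewrite addrC addKr.
rewrite prodr_const card_ord lee_fin -(prednK n0) exprS.
apply: (@le_trans _ _ d); last by rewrite ge_min lexx.
by rewrite ler_piMr ?(ltW d0)// exprn_ile1// (ltW d0).
Qed.

(** A form of Young's inequality with the conjugate exponent [s / (s - 1)], by comparing [w] with
    [u^(s-1)]. *)
Lemma mul_le_powR_add {R : realType} (u w s : R) : 1 < s -> 0 <= u -> 0 <= w ->
  u * w <= u `^ s + w `^ (s / (s - 1)).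
Proof.
move=> s1 u0 w0; have s10 : 0 < s - 1 by rewrite subr_gt0.
have [ue|u00] := eqVneq u 0; first by rewrite ue mul0r addr_ge0 ?powR_ge0.
have {u0 u00}u0 : 0 < u by rewrite lt_neqAle eq_sym u00.
have [wu|uw] := leP w (u `^ (s - 1)).
  apply: (@le_trans _ _ (u `^ s)); last by rewrite lerDl powR_ge0.
  have us : u `^ (1 + (s - 1)) = u * u `^ (s - 1).
    by rewrite (@powRD _ u 1) ?(gt_eqF u0) ?implybT// powRr1 ?(ltW u0).
  by rewrite addrC subrK in us; rewrite us (ler_pM2l u0).
have w00 : 0 < w by apply: le_lt_trans uw; exact: powR_ge0.
apply: (@le_trans _ _ (w `^ (s / (s - 1)))); last by rewrite lerDr powR_ge0.
have -> : s / (s - 1) = (s - 1)^-1 + 1 by field; rewrite gt_eqF.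
rewrite (@powRD _ w _ 1) ?(gt_eqF w00) ?implybT// powRr1// ler_wpM2r//.
have -> : u = (u `^ (s - 1)) `^ (s - 1)^-1 by rewrite -powRrM divff ?gt_eqF// powRr1// ltW.
by apply: ge0_ler_powR; rewrite ?nnegrE ?powR_ge0 ?invr_ge0 ?(ltW s10) ?(ltW uw).
Qed.

Section local_integrability.
Context {R : realType} (n m : nat) (alpha : R).
Context (a : 'I_m -> R) (A : 'I_m -> 'M[R]_n).
Context (hn : (0 < n)%N) (halpha : 0 <= alpha < n%:R) (hm : 1 - alpha / n%:R < m%:R)
  (ha : forall i, 0 < a i) (hasum : \sum_i a i = n%:R - alpha)
  (hA : forall i, A i *m (A i)^T = 1%:M)
  (hA0 : alpha = 0 -> forall i j, i != j -> A i - A j \in unitmx).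
Implicit Types (x y z : 'cV[R]_n) (s : 'cV[R]_m).
Local Notation kernel := (rough_kernel a A).

Let na : 0 < n%:R - alpha. Proof. by rewrite subr_gt0; case/andP: halpha. Qed.

(** Each factor satisfies [|x - A_l y|^2 >= |y|^2 / 2 - |x|^2 >= |y|^2 / 4 >= (1 + |y|^2) / 8]. *)
Lemma rough_kernel_far x y : 4 * sqnorm x <= sqnorm y -> 1 <= sqnorm y ->
  kernel x y <= 8 `^ ((n%:R - alpha) / 2) * (1 + sqnorm y) `^ (- ((n%:R - alpha) / 2)).
Proof.
move=> xy y1.
have y8 : 0 < (1 + sqnorm y) / 8 by rewrite divr_gt0// ltr_pwDl ?sqnorm_ge0.
have e : (n%:R - alpha) / 2 = \sum_l a l / 2 by rewrite -mulr_suml hasum.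
rewrite -[8]invrK -(powR_inv1 (ltW (_ : 0 < 8^-1)))// -powRrM mulN1r.
rewrite mulrC -powRM ?invr_ge0 ?addr_ge0 ?sqnorm_ge0//.
rewrite rough_kernelE e -sumrN -prod_powR//; apply: ler_prod => l _; rewrite powR_ge0/=.
apply: powR_le_neg => //; first by rewrite divr_ge0// ltW.
have := sqnorm_triangle (A l *m y) 0 x.
rewrite !subr0 sqnorm_orthogonal; last exact: mulmx1C.
lra.
Qed.

(** For [y] in a large cube, local integrability of the kernel in [x] and Tonelli give convergence
    for almost every [x]. For distant [y] the decay of the kernel and Young's inequality lead to the
    weight of exponent [N], and [N > n] is equivalent to [alpha * s < n]. *)
Lemma rough_kernel_integrable_ae (s : R) (g : 'cV[R]_n -> R) :
  1 < s -> alpha * s < n%:R -> measurable_fun setT g -> (forall y, 0 <= g y) ->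
  (\int[lebesgue_rn n]_y (g y `^ s)%:E < +oo)%E ->
  {ae lebesgue_rn n, forall x, (\int[lebesgue_rn n]_y (kernel x y * g y)%:E < +oo)%E}.
Proof.
move=> s1 sn mg g0 goo; have s10 : 0 < s - 1 by rewrite subr_gt0.
pose N := (n%:R - alpha) * (s / (s - 1)).
have nN : n%:R < N.
  by rewrite /N mulrA ltr_pdivlMr//; lra.
pose w y : R := (1 + sqnorm y) `^ (- (N / 2)).
have woo := integral_bessel_weight nN.
have mw : measurable_fun setT w.
  apply: (@measurableT_comp _ _ _ _ _ _ (@powR R ^~ (- (N / 2)))) => //.
  apply: measurable_funD => //; apply: measurable_sum => i; apply: measurable_funX.
  exact: measurable_coord.
have mgs : measurable_fun setT (fun y => g y `^ s).
  exact: (@measurableT_comp _ _ _ _ _ _ (@powR R ^~ s)).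
pose c8 : R := 8 `^ ((n%:R - alpha) / 2).
have c80 : 0 <= c8 by exact: powR_ge0.
have far x y : 4 * sqnorm x <= sqnorm y -> 1 <= sqnorm y ->
    kernel x y * g y <= c8 * (g y `^ s + w y).
  move=> h1 h2; apply: (@le_trans _ _ (c8 * (1 + sqnorm y) `^ (- ((n%:R - alpha) / 2)) * g y)).
    by rewrite ler_wpM2r//; exact: rough_kernel_far.
  rewrite -mulrA ler_wpM2l// mulrC; apply: (le_trans (mul_le_powR_add s1 (g0 y) (powR_ge0 _ _))).
  rewrite lerD2l -powRrM /w /N le_eqVlt; apply/orP; left; apply/eqP.
  by congr (_ `^ _); field; rewrite gt_eqF.
(* Large enough that [|y| >= 1] and [|y| >= 2 |x|] whenever [x] lies in [D k] and [y] outside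
   [B k]. *)
pose M (k : nat) : R := 2 * n%:R * k.+1%:R + 1.
pose B k := box (fun=> - M k) (fun=> M k) : set 'cV[R]_n.
pose D k := annulus k.+1%:R^-1 k.+1%:R : set 'cV[R]_n.
have mB k : measurable (B k) by exact: measurable_box.
have mD k : measurable (D k) by exact: measurable_annulus.
pose p k (z : 'cV[R]_n * 'cV[R]_n) : \bar R :=
  (kernel z.1 z.2 * \1_(D k) z.1 * (g z.2 * \1_(B k) z.2))%:E.
have mp k : measurable_fun setT (p k).
  have m1 : measurable_fun setT (\1_(D k) : 'cV[R]_n -> R) by exact: measurable_indic.
  have m2 : measurable_fun setT (\1_(B k) : 'cV[R]_n -> R) by exact: measurable_indic.
  apply/measurable_EFinP; apply: measurable_funM.
    by apply: measurable_funM; [exact: measurable_rough_kernel|exact: (measurableT_comp m1 measurable_fst)].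
  by apply: measurable_funM; [exact: (measurableT_comp mg measurable_snd)|exact: (measurableT_comp m2 measurable_snd)].
have p0 k (z : 'cV[R]_n * 'cV[R]_n) : (0 <= p k z)%E by rewrite lee_fin !mulr_ge0 ?rough_kernel_ge0.
have ploc k : (\int[lebesgue_rn n]_x \int[lebesgue_rn n]_y p k (x, y) < +oo)%E.
  have r0 : 0 < k.+1%:R^-1 :> R by rewrite invr_gt0.
  have k0 : 0 <= k.+1%:R :> R by rewrite ler0n.
  have [C C0 HC] := kernel_integral_annulus hn halpha hm ha hasum hA hA0 r0 k0.
  rewrite (fubini_tonelli (p k) (mp k) (p0 k)).
  have mK y : measurable_fun setT (fun x => kernel x y).
    exact: (measurableT_comp (measurable_rough_kernel a A) (measurable_pair2 y)).
  apply: (@le_lt_trans _ _ (\int[lebesgue_rn n]_y (C%:E * ((\1_(B k) y)%:E + (g y `^ s)%:E)))%E).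
    apply: ge0_le_integralW => y _; first exact: integral_ge0.
    rewrite [leLHS](_ : _ = ((g y * \1_(B k) y)%:E *
        \int[lebesgue_rn n]_(x in D k) (kernel x y)%:E)%E); last first.
      rewrite [X in (_ * X)%E]integral_mkcond -ge0_integralZl//; last 3 first.
      - apply/(measurable_restrictT _ _).1 => //; apply: measurable_funTS.
        by apply/measurable_EFinP.
      - by move=> x _; rewrite patchE; case: ifP => // _; rewrite lee_fin rough_kernel_ge0.
      - by rewrite lee_fin mulr_ge0.
      apply: eq_integral => x _; rewrite patchE /p/= indicE.
      by case: ifPn => _; rewrite /= ?mulr1 ?mulr0 ?mul0r ?mule0// [RHS]muleC EFinM.
    rewrite muleC; apply: lee_pmul => //.
    - by apply: integral_ge0 => x _; rewrite lee_fin rough_kernel_ge0.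
    - by rewrite lee_fin mulr_ge0.
    rewrite -EFinD lee_fin indicE; case: (y \in B k); rewrite /= ?mulr1 ?mulr0 ?addr_ge0 ?powR_ge0//.
    have [g1|g1] := leP (g y) 1; first by apply: (le_trans g1); rewrite lerDl powR_ge0.
    apply: (@le_trans _ _ (g y `^ s)); last by rewrite lerDr.
    by rewrite -[leLHS]powRr1//; apply: ler_powR; exact: ltW.
  have mI : measurable_fun setT (\1_(B k) : 'cV[R]_n -> R) by exact: measurable_indic.
  rewrite ge0_integralZl//; last 2 first.
  - by apply: emeasurable_funD; exact/measurable_EFinP.
  - by move=> y _; rewrite adde_ge0// lee_fin ?powR_ge0.
  rewrite ge0_integralD//; last 3 first.
  - exact/measurable_EFinP.
  - by move=> y _; rewrite lee_fin powR_ge0.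
  - exact/measurable_EFinP.
  apply: lte_mul_pinfty => //; apply: lte_add_pinfty => //.
  rewrite integral_indic// setIT.
  have Mk i : (fun=> - M k : R) i <= (fun=> M k) (i : 'I_n) :> R.
    by rewrite ge0_cp// addr_ge0// !mulr_ge0.
  apply: (@eq_ind_r _ _ (fun v => v < +oo)%E _ _ (lebesgue_rn_box Mk)); exact: ltry.
have ae1 : {ae lebesgue_rn n, forall x, forall k,
    (\int[lebesgue_rn n]_y p k (x, y))%E \is a fin_num}.
  apply: ae_foralln => k.
  have iF : (lebesgue_rn n).-integrable setT (fun x => \int[lebesgue_rn n]_y p k (x, y))%E.
    apply/integrableP; split; first exact: (measurable_fun_fubini_tonelli_F (p k) (mp k) (p0 k)).
    apply: le_lt_trans (ploc k); apply: ge0_le_integralW => x _ //.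
    by rewrite gee0_abs//; exact: integral_ge0.
  by apply: filterS (integrable_ae measurableT iF) => x; apply.
have ae2 : {ae lebesgue_rn n, forall x, x != 0}.
  exists [set 0]; split => //; first exact: measurable_rn_set1.
    exact: lebesgue_rn_set1.
  by move=> x /= /negP/negPn/eqP.
apply: filterS2 ae1 ae2 => x xfin x0.
have ex0 : 0 < enorm x.
  rewrite lt_neqAle enorm_ge0 andbT eq_sym; apply: contraNneq x0 => ex.
  apply/eqP/matrixP => i j; rewrite (ord1 j) mxE; apply/eqP; rewrite -normr_le0 -ex.
  exact: le_entry_enorm.
pose k := Num.truncn (enorm x + (enorm x)^-1).
have hk : enorm x + (enorm x)^-1 < k.+1%:R by exact: truncnS_gt.
have exi : 0 < (enorm x)^-1 by rewrite invr_gt0.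
have xD : D k x.
  split=> [i|] /=.
    have ek : enorm x < k.+1%:R by lra.
    by have := le_lt_trans (le_entry_enorm x i) ek; rewrite ltr_norml => /andP[/ltW -> ->].
  by rewrite -[leRHS]invrK lef_pV2 ?posrE//; lra.
have := xfin k; rewrite ge0_fin_numE; last exact: integral_ge0.
move=> hx; apply: (@le_lt_trans _ _ (\int[lebesgue_rn n]_y
  (p k (x, y) + c8%:E * ((g y `^ s)%:E + (w y)%:E)))%E).
  apply: ge0_le_integralW => y _; first by rewrite lee_fin mulr_ge0 ?rough_kernel_ge0.
  rewrite /p/= [\1_(D k) x]indicE mem_set// mulr1 -(EFinD (g y `^ s)) -(EFinM c8) -EFinD lee_fin.
  have r0 : 0 <= c8 * (g y `^ s + w y) by rewrite mulr_ge0// addr_ge0 ?powR_ge0.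
  rewrite indicE; have [yB|/negP yB] := boolP (y \in B k); first by rewrite mulr1 lerDl.
  have [i yi] : exists i, M k <= `|y i ord0|.
    apply: contrapT => /forallNP h; case: yB; apply/mem_set => i.
    have /negP := h i; rewrite -ltNge => yi.
    by have := yi; rewrite ltr_norml => /andP[/ltW -> ->].
  have nk0 : 0 <= 2 * n%:R * k.+1%:R :> R by rewrite !mulr_ge0.
  have yM : M k ^+ 2 <= sqnorm y.
    apply: (@le_trans _ _ (y i ord0 ^+ 2)).
      by rewrite -[leRHS]real_normK ?num_real// lerXn2r ?nnegrE// addr_ge0.
    by rewrite /sqnorm (bigD1 i)//= lerDl; apply: sumr_ge0 => *; exact: sqr_ge0.
  rewrite !mulr0 add0r; apply: far; apply: le_trans yM; rewrite /M; last first.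
    by rewrite exprn_ege1// lerDr.
  have xn : sqnorm x <= n%:R * k.+1%:R ^+ 2.
    rewrite -[n in leRHS]card_ord mulr_natl -sumr_const; apply: ler_sum => j _.
    rewrite -[leLHS]real_normK ?num_real// lerXn2r ?nnegrE//.
    have [/(_ j)/andP[x1 x2] _] := xD; rewrite ler_norml x1/=; exact: ltW.
  have n1 : 1 <= n%:R :> R by rewrite ler1n.
  have k1 : 0 <= k.+1%:R ^+ 2 :> R by rewrite exprn_ge0.
  apply: (@le_trans _ _ ((2 * n%:R * k.+1%:R) ^+ 2)); last first.
    by rewrite lerXn2r ?nnegrE ?addr_ge0// lerDl.
  apply: (@le_trans _ _ (4 * (n%:R * k.+1%:R ^+ 2))); first by rewrite ler_pM2l.
  rewrite -subr_ge0 [leRHS](_ : _ = 4 * k.+1%:R ^+ 2 * n%:R * (n%:R - 1)); last by ring.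
  by rewrite !mulr_ge0// subr_ge0.
rewrite ge0_integralD//; last 3 first.
- exact: (measurableT_comp (mp k) (measurable_pair1 x)).
- by move=> y _; rewrite -EFinD -EFinM lee_fin mulr_ge0// addr_ge0 ?powR_ge0.
- by apply: measurable_funeM; apply: emeasurable_funD; exact/measurable_EFinP.
apply: lte_add_pinfty => //.
rewrite ge0_integralZl//; last 2 first.
- by apply: emeasurable_funD; exact/measurable_EFinP.
- by move=> y _; rewrite -EFinD lee_fin addr_ge0 ?powR_ge0.
apply: lte_mul_pinfty => //.
rewrite ge0_integralD//; last 4 first.
- by move=> y _; rewrite lee_fin powR_ge0.
- exact/measurable_EFinP.
- by move=> y _; rewrite lee_fin powR_ge0.
- exact/measurable_EFinP.
exact: lte_add_pinfty.
Qed.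

End local_integrability.

(** * Identification with the integral operator *)

Section fubini_identity.
Context {R : realType} (n m : nat) (alpha : R).
Context (a : 'I_m -> R) (A : 'I_m -> 'M[R]_n).
Context (hn : (0 < n)%N) (halpha : 0 <= alpha < n%:R)
  (ha : forall i, 0 < a i) (hasum : \sum_i a i = n%:R - alpha)
  (hA : forall i, A i *m (A i)^T = 1%:M).
Implicit Types (x y z : 'cV[R]_n) (s : 'cV[R]_m).
Local Notation kernel := (rough_kernel a A).
Local Notation density := (kernel_density a A).
Local Notation Re := (@complex.Re R).
Local Notation Im := (@complex.Im R).

Lemma not_pole_ae x : {ae lebesgue_rn n, forall y, forall l, x != A l *m y}.
Proof.
have [mU] := measure_finite_union (lebesgue_rn n : {measure set 'cV[R]_n -> \bar R})
  (enum 'I_m) (fun l => measurable_rn_set1 ((A l)^T *m x)).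
rewrite big1 => [U0|l _]; last exact: lebesgue_rn_set1.
eexists; split; [exact: mU|by apply/eqP; rewrite eq_le U0 measure_ge0|].
move=> y /= /existsNP[l /negP/negPn/eqP ->]; exists l; first by rewrite mem_enum.
by rewrite mulmxA (mulmx1C (hA l)) mul1mx.
Qed.

Lemma gauss_scaled (b : R) z y : 0 < b ->
  gauss (Num.sqrt b *: (z - y)) = expR (- (b * sqnorm (z - y))).
Proof.
move=> b0; rewrite /gauss /sqnorm mulr_sumr; congr (expR (- _)); apply: eq_bigr => i _.
by rewrite mxE exprMn sqr_sqrtr// ltW.
Qed.

Definition real_op_integrand x (h : 'cV[R]_n -> R) s : R :=
  weight a s * expR (- dispersion A x s) *
  (if 0 < total s then
     \int[lebesgue_rn n]_y (h y * expR (- (total s * sqnorm (barycenter A x s - y))))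
   else 0)%R.

(** Fubini for the density times [h]. Integrating in [s] first gives the kernel, which also provides
    absolute integrability; integrating in [y] first gives the pairing with a Gaussian, by Leibniz'
    identity. *)
Lemma real_op_integrand_integral x (h : 'cV[R]_n -> R) : measurable_fun setT h ->
  (\int[lebesgue_rn n]_y (kernel x y * `|h y|)%:E < +oo)%E ->
  (\int[lebesgue_rn m]_s real_op_integrand x h s =
   op_normalization a * \int[lebesgue_rn n]_y (kernel x y * h y))%R.
Proof.
move=> mh hoo; have on0 := op_normalization_gt0 ha.
have m0 := number_of_factors_gt0 halpha hasum.
pose f (p : 'cV[R]_m * 'cV[R]_n) : \bar R := (density x p.2 p.1 * h p.2)%:E.
have md : measurable_fun setT (fun p : 'cV[R]_m * 'cV[R]_n => density x p.2 p.1).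
  apply: (@measurableT_comp _ _ _ _ _ _ _ _
    (fun p : 'cV[R]_m * 'cV[R]_n => ((x, p.2), p.1)) (measurable_kernel_density a A)).
  apply: measurable_fun_pair; last exact: measurable_fst.
  by apply: measurable_fun_pair => //; exact: measurable_snd.
have mf : measurable_fun setT f.
  apply/measurable_EFinP; apply: measurable_funM => //.
  exact: (measurableT_comp mh measurable_snd).
have mdy y : measurable_fun setT (fun s => (density x y s)%:E).
  by apply/measurable_EFinP; exact: (measurableT_comp md (measurable_pair2 y)).
have mK : measurable_fun setT (fun y => kernel x y).
  exact: (measurableT_comp (measurable_rough_kernel a A) (measurable_pair1 x)).
have iKh : (lebesgue_rn n : {measure set 'cV[R]_n -> \bar R}).-integrable setT
    (EFin \o (fun y => kernel x y * h y)).
  apply/integrableP; split; first by apply/measurable_EFinP; exact: measurable_funM.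
  apply: le_lt_trans hoo; apply: ge0_le_integralW => y _ //=.
  by rewrite lee_fin normrM ger0_norm ?rough_kernel_ge0.
have idens y : (forall l, x != A l *m y) ->
    (lebesgue_rn m : {measure set 'cV[R]_m -> \bar R}).-integrable setT
      (fun s => (density x y s)%:E).
  move=> xy; apply/integrableP; split=> //.
  under eq_integral do rewrite gee0_abs ?lee_fin ?kernel_density_ge0//.
  by rewrite kernel_density_integral// ltry.
have if_ : (lebesgue_rn m \x lebesgue_rn n)%E.-integrable setT f.
  apply: (proj2 (integrable21ltyP _ _ mf)).
  rewrite (ae_eq_integralW (g := fun y => ((op_normalization a)%:E * (kernel x y * `|h y|)%:E)%E)).
    rewrite ge0_integralZl//; last 3 first.
    - apply/measurable_EFinP; apply: measurable_funM => //.
      exact: measurableT_comp.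
    - by move=> y _; rewrite lee_fin mulr_ge0 ?rough_kernel_ge0.
    - by rewrite lee_fin ltW.
    by apply: lte_mul_pinfty => //; rewrite lee_fin ltW.
  apply: filterS (not_pole_ae x) => y xy _.
  transitivity (\int[lebesgue_rn m]_s ((`|h y|)%:E * (density x y s)%:E))%E.
    apply: eq_integral => s _; rewrite /f/= normrM ger0_norm ?kernel_density_ge0//.
    by rewrite mulrC EFinM.
  rewrite ge0_integralZl//; last by move=> s _; rewrite lee_fin kernel_density_ge0.
  by rewrite kernel_density_integral// -!EFinM; congr EFin; ring.
rewrite -(RintegralZl (op_normalization a) measurableT iKh) /Rintegral; congr fine.
transitivity (\int[lebesgue_rn m]_s \int[lebesgue_rn n]_y f (s, y))%E; last first.
  rewrite (Fubini if_); apply: ae_eq_integralW.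
  apply: filterS (not_pole_ae x) => y xy _.
  transitivity (\int[lebesgue_rn m]_s ((h y)%:E * (density x y s)%:E))%E.
    by apply: eq_integral => s _; rewrite /f/= mulrC EFinM.
  rewrite (integralZl measurableT (idens _ xy)) kernel_density_integral// -EFinM.
  by congr EFin; ring.
(* For almost every [s] the slice in [y] is integrable, so the real-valued integral in
   [real_op_integrand] equals the extended one. *)
apply: ae_eq_integralW; apply: filterS (ae_integrable1 if_) => s ifs _.
have [s0|s0] := pselect (forall l, 0 < s l ord0); last first.
  rewrite /real_op_integrand (weight_eq0 a s0) !mul0r; apply/esym.
  by apply: integral0_eq => y _; rewrite /f/= /kernel_density (weight_eq0 a s0) !mul0r.
have [i si] := max_at_exists m0 s0; have b0 := total_gt0 si.
rewrite /real_op_integrand b0; set c := weight a s * _.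
have c0 : 0 < c.
  rewrite mulr_gt0 ?expR_gt0//; apply: prodr_gt0 => l _.
  by rewrite /gamma_weight s0 powR_gt0.
pose g y := h y * expR (- (total s * sqnorm (barycenter A x s - y))).
have fE y : f (s, y) = (c%:E * (g y)%:E)%E.
  rewrite /f/= /kernel_density -EFinM; congr EFin.
  under eq_bigr do rewrite sqnorm_pole//.
  rewrite (gaussian_product A x y b0) opprD expRD /c /g; ring.
have ig : (lebesgue_rn n : {measure set 'cV[R]_n -> \bar R}).-integrable setT (EFin \o g).
  have := integrableZl measurableT c^-1 ifs.
  by apply: eq_integrable => // y _ /=; rewrite fE -!EFinM mulrA mulVf ?gt_eqF// mul1r.
transitivity (c%:E * \int[lebesgue_rn n]_y (EFin \o g) y)%E; last first.
  by rewrite -(integralZl measurableT ig); apply: eq_integral => y _; exact/esym/fE.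
rewrite EFinM; congr (_ * _)%E; rewrite fineK//; exact: integrable_fin_num.
Qed.

Lemma Re_op_integrand (f : 'cV[R]_n -> R[i]) x s : Re (op_integrand a A (distribution_of f) x s) =
  real_op_integrand x (Re \o f) s.
Proof.
rewrite /op_integrand ReZ /real_op_integrand /gauss_val; congr (_ * _).
case: pselect => [sb|]; rewrite ?sqrtr_gt0; last by move=> /negP/negbTE ->.
have b0 : 0 < total s by rewrite -sqrtr_gt0.
rewrite b0.
apply: eq_Rintegral => y _ /=; rewrite -(gauss_scaled _ _ b0).
by case: (f y) => u w /=; rewrite mulr0 subr0.
Qed.

Lemma Im_op_integrand (f : 'cV[R]_n -> R[i]) x s : Im (op_integrand a A (distribution_of f) x s) =
  real_op_integrand x (Im \o f) s.
Proof.
rewrite /op_integrand ImZ /real_op_integrand /gauss_val; congr (_ * _).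
case: pselect => [sb|]; rewrite ?sqrtr_gt0; last by move=> /negP/negbTE ->.
have b0 : 0 < total s by rewrite -sqrtr_gt0.
rewrite b0.
apply: eq_Rintegral => y _ /=; rewrite -(gauss_scaled _ _ b0).
by case: (f y) => u w /=; rewrite mulr0 add0r.
Qed.

Lemma rough_extension_distribution (f : 'cV[R]_n -> R[i]) x : complex_measurable f ->
  rough_operator_defined a A f x ->
  rough_extension a A (distribution_of f) x = rough_operator a A f x.
Proof.
move=> [mr mi] fx; have on0 := op_normalization_gt0 ha.
have H (g : R[i] -> R) : (forall u, `|g u| <= normc u) ->
    (\int[lebesgue_rn n]_y (kernel x y * `|g (f y)|)%:E < +oo)%E.
  move=> gu; apply: le_lt_trans fx; apply: ge0_le_integralW => y _.
    by rewrite lee_fin mulr_ge0 ?rough_kernel_ge0.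
  by rewrite lee_fin ler_wpM2l ?rough_kernel_ge0.
have eR := real_op_integrand_integral mr (H _ (@norm_Re_le R)).
have eI := real_op_integrand_integral mi (H _ (@norm_Im_le R)).
rewrite /rough_extension /rough_operator /complex_integral.
under eq_Rintegral do rewrite Re_op_integrand.
under [X in Complex _ X]eq_Rintegral do rewrite Im_op_integrand.
rewrite eR eI; under [in RHS]eq_Rintegral do rewrite ReZ.
under [X in _ = Complex _ X]eq_Rintegral do rewrite ImZ.
have onn : op_normalization a != 0 by rewrite gt_eqF.
by apply/eqP; rewrite eq_complex /= !mul0r subr0 addr0 !mulKf// !eqxx.
Qed.

End fubini_identity.

(** * Boundedness *)

Lemma ae_impl2 d (T : measurableType d) (R : realType) (mu : {measure set T -> \bar R})
    (P Q S : T -> Prop) : (forall t, P t -> Q t -> S t) ->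
  {ae mu, forall t, P t} -> {ae mu, forall t, Q t} -> {ae mu, forall t, S t}.
Proof. by move=> PQS; apply: filterS2. Qed.

(** * From log-Hoelder exponents to the constants of the one-dimensional inequality *)

Section exponent_bounds.
Context {R : realType}.
Local Notation mu := (@lebesgue_measure R).

Lemma mrestr_pos_ae (P : R -> Prop) :
  {ae mrestr mu (measurable_itv `]0%R, +oo[), forall t, P t} ->
  {ae mu, forall t, 0 < t -> P t}.
Proof.
move=> [N [mN N0 PN]]; exists (N `&` `]0%R, +oo[); split=> //.
  by apply: measurableI.
move=> t /= /not_implyP[t0 Pt]; split; first exact: PN.
by rewrite /= in_itv/= t0.
Qed.

Lemma exponent_sup_ae (p : R -> R) (M : R) : exponent_sup p = M%:E ->
  {ae mu, forall t, 0 < t -> p t <= M}.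
Proof.
move=> pM; apply: mrestr_pos_ae; have := ess_sup_ge (mrestr mu (measurable_itv `]0%R, +oo[)) (EFin \o p).
by rewrite -/(exponent_sup p) pM; apply: filterS => t; rewrite lee_fin.
Qed.

Lemma exponent_inf_ae (p : R -> R) : (0 < exponent_inf p)%E ->
  exists2 M : R, 0 < M & {ae mu, forall t, 0 < t -> M <= p t}.
Proof.
move=> p0; have h := ess_inf_le (mrestr mu (measurable_itv `]0%R, +oo[)) (EFin \o p).
have [M M0 Mp] : exists2 M : R, 0 < M & (M%:E <= exponent_inf p)%E.
  case: (exponent_inf p) p0 => [r r0| _|//]; first by exists r.
  by exists 1; rewrite ?leey.
exists M => //; apply: mrestr_pos_ae; apply: filterS h => t.
by move=> /(le_trans Mp); rewrite lee_fin.
Qed.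

Lemma ae_exists_between (P : R -> Prop) (c d : R) : 0 <= c -> c < d ->
  {ae mu, forall t, 0 < t -> P t} -> exists2 t, c < t < d & P t.
Proof.
move=> c0 cd [N [mN N0 PN]]; apply: contrapT => H.
have sub : (`]c, d[%classic : set R) `<=` N.
  move=> t /=; rewrite in_itv/= => /andP[ct td]; apply: PN => /= Pt; apply: H.
  by exists t; [rewrite ct td|apply: Pt; exact: le_lt_trans ct].
have : (mu (`]c, d[%classic : set R) <= mu N)%E by apply: le_measure; rewrite ?inE.
by rewrite N0 lebesgue_measure_itv/= lte_fin cd -EFinB lee_fin subr_le0 leNgt cd.
Qed.

(** Both log-Hoelder conditions in one: [|ln t|] measures the distance to 0 and to infinity, and
    vanishes at 1 where the model exponent jumps. *)
Definition log_bound (p : R -> R) (c0 c1 C : R) :=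
  {ae mu, forall t, 0 < t -> `|p t - two_valued c0 c1 t| * `|ln t| <= C}.

(** The limits inherit the essential bounds, since near 0 and near infinity there are points where
    these bounds hold and [p] is close to its limit. On the interval from [1/2] to 1 one has
    [|ln t| <= 1] and boundedness suffices, hence the summand [pM - pm]. *)
Lemma log_hoelder_bounds (p : R -> R) (pM : R) : log_hoelder_exponent p ->
  exponent_sup p = pM%:E ->
  exists pm C : R, [/\ 0 < pm,
   {ae mu, forall t, 0 < t -> pm <= p t <= pM},
   pm <= exponent_at0 p <= pM /\ pm <= exponent_aty p <= pM &
   log_bound p (exponent_at0 p) (exponent_aty p) C].
Proof.
move=> [_ [pinf _] _ [C C0 [near0 nearoo]]] psup.
have [pm pm0 hm] := exponent_inf_ae pinf; have hM := exponent_sup_ae psup.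
have hb : {ae mu, forall t, 0 < t -> pm <= p t <= pM}.
  by move: hm hM; apply: ae_impl2 => t h1 h2 t0; rewrite h1// h2.
set p0 := exponent_at0 p in near0 *; set p1 := exponent_aty p in nearoo *.
have at0 e : 0 < e -> exists2 t, pm <= p t <= pM & `|p t - p0| <= e.
  move=> e0; pose d := Num.min 2^-1 (expR (- (C / e))).
  have d0 : 0 < d by rewrite lt_min invr_gt0 ltr0n expR_gt0.
  have [t /andP[t0 td] pt] := ae_exists_between (lexx 0) d0 hb.
  exists t => //; move: td; rewrite lt_min => /andP[t1 t2].
  apply: (le_trans (near0 t _)); first by rewrite t0.
  have : ln t < - (C / e) by rewrite -[ltRHS]expRK ltr_ln ?posrE ?expR_gt0.
  rewrite ltrNr => lt.
  have Ce : 0 < C / e by rewrite divr_gt0.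
  rewrite ler_pdivrMr; last exact: lt_trans lt.
  by rewrite mulrC -ler_pdivrMr// ltW.
have aty e : 0 < e -> exists2 t, pm <= p t <= pM & `|p t - p1| <= e.
  move=> e0; pose d := expR (C / e).
  have d0 : 0 <= d by exact: expR_ge0.
  have dd : d < d + 1 by rewrite ltrDl.
  have [t /andP[dt _] pt] := ae_exists_between d0 dd hb.
  have t0 : 0 < t by exact: le_lt_trans dt.
  exists t => //; apply: (le_trans (nearoo t t0)).
  have Ce : 0 < C / e by rewrite divr_gt0.
  have lt : C / e <= ln (expR 1 + t).
    rewrite -[leLHS]expRK ler_ln ?posrE ?expR_gt0// ?addr_gt0 ?expR_gt0//.
    by apply: (le_trans (ltW dt)); rewrite lerDr expR_ge0.
  rewrite ler_pdivrMr; last exact: lt_le_trans lt.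
  by rewrite mulrC -ler_pdivrMr.
have between c : (forall e, 0 < e -> exists2 t, pm <= p t <= pM & `|p t - c| <= e) ->
    pm <= c <= pM.
  move=> hc; apply/andP; split; apply/ler_addgt0Pr => e e0;
    have [t /andP[h1 h2] h3] := hc e e0; move: h3; rewrite ler_norml => /andP[h3 h4]; lra.
exists pm, (C + (pM - pm)); split=> //.
  by split; apply: between.
move: hb; rewrite /log_bound; apply: ae_impl => t hbt t0; have /andP[h1 h2] := hbt t0.
have pMm : 0 <= pM - pm by rewrite subr_ge0 (le_trans h1).
rewrite /two_valued; have [t1|t1] := leP t 1; last first.
  apply: (@le_trans _ _ C); last by rewrite lerDl.
  have l0 : 0 < ln t by rewrite ln_gt0.
  have := nearoo t t0; have l1 : ln t <= ln (expR 1 + t).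
    by rewrite ler_ln ?posrE ?addr_gt0 ?expR_gt0// lerDr expR_ge0.
  rewrite ler_pdivlMr; last exact: lt_le_trans l1.
  by rewrite (gtr0_norm l0) => h; apply: le_trans h; rewrite ler_wpM2l.
have [t2|t2] := ltP t 2^-1.
  apply: (@le_trans _ _ C); last by rewrite lerDl.
  have l0 : ln t < 0 by rewrite ln_lt0// t0 (lt_trans t2)// invf_lt1// ltr1n.
  have /near0 : 0 < t < 2^-1 by rewrite t0.
  by rewrite (ltr0_norm l0) ler_pdivlMr// oppr_gt0.
apply: (@le_trans _ _ (pM - pm)); last by rewrite lerDr ltW.
rewrite -[leRHS]mulr1; apply: ler_pM => //.
  have /andP[h3 h4] := between _ at0; rewrite ler_norml; lra.
rewrite (ler0_norm (ln_le0 t1)) -lnV ?posrE//.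
have ti : t^-1 <= 2 by rewrite -[leRHS]invrK lef_pV2 ?posrE ?invr_gt0.
apply: (@le_trans _ _ (ln (expR 1))); last by rewrite expRK.
rewrite ler_ln ?posrE ?invr_gt0 ?expR_gt0//; apply: (le_trans ti).
by have := @expR_ge1Dx R 1.
Qed.

Lemma log_bound_inv (p : R -> R) (pm c0 c1 C : R) : 0 < pm ->
  {ae mu, forall t, 0 < t -> pm <= p t} -> pm <= c0 -> pm <= c1 ->
  log_bound p c0 c1 C ->
  log_bound (fun t => (p t)^-1) c0^-1 c1^-1 (pm ^- 2 * C).
Proof.
move=> pm0 hp h0 h1; rewrite /log_bound; move: hp; apply: ae_impl2 => t pt bt t0.
have {}pt := pt t0; have {}bt := bt t0.
have -> : two_valued c0^-1 c1^-1 t = (two_valued c0 c1 t)^-1.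
  by rewrite /two_valued; case: ifP.
have ct : pm <= two_valued c0 c1 t by rewrite /two_valued; case: ifP.
move: (two_valued c0 c1 t) ct bt => c ct bt.
have p0 : 0 < p t by exact: lt_le_trans pt.
have cc0 : 0 < c by exact: lt_le_trans ct.
have -> : (p t)^-1 - c^-1 = (p t * c)^-1 * (c - p t) by field; rewrite !gt_eqF.
rewrite normrM -mulrA; apply: ler_pM; rewrite ?mulr_ge0//; last by rewrite distrC.
rewrite gtr0_norm ?invr_gt0 ?mulr_gt0// lef_pV2 ?posrE ?mulr_gt0 ?exprn_gt0//.
by rewrite expr2; apply: ler_pM => //; exact: ltW.
Qed.

Lemma log_bound_shift (p : R -> R) (c0 c1 C d : R) : log_bound p c0 c1 C ->
  log_bound (fun t => p t - d) (c0 - d) (c1 - d) C.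
Proof.
rewrite /log_bound; apply: ae_impl => t bt t0; apply: le_trans (bt t0).
rewrite (_ : p t - d - _ = p t - two_valued c0 c1 t)//.
by rewrite /two_valued; case: ifP => _; ring.
Qed.

End exponent_bounds.

Section exponent_data.
Context {R : realType}.
Local Notation mu := (@lebesgue_measure R).

Lemma shifted_inv_bounds (beta c cm cM : R) : 0 <= beta -> 0 < cm -> cm <= c <= cM ->
  beta * cM < 1 ->
  [/\ cM^-1 - beta <= c^-1 - beta, 0 < cM^-1 - beta,
      c <= (c^-1 - beta)^-1 & (c^-1 - beta)^-1 <= (cM^-1 - beta)^-1].
Proof.
move=> b0 cm0 /andP[h1 h2] bM; have c0 : 0 < c by exact: lt_le_trans h1.
have cM0 : 0 < cM by exact: lt_le_trans h2.
have i1 : cM^-1 - beta <= c^-1 - beta by rewrite lerD2r lef_pV2.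
have i2 : 0 < cM^-1 - beta by rewrite subr_gt0 -[cM^-1]mul1r ltr_pdivlMr.
have i3 : 0 < c^-1 - beta by exact: lt_le_trans i1.
split=> //; last by rewrite lef_pV2.
by rewrite -[leLHS]invrK lef_pV2 ?posrE ?invr_gt0// lerBlDr lerDl.
Qed.

Lemma exponent_data (beta pM qM : R) (p q : R -> R) : 0 <= beta ->
  log_hoelder_exponent p -> log_hoelder_exponent q ->
  exponent_sup p = pM%:E -> exponent_sup q = qM%:E ->
  beta * pM < 1 -> beta * qM < 1 ->
  exists e0 e1 q0 q1 v0 v1 delta eM qm vM Cp Cq Cv : R,
  [/\ [/\ 0 < delta, 0 < qm, delta <= e0 - beta & delta <= e1 - beta],
      [/\ e0 <= eM & e1 <= eM],
      [/\ qm <= q0 <= v0, qm <= q1 <= v1, v0 <= vM & v1 <= vM] &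
      {ae mu, forall t, 0 < t ->
        [/\ `|(p t)^-1 - two_valued e0 e1 t| * `|ln t| <= Cp,
            `|q t - two_valued q0 q1 t| * `|ln t| <= Cq,
            `|((q t)^-1 - beta)^-1 - two_valued v0 v1 t| * `|ln t| <= Cv &
            [/\ qm <= q t, q t <= ((q t)^-1 - beta)^-1 & ((q t)^-1 - beta)^-1 <= vM]]}].
Proof.
move=> b0 hp hq sp sq bp bq.
have [pm [C [pm0 pb [p0b p1b] plog]]] := log_hoelder_bounds hp sp.
have [qm [D [qm0 qb [q0b q1b] qlog]]] := log_hoelder_bounds hq sq.
set p0 := exponent_at0 p in p0b plog *; set p1 := exponent_aty p in p1b plog *.
set q0 := exponent_at0 q in q0b qlog *; set q1 := exponent_aty q in q1b qlog *.
have [P1 P2 _ _] := shifted_inv_bounds b0 pm0 p0b bp.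
have [P3 _ _ _] := shifted_inv_bounds b0 pm0 p1b bp.
have [Q1 Q2 Q3 Q4] := shifted_inv_bounds b0 qm0 q0b bq.
have [Q5 _ Q6 Q7] := shifted_inv_bounds b0 qm0 q1b bq.
have pmge : {ae mu, forall t, 0 < t -> pm <= p t}.
  by move: pb; apply: ae_impl => t h /h/andP[].
have qmge : {ae mu, forall t, 0 < t -> qm <= q t}.
  by move: qb; apply: ae_impl => t h /h/andP[].
move/andP: (p0b) => [p0m _]; move/andP: (p1b) => [p1m _].
move/andP: (q0b) => [q0m _]; move/andP: (q1b) => [q1m _].
have plogV := log_bound_inv pm0 pmge p0m p1m plog.
have qlogV := log_bound_shift beta (log_bound_inv qm0 qmge q0m q1m qlog).
have vge : {ae mu, forall t, 0 < t -> qM^-1 - beta <= (q t)^-1 - beta}.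
  move: qb; apply: ae_impl => t h /h qt.
  by have [] := shifted_inv_bounds b0 qm0 qt bq.
have vlog := log_bound_inv Q2 vge Q1 Q5 qlogV.
exists p0^-1, p1^-1, q0, q1, (q0^-1 - beta)^-1, (q1^-1 - beta)^-1, (pM^-1 - beta), pm^-1, qm,
  (qM^-1 - beta)^-1, (pm ^- 2 * C), D, ((qM^-1 - beta) ^- 2 * (qm ^- 2 * D)).
split=> //.
- by split; rewrite lef_pV2 ?posrE// (lt_le_trans pm0).
- by split=> //; apply/andP.
have H1 := ae_impl2 (fun t x y => conj x y) plogV qlog.
have H2 := ae_impl2 (fun t x y => conj x y) vlog qb.
move: H1 H2; apply: ae_impl2 => t [h1 h2] [h3 h4] t0.
have [_ _ h5 h6] := shifted_inv_bounds b0 qm0 (h4 t0) bq.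
by have /andP[h7 _] := h4 t0; split; [exact: h1|exact: h2|exact: h3|].
Qed.

End exponent_data.

Section boundedness.
Context {R : realType} (n m : nat) (alpha : R) (p q : R -> R).
Context (a : 'I_m -> R) (A : 'I_m -> 'M[R]_n) (L : nat).
Context (hn : (0 < n)%N) (halpha : 0 <= alpha < n%:R) (hm : 1 - alpha / n%:R < m%:R)
  (ha : forall i, 0 < a i) (hasum : \sum_i a i = n%:R - alpha)
  (hA : forall i, A i *m (A i)^T = 1%:M)
  (hA0 : alpha = 0 -> forall i j, i != j -> A i - A j \in unitmx).
Context (hp : log_hoelder_exponent p) (hq : log_hoelder_exponent q).
Context (pM qM : R) (sp : exponent_sup p = pM%:E) (sq : exponent_sup q = qM%:E).
Context (bp : alpha / n%:R * pM < 1) (bq : alpha / n%:R * qM < 1).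
Implicit Types (F G : schwartz R n -> R[i]).
Local Notation beta := (alpha / n%:R).
Local Notation b := (2 ^+ n : R).
Local Notation ratio := (@scale_ratio R n m).
Local Notation T := (rough_extension a A).
Local Notation u := (shifted_exponent n alpha p).
Local Notation v := (shifted_exponent n alpha q).
Local Notation rearr_max F l := (rearrangement (fun x => (l^-1)%:E * grand_maximal L F x)%E).

Let nR : 0 < n%:R :> R. Proof. by rewrite ltr0n. Qed.
Let b1 : 1 < b. Proof. by rewrite exprn_egt1 ?ltr1n// -lt0n. Qed.
Let beta0 : 0 <= beta. Proof. by case/andP: halpha => ? _; rewrite divr_ge0. Qed.
Let m0 : (0 < m)%N. Proof. exact: number_of_factors_gt0 halpha hasum. Qed.
Let ratio0 : 0 < ratio. Proof. by rewrite invr_gt0 mulr_gt0 ?ltr0n. Qed.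

Let rootK (t : R) : 0 < t -> (t `^ n%:R^-1) ^+ n = t.
Proof.
by move=> t0; rewrite -powR_mulrn ?powR_ge0// -powRrM mulVf ?gt_eqF// powRr1// ltW.
Qed.

(** The competitors in the infimum that defines the Hardy norm. *)
Definition admissible F (l : R) : Prop :=
  0 < l /\ (lorentz_modular p q (fun x => (l^-1)%:E * grand_maximal L F x) <= 1)%E.

(** In the variable [t = (r * ratio)^n] the lengths [2^k r] become [b^k t] with [b = 2^n], and the
    power [alpha] becomes [beta = alpha / n]. *)
Lemma tail_sum_dyadic F (t : R) : 0 < t ->
  tail_sum m alpha L F (t `^ n%:R^-1 / ratio) =
  ((ratio `^ (- alpha))%:E * \sum_(k <oo) ((b ^+ k * t) `^ beta)%:E *
      rearrangement (gauss_maximal L F) (b ^+ k * t)%R)%E.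
Proof.
move=> t0; have tn := rootK t0.
have r0 : 0 < t `^ n%:R^-1 / ratio by rewrite divr_gt0// powR_gt0.
rewrite -nneseriesZl; last first.
  by move=> k _; rewrite mule_ge0 ?rearrangement_ge0// lee_fin powR_ge0.
apply: eq_eseriesr => k _.
set w := 2 ^+ k * (t `^ n%:R^-1 / ratio).
have w0 : 0 < w by rewrite mulr_gt0 ?exprn_gt0.
have bk : (w * ratio) ^+ n = b ^+ k * t.
  by rewrite /w -mulrA divfK ?gt_eqF// exprMn tn -!exprM mulnC.
rewrite bk muleA -EFinM; congr (_%:E * _)%E.
rewrite -bk -(powR_mulrn n (ltW (mulr_gt0 w0 ratio0))) -powRrM [n%:R * _]mulrC divfK ?gt_eqF//.
rewrite (powRM _ (ltW w0) (ltW ratio0)) mulrCA -powRD ?(gt_eqF ratio0) ?implybT//.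
by rewrite addNr powRr0 mulr1.
Qed.

Lemma rearrangement_gauss_maximal_le : exists2 C : R, 0 < C & forall F l t,
  linear F -> 0 < l -> (rearrangement (gauss_maximal L F) t <= (C * l)%:E * rearr_max F l t)%E.
Proof.
have [C C0 HC] := @gauss_maximal_le_grand_maximal R n L.
exists C => // F l t lF l0; apply: rearrangement_le; first exact: mulr_gt0.
move=> x; rewrite muleA -EFinM -mulrA divff ?gt_eqF// mulr1; exact: HC.
Qed.

Lemma rough_extension_modular : exists2 K : R, 0 < K & forall F l,
  tempered_distribution F -> admissible F l ->
  [/\ (lorentz_modular u v (modulus (T F)) < +oo)%E,
      (lorentz_modular u v (fun x => ((K * l)^-1)%:E * modulus (T F) x) <= 1)%E &
      forall r, 0 < r -> (tail_sum m alpha L F r < +oo)%E].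
Proof.
have [C C0 [Lam Lam0 HT]] := rough_extension_rearrangement hn halpha hm ha hasum hA hA0 L.
have [Cg Cg0 Hg] := rearrangement_gauss_maximal_le.
have [e0 [e1 [q0 [q1 [v0 [v1 [delta [eM [qm [vM [Cp [Cq [Cv
  [[delta0 qm0 he0 he1] [he0M he1M] [hq0 hq1 hv0 hv1] good]]]]]]]]]]]]]] :=
  exponent_data beta0 hp hq sp sq bp bq.
(* The one-dimensional inequality asks for a dilation factor at least 1; it may be enlarged because
   rearrangements are nonincreasing. *)
pose Lam1 := Num.max 1 (Lam / ratio ^+ n).
have Lam11 : 1 <= Lam1 by rewrite le_max lexx.
pose D := C * (ratio `^ (- alpha) * Cg).
have D0 : 0 < D by rewrite !mulr_gt0 ?powR_gt0.
pose K := one_dimensional_const b Lam1 D delta eM qm vM Cp Cq Cv.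
have K0 : 0 < K by exact: one_dimensional_const_gt0 beta0 b1 D0 delta0 qm0 he0 he0M good.
exists K => // F l tF [l0 Hmod]; have lF := tF.1.
set H := rearr_max F l.
have H0 t : (0 <= H t)%E by exact: rearrangement_ge0.
have Hmono t t' : 0 < t <= t' -> (H t' <= H t)%E.
  by move=> /andP[_]; exact: rearrangement_nonincreasing.
pose N := rearrangement (modulus (T F)).
have N0 t : (0 <= N t)%E by exact: rearrangement_ge0.
have S0 t : (0 <= \sum_(k <oo) ((b ^+ k * t) `^ beta)%:E * H (b ^+ k * t)%R)%E.
  by apply: nneseries_ge0 => k _ _; rewrite mule_ge0// lee_fin powR_ge0.
have tail_le t : 0 < t -> (tail_sum m alpha L F (t `^ n%:R^-1 / ratio) <=
    (ratio `^ (- alpha) * (Cg * l))%:E *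
    \sum_(k <oo) ((b ^+ k * t) `^ beta)%:E * H (b ^+ k * t)%R)%E.
  move=> t0; rewrite tail_sum_dyadic// EFinM -muleA.
  apply: lee_wpmul2l; first by rewrite lee_fin powR_ge0.
  rewrite -nneseriesZl; last by move=> k _; rewrite mule_ge0// lee_fin powR_ge0.
  apply: lee_nneseries => k *.
    by rewrite mule_ge0 ?rearrangement_ge0// lee_fin powR_ge0.
  by rewrite muleCA; apply: lee_wpmul2l; [rewrite lee_fin powR_ge0|exact: Hg].
have HN t : 0 < t -> (N (Lam1 * t)%R <= (D * l)%:E *
    \sum_(k <oo) ((b ^+ k * t) `^ beta)%:E * H (b ^+ k * t)%R)%E.
  move=> t0; have r0 : 0 < t `^ n%:R^-1 / ratio by rewrite divr_gt0// powR_gt0.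
  apply: (@le_trans _ _ (N (Lam * (t `^ n%:R^-1 / ratio) ^+ n)%R)).
    apply: rearrangement_nonincreasing; rewrite expr_div_n mulrA mulrAC rootK//.
    by rewrite ler_wpM2r ?(ltW t0)// le_max lexx orbT.
  apply: (le_trans (HT F _ tF r0)).
  have -> : D * l = C * (ratio `^ (- alpha) * (Cg * l)) by rewrite /D; ring.
  by rewrite EFinM -muleA; apply: lee_wpmul2l; [rewrite lee_fin ltW|exact: tail_le].
have uE t : v t / u t = v t * ((p t)^-1 - beta) by rewrite /shifted_exponent invrK.
have modE g : lorentz_modular u v g = modular_rhs beta p v (rearrangement g).
  by apply: eq_integral => t _; rewrite uE.
(* For finiteness the constant may depend on [l], and [D * l] is used. For the bound by 1, [N] is
   first divided by [l], which leaves the constant [D], independent of [F] and [l]. *)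
have Dl0 : 0 < D * l by rewrite mulr_gt0.
split.
- rewrite modE; apply: le_lt_trans (modular_rhs_le beta0 b1 Lam11 Dl0 delta0 qm0 he0 he1
    he0M he1M hq0 hq1 hv0 hv1 good H0 Hmono Hmod N0 HN) _.
  exact: ltry.
- pose N1 t := ((l^-1)%:E * N t)%E.
  have N10 t : (0 <= N1 t)%E by rewrite mule_ge0// lee_fin invr_ge0 ltW.
  have HN1 t : 0 < t -> (N1 (Lam1 * t)%R <= D%:E *
      \sum_(k <oo) ((b ^+ k * t) `^ beta)%:E * H (b ^+ k * t)%R)%E.
    move=> t0; have -> : D%:E = ((l^-1)%:E * (D * l)%:E)%E.
      by rewrite -EFinM mulrC mulfK ?gt_eqF.
    rewrite -muleA; apply: lee_wpmul2l; first by rewrite lee_fin invr_ge0 ltW.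
    exact: HN.
  apply: le_trans (modular_rhs_scaled_le1 beta0 b1 Lam11 D0 delta0 qm0 he0 he1
    he0M he1M hq0 hq1 hv0 hv1 good H0 Hmono Hmod N10 HN1).
  rewrite modE /modular_rhs; apply: ae_le_ge0_integral.
  + by move=> t _; rewrite mule_ge0 ?poweR_ge0// lee_fin powR_ge0.
  + by move=> t _; rewrite mule_ge0 ?poweR_ge0// lee_fin powR_ge0.
  apply: ae_impl good => t gt; rewrite /= in_itv/= andbT => t0.
  have [_ _ _ [g1 g2 _]] := gt t0.
  apply: lee_wpmul2l; first by rewrite lee_fin powR_ge0.
  apply: gt0_ler_poweR; rewrite ?in_itv/= ?leey ?andbT ?rearrangement_ge0//.
  + by apply: le_trans g2; apply: le_trans g1; exact: ltW.
  + by rewrite mule_ge0// lee_fin invr_ge0 ltW.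
  rewrite /N1 muleA -EFinM -invfM; apply: rearrangement_le => //.
  by rewrite invr_gt0 mulr_gt0.
move=> r r0; pose t := (r * ratio) ^+ n.
have t0 : 0 < t by rewrite exprn_gt0// mulr_gt0.
have -> : r = t `^ n%:R^-1 / ratio.
  rewrite /t -powR_mulrn ?mulr_ge0 ?(ltW r0) ?(ltW ratio0)// -powRrM divff ?gt_eqF//.
  by rewrite powRr1 ?mulfK ?gt_eqF// mulr_ge0 ?ltW.
apply: (le_lt_trans (tail_le t t0)); apply: lte_mul_pinfty => //.
  by rewrite lee_fin !mulr_ge0 ?powR_ge0 ?ltW.
exact: (tail_lty beta0 b1 Lam11 delta0 qm0 he0 he1 he0M he1M good H0 Hmono Hmod t0).
Qed.


Lemma hardy_admissible F : hardy L p q F -> exists l, admissible F l.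
Proof.
move=> [_ /ereal_inf_lt[_ [l [l0 Hl] <-] _]].
by exists l.
Qed.

Lemma rough_extension_linear_ae (c : R[i]) F G : hardy L p q F -> hardy L p q G ->
  {ae lebesgue_rn n, forall x, T (c *: F + G) x = c * T F x + T G x}.
Proof.
move=> hF hG; have [K K0 HK] := rough_extension_modular.
have [l lF] := hardy_admissible hF; have [l' lG] := hardy_admissible hG.
have [tF _] := hF; have [tG _] := hG.
have [_ _ sF] := HK F l tF lF; have [_ _ sG] := HK G l' tG lG.
have iF := rough_extension_integrable_ae hn halpha hm ha hasum hA hA0 tF sF.
have iG := rough_extension_integrable_ae hn halpha hm ha hasum hA hA0 tG sG.
by move: iF iG; apply: filterS2 => x; exact: rough_extension_linear.
Qed.

Lemma rough_extension_bounded : exists C : R, forall F, hardy L p q F ->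
  lorentz u v (T F) /\ (lorentz_norm u v (modulus (T F)) <= C%:E * hardy_norm L p q F)%E.
Proof.
have [K K0 HK] := rough_extension_modular; exists K => F hF.
have [tF _] := hF; have [mr mi] := rough_extension_measurable a A tF.
split.
  have [l lF] := hardy_admissible hF; have [Too _ _] := HK F l tF lF.
  by split.
rewrite -lee_pdivrMl//; apply: le_ereal_inf_tmp => _ [l [l0 Hl] <-].
rewrite (lee_pdivrMl _ _ K0) -EFinM; apply: ereal_inf_lbound; exists (K * l) => //.
have [_ H _] := HK F l tF (conj l0 Hl).
by split; [exact: mulr_gt0|exact: H].
Qed.

(** [f] is replaced by a Borel representative; the distribution, the operator and its domain are
    given by integrals and do not notice. *)
Lemma rough_extension_Lebesgue (s : R) (f : 'cV[R]_n -> R[i]) :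
  1 < s -> alpha * s < n%:R -> Lebesgue_space s f ->
  {ae lebesgue_rn n, forall x, rough_operator_defined a A f x /\
     T (distribution_of f) x = rough_operator a A f x}.
Proof.
move=> s1 sn [[g1 [mg1 fg1]] [g2 [mg2 fg2]] foo].
pose g y := Complex (g1 y) (g2 y).
have fg : {ae lebesgue_rn n, forall y, f y = g y}.
  move: fg1 fg2; apply: filterS2 => y /(_ I) h1 /(_ I) h2.
  by rewrite /g -h1 -h2 /=; case: (f y).
have mg : complex_measurable g by [].
have mng := complex_measurable_norm mg.
have goo : (\int[lebesgue_rn n]_y (normc (g y) `^ s)%:E < +oo)%E.
  rewrite (ae_eq_integralW (g := fun y => (normc (f y) `^ s)%:E))//.
  by apply: filterS fg => y -> _.
have dE : distribution_of f = distribution_of g.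
  apply/funext => phi; congr Complex; congr fine; apply: ae_eq_integralW.
    by apply: filterS fg => y -> _.
  by apply: filterS fg => y -> _.
have opE x : rough_operator a A f x = rough_operator a A g x.
  congr Complex; congr fine; apply: ae_eq_integralW.
    by apply: filterS fg => y -> _.
  by apply: filterS fg => y -> _.
have defE x : rough_operator_defined a A g x -> rough_operator_defined a A f x.
  rewrite /rough_operator_defined (ae_eq_integralW (g := fun y =>
    (rough_kernel a A x y * normc (f y))%:E))//.
  by apply: filterS fg => y -> _.
have := rough_kernel_integrable_ae hn halpha hm ha hasum hA hA0 s1 sn mng
  (fun y => normc_ge0 (g y)) goo.
apply: filterS => x gx; split; first exact: defE.
rewrite dE opE; exact: (rough_extension_distribution hn halpha ha hasum hA mg gx).
Qed.

End boundedness.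

(** Clearing the denominator treats [alpha = 0], where the critical exponent is infinite, on the
    same footing. *)
Lemma lt_critical_exponent {R : realType} n (alpha s : R) : 0 <= alpha -> (0 < n)%N ->
  (s%:E < critical_exponent n alpha)%E -> alpha * s < n%:R.
Proof.
move=> a0 n0; rewrite /critical_exponent; case: eqP => [->|/eqP an0].
  by rewrite mul0r ltr0n.
by rewrite lte_fin ltr_pdivlMr 1?mulrC// lt_neqAle eq_sym an0.
Qed.

Theorem theorem35 (R : realType) (n m : nat) (alpha : R) (p q : R -> R)
    (a : 'I_m -> R) (A : 'I_m -> 'M[R]_n) (r : R) (L : nat)
    (halpha : 0 <= alpha < n%:R)
    (hm : 1 - alpha / n%:R < m%:R)
    (hp : log_hoelder_exponent p) (hq : log_hoelder_exponent q)
    (hp_sup : (0 < exponent_sup p < critical_exponent n alpha)%E)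
    (hq_sup : (0 < exponent_sup q < critical_exponent n alpha)%E)
    (hqp0 : exponent_at0 q <= exponent_at0 p)
    (hpqy : exponent_aty p <= exponent_aty q)
    (ha : forall i, 0 < a i) (hasum : \sum_i a i = n%:R - alpha)
    (hA : forall i, A i *m (A i)^T = 1%:M)
    (hA0 : alpha = 0 -> forall i j, i != j -> A i - A j \in unitmx)
    (hr : 0 < r < 1)
    (hrp : (r%:E < exponent_inf p)%E) (hrq : (r%:E < exponent_inf q)%E)
    (hL : Num.floor (n%:R / r + 3) <= L%:Z) :
  let u := shifted_exponent n alpha p in
  let v := shifted_exponent n alpha q in
  exists T : (schwartz R n -> R[i]) -> ('cV[R]_n -> R[i]),
    [/\ (* T is linear, with values taken modulo equality almost everywhere *)
        (forall (c : R[i]) (F G : schwartz R n -> R[i]),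
          hardy L p q F -> hardy L p q G ->
          {ae lebesgue_rn n, forall x,
            T (c *: F + G) x = c * T F x + T G x}),
        (exists C : R, forall F : schwartz R n -> R[i], hardy L p q F ->
          lorentz u v (T F) /\
          (lorentz_norm u v (modulus (T F)) <= C%:E * hardy_norm L p q F)%E) &
        forall (s : R) (f : 'cV[R]_n -> R[i]),
          1 < s -> (s%:E < critical_exponent n alpha)%E ->
          Lebesgue_space s f -> hardy L p q (distribution_of f) ->
          {ae lebesgue_rn n, forall x,
            rough_operator_defined a A f x /\
            T (distribution_of f) x = rough_operator a A f x}].
Proof.
move=> u v.
have a0 : 0 <= alpha by case/andP: halpha.
have n0 : (0 < n)%N.
  by rewrite -(ltr0n R); apply: le_lt_trans a0 _; case/andP: halpha.
have nR : 0 < n%:R :> R by rewrite ltr0n.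
have fin w : (0 < exponent_sup w < critical_exponent n alpha)%E -> log_hoelder_exponent w ->
    exists2 M : R, exponent_sup w = M%:E & alpha / n%:R * M < 1.
  move=> /andP[w0 wc] [_ [_ woo] _ _]; exists (fine (exponent_sup w)).
    by rewrite fineK// gt0_fin_numE.
  rewrite mulrAC ltr_pdivrMr// mul1r; apply: lt_critical_exponent => //.
  by rewrite fineK// gt0_fin_numE.
have [pM sp bp] := fin _ hp_sup hp; have [qM sq bq] := fin _ hq_sup hq.
exists (rough_extension a A); split.
- by move=> c F G; apply: (rough_extension_linear_ae n0 halpha hm ha hasum hA hA0 hp hq sp sq bp bq).
- exact: (rough_extension_bounded L n0 halpha hm ha hasum hA hA0 hp hq sp sq bp bq).
move=> s f s1 sc fs _; apply: (rough_extension_Lebesgue n0 halpha hm ha hasum hA hA0 s1 _ fs).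
exact: lt_critical_exponent sc.
Qed.
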